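(* Let $\Psi$ be a Young function with $\Psi(x)/x^2\downarrow 0$ as $x\downarrow 0$. Then there exists a singular inner function $\Theta$ such that the set $$\{z^n\Theta(z): n=0,1,2,\dots\}$$ has a dense linear span in $\ell^{\Psi}_a$.
   Context: $\mathbb{D}$ is the open unit disc, $\mathbb{T}$ the unit circle, $m$ normalized Lebesgue measure on $\mathbb{T}$. For a holomorphic function $f$ on $\mathbb{D}$, $(\widehat f(n))_{n\ge0}$ denotes its Taylor coefficients at $0$. A Young function is a convex function $\Psi$ on $[0,\infty)$ with $\Psi(0)=0$, $\Psi(x)>0$ for $x>0$, and $\Psi(2x)\asymp\Psi(x)$ as $x\to0$ (two-sided bounds with positive constants for small $x>0$). The notation $\Psi(x)/x^2\downarrow0$ as $x\downarrow0$ means that $\Psi(x)/x^2$ decreases monotonically to $0$ as $x$ decreases to $0$. The space $\ell^{\Psi}_a$ consists of all holomorphic $f$ on $\mathbb{D}$ with $\sum_{n=0}^\infty\Psi(|\widehat f(n)|)<\infty$, with norm $$\|f\|_\Psi=\inf\Big\{M>0:\sum_{n=0}^\infty\Psi\big(|\widehat f(n)|/M\big)\le1\Big\};$$ it is a separable Banach space in which the holomorphic polynomials are dense. A singular inner function is a function of the form $\Theta(z)=\exp\left(-\int_{\mathbb{T}}\frac{\zeta+z}{\zeta-z}\,d\nu(\zeta)\right)$, $z\in\mathbb{D}$, with $\nu$ a non-zero positive finite Borel measure on $\mathbb{T}$ singular with respect to $m$. *)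

(* Defs.v *)
From HB Require Import structures.
From mathcomp Require Import all_boot all_order all_algebra.
From mathcomp Require Import complex.
From mathcomp Require Import all_classical all_reals all_analysis.

Set Implicit Arguments.
Unset Strict Implicit.
Unset Printing Implicit Defensive.

Import Order.TTheory GRing.Theory Num.Theory.
Import numFieldNormedType.Exports.

Local Open Scope classical_set_scope.
Local Open Scope ring_scope.
Local Open Scope complex_scope.

(* R[i] has no topology of its own in the library; presented as a
   numFieldType, it gets the topology and the normed module structure (over
   itself) given by its modulus. *)
Definition Cplx (R : realType) : numFieldType := R[i].

Section Disc.
Context {R : realType}.
Implicit Types (f : Cplx R -> Cplx R) (z : Cplx R).

(* `|z| is the modulus seen as a complex number; this is the real one. *)
Definition modulus z : R := complex.Re (`|z| : R[i]).

Definition disc : set (Cplx R) := [set z | `|z| < 1].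

(* Functions on the disc are represented by total functions, whose values
   outside the disc are irrelevant. *)
Definition holomorphic_on_disc f := forall z, disc z -> derivable f z 1.

Definition taylor_coef f (n : nat) : Cplx R := derive1n n f 0 / n`!%:R.

Definition expC z : Cplx R :=
  (expR (complex.Re z))%:C *
    (cos (complex.Im z) +i* sin (complex.Im z)) :> R[i].

End Disc.

Section Circle.
Context (R : realType).

Definition circle : Type := set_type [set z : Cplx R | `|z| = 1].

HB.instance Definition _ := Topological.on circle.

Lemma expi_on_circle (t : R) :
  (cos t +i* sin t : Cplx R) \in [set z : Cplx R | `|z| = 1].
Proof. by rewrite inE /= normc_def /= cos2Dsin2 sqrtr1. Qed.

Definition expi (t : R) : circle :=
  exist _ (cos t +i* sin t : Cplx R) (expi_on_circle t).

HB.instance Definition _ := isPointed.Build circle (expi 0).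

Definition borel_circle : Type := g_sigma_algebraType (@open circle).

HB.instance Definition _ := Measurable.on borel_circle.

End Circle.

Section SingularInner.
Context {R : realType}.

Definition circle_lebesgue (A : set (borel_circle R)) : \bar R :=
  (((2 * pi)^-1)%:E *
     lebesgue_measure (`[0%R, (2 * pi)%R[ `&` (@expi R) @^-1` A))%E.

Definition circle_integral (nu : {measure set (borel_circle R) -> \bar R})
    (F : borel_circle R -> Cplx R) : Cplx R :=
  (\int[nu]_zeta complex.Re (F zeta)) +i* (\int[nu]_zeta complex.Im (F zeta)).

Definition singular_to_lebesgue
    (nu : {measure set (borel_circle R) -> \bar R}) :=
  exists A : set (borel_circle R),
    [/\ measurable A, circle_lebesgue A = 0%E & nu (~` A) = 0%E].

Definition singular_inner (Theta : Cplx R -> Cplx R) :=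
  exists nu : {finite_measure set (borel_circle R) -> \bar R},
    [/\ nu [set: borel_circle R] != 0%E,
        singular_to_lebesgue nu &
        forall z, disc z ->
          Theta z = expC (- circle_integral nu (fun zeta =>
            (val zeta + z) / (val zeta - z)))].

End SingularInner.

Section Orlicz.
Context {R : realType}.
Implicit Types (Psi : R -> R) (f g : Cplx R -> Cplx R).

(* Only the values of Psi on the nonnegative half-line matter. *)
Definition young_function Psi :=
  [/\ convex_function (`[0, +oo[%classic : set R) Psi,
      Psi 0 = 0,
      forall x, 0 < x -> 0 < Psi x &
      exists c C : R, [/\ 0 < c, 0 < C &
        \forall x \near 0^'+, c * Psi x <= Psi (2 * x) <= C * Psi x]].

(* Monotonicity is required on some right neighbourhood of 0 only. *)
Definition decreases_to_0_at_0 (h : R -> R) :=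
  (exists2 delta : R, 0 < delta &
     {in `]0, delta[ &, {homo h : x y / x <= y}}) /\
  h x @[x --> 0^'+] --> (0 : R).

Definition modular Psi f (M : R) : \bar R :=
  (\sum_(0 <= n <oo) (Psi (modulus (taylor_coef f n) / M))%:E)%E.

Definition orlicz_space Psi : set (Cplx R -> Cplx R) :=
  [set f | holomorphic_on_disc f /\
    (\sum_(0 <= n <oo) (Psi (modulus (taylor_coef f n)))%:E < +oo)%E].

Definition orlicz_norm Psi f : \bar R :=
  ereal_inf [set M%:E | M in [set M : R | 0 < M /\ (modular Psi f M <= 1)%E]].

Definition linear_span (S : set (Cplx R -> Cplx R)) :
    set (Cplx R -> Cplx R) :=
  [set g | exists (n : nat) (a : 'I_n -> Cplx R)
      (F : 'I_n -> Cplx R -> Cplx R),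
     (forall i, S (F i)) /\ g = (fun z => \sum_(i < n) a i * F i z)].

Definition dense_in_orlicz Psi (A : set (Cplx R -> Cplx R)) :=
  A `<=` orlicz_space Psi /\
  forall f, orlicz_space Psi f -> forall eps : R, 0 < eps ->
    exists2 g, A g & (orlicz_norm Psi (f \- g)%R < eps%:E)%E.

End Orlicz.

(* Main.v *)
From HB Require Import structures.
Require Import Defs.
From mathcomp Require Import all_boot all_order all_algebra.
From mathcomp Require Import complex.
From mathcomp Require Import all_classical all_reals all_analysis.
From mathcomp Require Import ring lra.

Set Implicit Arguments.
Unset Strict Implicit.
Unset Printing Implicit Defensive.

Import Order.TTheory GRing.Theory Num.Theory.
Import numFieldNormedType.Exports.

Local Open Scope classical_set_scope.
Local Open Scope ring_scope.
Local Open Scope complex_scope.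

(** Write [Theta = exp (- H)], where [H] is the integral of the kernel
[(zeta + z) / (zeta - z)] against a probability measure on the circle that has
to be constructed. Suppose that, for every [k], a function [F_k] that is entire
(hence uniformly close to a polynomial on the disc) makes all Taylor
coefficients of [1 - F_k Theta] at most [D_k] in modulus, while
[sup |F_k| <= C_k] on the disc and [D_k] is tiny compared with [C_k]. Then
[F_k Theta] tends to [1] in the Orlicz space: the coefficients [c_n] satisfy
[sum |c_n|^2 <= const * C_k^2] by the Bessel inequality, and for [y <= const * D_k]
the quotient [Psi y / y^2] is as small as desired, so that [sum Psi (|c_n|)] is
small. Multiplying by a fixed polynomial only changes constants, so the closed
span of the [z^n Theta] contains the polynomials and therefore everything
([near_one], [span_approx]).

The functions are [F_k = exp H_k], where the [H_k] are polynomials with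
[H_k(0) = 1] and positive real part [f_k] on the circle, and the measure is the weak
limit of [f_k dm]. Once [H_k] is chosen, [C_k] is known, and [D_k] is fixed
accordingly. All later changes are of the form [H_{j+1} = H_j + z^K G]: they do
not move the coefficients of order less than [K] of [exp (H_k - H_{j+1})], and they are
made so gently that the coefficients of order at least [K] stay below [D_k], for all
[k <= j] at once. Since [exp (H_k - H_k) = 1] has no coefficient of positive
order, every coefficient of positive order of [F_k Theta] is at most [D_k]
([anchor_coef]).

For the limit measure to be singular, [f_{k+1}] has to be at most [eps_k] outside a
set of measure [eps_k]. This is reached by many steps that replace [H] by [H + d z^K B],
where [|B|] on the circle is the bump [b = f (1 - f / n)^n], which lies between
[0] and [min 1 f], so that positivity of the real part persists for [d < 1].
The potential, which is the mean of [exp (- f)] and never exceeds [1], grows in such a step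
by about [d^2 / 8] times the mean of [exp (- f) b^2]: the terms of first order oscillate
with frequency [K] and vanish in the limit. So there is a definite gain as long as [f] is
not concentrated, and after finitely many steps it is ([step_gain],
[concentrated_or_gain], [stage]). Large frequencies also make the primitives of
successive [f_k] close to each other; this gives the weak limit and shows that the
limit measure of the set [f_{k+1} < eps_k] is at most [6 eps_k]. Almost every point of the
limit measure thus lies in infinitely many sets [f_{k+1} >= eps_k], and
these points form a Lebesgue null set by the lemma of Borel and Cantelli ([nuP_singular]).

The function theory rests on complex differentiability alone: the theorem of Goursat on
rectangles, transported by the exponential, says that means over concentric circles agree
([mean_annulus]); the Cauchy formula, Taylor expansions, the Bessel inequality
for coefficients and the maximum principle follow. *)

(** * Integrals of continuous real functions *)

Section RealIntegral.
Context {R : realType}.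
Implicit Types (f g : R -> R) (a b c : R).

(** Continuity is wrapped in an inductive type, so that a continuity goal is never
unfolded to a statement about filters. *)
Variant rcont f : Prop := RCont of continuous f.

Lemma rcontE f : rcont f -> continuous f. Proof. by case. Qed.
Lemma rcont_cst c : rcont (fun=> c).
Proof. by split => x; exact: cvg_cst. Qed.
Lemma rcont_id : rcont (fun x => x).
Proof. by split => x; exact: cvg_id. Qed.
Lemma rcontD f g : rcont f -> rcont g -> rcont (fun x => f x + g x).
Proof. by move=> [cf] [cg]; split => x; apply: cvgD; [exact: cf|exact: cg]. Qed.
Lemma rcontM f g : rcont f -> rcont g -> rcont (fun x => f x * g x).
Proof. by move=> [cf] [cg]; split => x; apply: cvgM; [exact: cf|exact: cg]. Qed.
Lemma rcontN f : rcont f -> rcont (fun x => - f x).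
Proof. by move=> [cf]; split => x; apply: cvgN; exact: cf. Qed.
Lemma rcontB f g : rcont f -> rcont g -> rcont (fun x => f x - g x).
Proof. by move=> cf cg; apply: rcontD => //; exact: rcontN. Qed.
Lemma rcontX f n : rcont f -> rcont (fun x => f x ^+ n).
Proof.
move=> cf; elim: n => [|n ih]; first exact: rcont_cst.
have [] := rcontM cf ih; split.
by rewrite (_ : (fun x => f x ^+ n.+1) = (fun x => f x * f x ^+ n))//; apply/funext => x; rewrite exprS.
Qed.
Lemma rcont_comp f g : continuous f -> rcont g -> rcont (fun x => f (g x)).
Proof. by move=> cf [cg]; split => x; apply: continuous_comp; [exact: cg|exact: cf]. Qed.

Definition Rint a b f : R := \int[lebesgue_measure]_(x in `[a, b]) f x.

Lemma cont_integrable a b f : rcont f ->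
  lebesgue_measure.-integrable `[a, b] (EFin \o f).
Proof.
move=> [cf]; apply: continuous_compact_integrable; first exact: segment_compact.
exact: continuous_subspaceT.
Qed.

Lemma RintD a b f g : rcont f -> rcont g ->
  Rint a b (fun x => f x + g x) = Rint a b f + Rint a b g.
Proof. by move=> cf cg; rewrite /Rint RintegralD//; exact: cont_integrable. Qed.

Lemma RintZ a b c f : rcont f -> Rint a b (fun x => c * f x) = c * Rint a b f.
Proof. by move=> cf; rewrite /Rint RintegralZl//; exact: cont_integrable. Qed.

Lemma Rint_cst a b c : a <= b -> Rint a b (fun=> c) = c * (b - a).
Proof.
move=> ab; rewrite /Rint Rintegral_cst//= lebesgue_measure_itv/= lte_fin.
case: ltP => [//|ba]; have -> : a = b by apply/le_anti/andP.
by rewrite subrr.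
Qed.

Lemma le_Rint a b f g : rcont f -> rcont g ->
  (forall x, a <= x <= b -> f x <= g x) -> Rint a b f <= Rint a b g.
Proof.
move=> cf cg fg; apply: le_Rintegral; try exact: cont_integrable.
  by [].
by move=> x /=; rewrite in_itv/=; exact: fg.
Qed.

Lemma Rint_ge0 a b f : (forall x, a <= x <= b -> 0 <= f x) -> 0 <= Rint a b f.
Proof. by move=> f0; apply: Rintegral_ge0 => x /=; rewrite in_itv/=; exact: f0. Qed.

Lemma eq_Rint a b f g : (forall x, a <= x <= b -> f x = g x) -> Rint a b f = Rint a b g.
Proof.
by move=> fg; apply: eq_Rintegral => x; rewrite inE/= in_itv/=; exact: fg.
Qed.

Lemma RintN a b f : rcont f -> Rint a b (fun x => - f x) = - Rint a b f.
Proof.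
move=> cf; rewrite -mulN1r -RintZ//; apply: eq_Rint => x _; by rewrite mulN1r.
Qed.

Lemma RintB a b f g : rcont f -> rcont g ->
  Rint a b (fun x => f x - g x) = Rint a b f - Rint a b g.
Proof. by move=> cf cg; rewrite /Rint RintegralB//; exact: cont_integrable. Qed.

Lemma Rint_split a b c f : a <= b -> b <= c -> rcont f ->
  Rint a c f = Rint a b f + Rint b c f.
Proof.
move=> ab bc cf; have ic := cont_integrable a c cf.
have := @Rintegral_itvB R f (BLeft a) (BRight c) b ic; rewrite !bnd_simp => /(_ ab bc).
rewrite -/(Rint a c f) -/(Rint a b f) => E.
rewrite /Rint in E *.
rewrite -[X in _ + X]Rintegral_itv_obnd_cbnd ?(cont_integrable) -?E//; last first.
  apply: integrableS ic => //; apply: subset_itv; rewrite bnd_simp//.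
by rewrite addrC subrK.
Qed.

Lemma Rint_FTC a b f F : a <= b -> rcont f ->
  (forall x, is_derive x (1 : R) F (f x)) -> Rint a b f = F b - F a.
Proof.
move=> ab [cf] dF; move: ab; rewrite le_eqVlt => /predU1P[<-|ab].
  by rewrite /Rint set_itv1 Rintegral_set1 subrr.
have cF : continuous F.
  by move=> x; apply/differentiable_continuous/derivable1_diffP; have [] := dF x.
rewrite /Rint /Rintegral (@continuous_FTC2 R f F a b)//=.
- by apply: continuous_subspaceT.
- split; first by move=> x _; have [] := dF x.
    by apply: cvg_at_right_filter; exact: cF.
  by apply: cvg_at_left_filter; exact: cF.
- by move=> x _; rewrite derive1E; have [_ ->] := dF x.
Qed.

End RealIntegral.

(** * The complex plane *)

Section ComplexBasics.
Context {R : realType}.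
Local Notation C := (Cplx R).
Implicit Types (x y z w : C) (r : R).

Definition rC r : C := r%:C.
Definition reC z : R := complex.Re z.
Definition imC z : R := complex.Im z.
Definition iC : C := 'i.
Definition cjC z : C := z^*.
Definition mkC (a b : R) : C := a +i* b.

Lemma normE z : `|z| = rC (modulus z).
Proof. by case: z. Qed.

Lemma modulusE z : modulus z = Num.sqrt (reC z ^+ 2 + imC z ^+ 2).
Proof. by case: z. Qed.

Lemma eq_reim z w : reC z = reC w -> imC z = imC w -> z = w.
Proof. by case: z => a b; case: w => c d /= -> ->. Qed.

Lemma reD z w : reC (z + w) = reC z + reC w. Proof. by case: z; case: w. Qed.
Lemma imD z w : imC (z + w) = imC z + imC w. Proof. by case: z; case: w. Qed.
Lemma reN z : reC (- z) = - reC z. Proof. by case: z. Qed.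
Lemma imN z : imC (- z) = - imC z. Proof. by case: z. Qed.
Lemma reB z w : reC (z - w) = reC z - reC w. Proof. by rewrite reD reN. Qed.
Lemma imB z w : imC (z - w) = imC z - imC w. Proof. by rewrite imD imN. Qed.
Lemma reM z w : reC (z * w) = reC z * reC w - imC z * imC w.
Proof. by case: z; case: w. Qed.
Lemma imM z w : imC (z * w) = reC z * imC w + imC z * reC w.
Proof. by case: z; case: w. Qed.
Lemma reR r : reC (rC r) = r. Proof. by []. Qed.
Lemma imR r : imC (rC r) = 0. Proof. by []. Qed.
Lemma re_i : reC iC = 0. Proof. by []. Qed.
Lemma im_i : imC iC = 1. Proof. by []. Qed.
Lemma re0 : reC 0 = 0. Proof. by []. Qed.
Lemma im0 : imC 0 = 0. Proof. by []. Qed.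
Lemma re1 : reC 1 = 1. Proof. by []. Qed.
Lemma im1 : imC 1 = 0. Proof. by []. Qed.
Lemma re_mk a b : reC (mkC a b) = a. Proof. by []. Qed.
Lemma im_mk a b : imC (mkC a b) = b. Proof. by []. Qed.
Lemma re_cj z : reC (cjC z) = reC z. Proof. by case: z. Qed.
Lemma im_cj z : imC (cjC z) = - imC z. Proof. by case: z. Qed.
Definition reimE := (reD, imD, reN, imN, reM, imM, reR, imR, re_i, im_i, re0, im0, re1, im1,
  re_mk, im_mk, re_cj, im_cj).

Lemma rCD (a b : R) : rC (a + b) = rC a + rC b. Proof. exact: rmorphD. Qed.
Lemma rCB (a b : R) : rC (a - b) = rC a - rC b. Proof. exact: rmorphB. Qed.
Lemma rCM (a b : R) : rC (a * b) = rC a * rC b. Proof. exact: rmorphM. Qed.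
Lemma rC0 : rC 0 = 0. Proof. by []. Qed.
Lemma rC1 : rC 1 = 1. Proof. by []. Qed.
Lemma rCV (a : R) : rC a^-1 = (rC a)^-1. Proof. exact: (fmorphV (real_complex R)). Qed.
Lemma rCX (a : R) n : rC (a ^+ n) = rC a ^+ n. Proof. exact: (rmorphXn (real_complex R)). Qed.
Lemma rCn n : rC n%:R = n%:R. Proof. exact: (rmorph_nat (real_complex R)). Qed.
Lemma rC_eq0 (a : R) : (rC a == 0) = (a == 0).
Proof. by rewrite (fmorph_eq0 (real_complex R)). Qed.

Lemma mkCE a b : mkC a b = rC a + iC * rC b.
Proof. by apply: eq_reim; rewrite !reimE; ring. Qed.

Lemma ReImE z : z = mkC (reC z) (imC z). Proof. by case: z. Qed.

Lemma modulus_ge0 z : 0 <= modulus z.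
Proof. by rewrite modulusE sqrtr_ge0. Qed.
Hint Resolve modulus_ge0 : core.

Lemma modulus_sq z : modulus z ^+ 2 = reC z ^+ 2 + imC z ^+ 2.
Proof. by rewrite modulusE sqr_sqrtr// addr_ge0// sqr_ge0. Qed.

Lemma rC_inj : injective rC. Proof. exact: complexI. Qed.
Lemma le_rC (a b : R) : (rC a <= rC b) = (a <= b). Proof. exact: lecR. Qed.
Lemma lt_rC (a b : R) : (rC a < rC b) = (a < b). Proof. exact: ltcR. Qed.

Lemma modulusM z w : modulus (z * w) = modulus z * modulus w.
Proof. by apply: rC_inj; rewrite rCM -!normE normrM. Qed.
Lemma modulusN z : modulus (- z) = modulus z.
Proof. by apply: rC_inj; rewrite -!normE normrN. Qed.
Lemma modulus0 : modulus (0 : C) = 0.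
Proof. by apply: rC_inj; rewrite -!normE normr0. Qed.
Lemma modulus1 : modulus (1 : C) = 1.
Proof. by apply: rC_inj; rewrite -!normE normr1. Qed.
Lemma modulusV z : modulus (z^-1) = (modulus z)^-1.
Proof. by apply: rC_inj; rewrite rCV -!normE normfV. Qed.
Lemma modulusX z n : modulus (z ^+ n) = modulus z ^+ n.
Proof. by apply: rC_inj; rewrite rCX -!normE normrX. Qed.
Lemma modulusD z w : modulus (z + w) <= modulus z + modulus w.
Proof. by rewrite -le_rC rCD -!normE ler_normD. Qed.
Lemma modulusB z w : modulus (z - w) <= modulus z + modulus w.
Proof. by rewrite -(modulusN w) modulusD. Qed.
Lemma modulusC z w : modulus (z - w) = modulus (w - z).
Proof. by rewrite -modulusN opprB. Qed.
Lemma modulus_tri z w y : modulus (z - w) <= modulus (z - y) + modulus (y - w).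
Proof. by have := modulusD (z - y) (y - w); rewrite addrA subrK. Qed.
Lemma modulus_eq0 z : (modulus z == 0) = (z == 0).
Proof. by rewrite -[z == 0]normr_eq0 normE rC_eq0. Qed.
Lemma modulus_gt0 z : (0 < modulus z) = (z != 0).
Proof. by rewrite lt_neqAle modulus_ge0 andbT eq_sym modulus_eq0. Qed.
Lemma modulusR r : modulus (rC r) = `|r|.
Proof. by rewrite modulusE reR imR expr0n addr0 sqrtr_sqr. Qed.
Lemma modulus_i : modulus iC = 1.
Proof. by rewrite modulusE re_i im_i expr0n add0r expr1n sqrtr1. Qed.
Lemma modulus_nat n : modulus (n%:R : C) = n%:R.
Proof. by rewrite -rCn modulusR ger0_norm. Qed.
Lemma le_re z : `|reC z| <= modulus z.
Proof. by rewrite modulusE -sqrtr_sqr ler_sqrt ?lerDl ?addr_ge0 ?sqr_ge0. Qed.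
Lemma le_im z : `|imC z| <= modulus z.
Proof. by rewrite modulusE -sqrtr_sqr ler_sqrt ?lerDr ?addr_ge0 ?sqr_ge0. Qed.
Lemma re_le z : reC z <= modulus z.
Proof. exact: le_trans (ler_norm _) (le_re _). Qed.
Lemma modulus_le z : modulus z <= `|reC z| + `|imC z|.
Proof.
rewrite {1}[z]ReImE mkCE (le_trans (modulusD _ _))//.
by rewrite modulusM modulus_i mul1r !modulusR.
Qed.
Lemma modulus_sum (I : Type) (s : seq I) (P : pred I) (F : I -> C) :
  modulus (\sum_(i <- s | P i) F i) <= \sum_(i <- s | P i) modulus (F i).
Proof.
elim/big_ind2 : _ => [|z a w b za wb|//]; first by rewrite modulus0.
by rewrite (le_trans (modulusD _ _))// lerD.
Qed.
Lemma modulus_subD z w : modulus z - modulus w <= modulus (z - w).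
Proof. by rewrite lerBlDr; have := modulusD (z - w) w; rewrite subrK. Qed.
Lemma modulus_cj z : modulus (cjC z) = modulus z.
Proof. by rewrite !modulusE re_cj im_cj sqrrN. Qed.
Lemma mul_cj z : z * cjC z = rC (modulus z ^+ 2).
Proof. by rewrite modulus_sq; apply: eq_reim; rewrite !reimE; ring. Qed.
Lemma cjD z w : cjC (z + w) = cjC z + cjC w. Proof. exact: rmorphD. Qed.
Lemma cjM z w : cjC (z * w) = cjC z * cjC w. Proof. exact: rmorphM. Qed.
Lemma cjX z n : cjC (z ^+ n) = cjC z ^+ n. Proof. exact: (rmorphXn (@conjc R)). Qed.

Lemma cjR r : cjC (rC r) = rC r.
Proof. by apply: eq_reim; rewrite !reimE ?oppr0. Qed.

Lemma discP z : disc z <-> modulus z < 1.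
Proof. by rewrite /disc/= normE -rC1 lt_rC. Qed.

Lemma posC (e : C) : 0 < e -> exists2 d : R, 0 < d & e = rC d.
Proof.
case: e => a b; rewrite ltcE/= => /andP[/eqP -> a0]; by exists a.
Qed.

Lemma nearCP (x : C) (P : set C) :
  (\forall y \near x, P y) <-> exists2 d : R, 0 < d & forall y, modulus (y - x) < d -> P y.
Proof.
split.
  move=> /nbhs_ballP[e /= /posC[d d0 ->] h]; exists d => // y yd; apply: h.
  by rewrite /ball/= normE lt_rC modulusC.
move=> [d d0 h]; apply/nbhs_ballP; exists (rC d) => /=; first by rewrite -rC0 lt_rC.
by move=> y; rewrite /ball/= normE lt_rC modulusC; exact: h.
Qed.

Lemma nearRP (x : R) (P : set R) :
  (\forall y \near x, P y) <-> exists2 d : R, 0 < d & forall y : R, `|y - x| < d -> P y.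
Proof.
split.
  move=> /nbhs_ballP[e /= e0 h]; exists e => // y yd; apply: h.
  by rewrite /ball/= distrC.
move=> [d d0 h]; apply/nbhs_ballP; exists d => //=.
by move=> y; rewrite /ball/= distrC; exact: h.
Qed.

Lemma cvgCP (T : Type) (F : set_system T) {FF : Filter F} (f : T -> C) (l : C) :
  (f @ F --> l) <-> forall e : R, 0 < e -> \forall t \near F, modulus (f t - l) < e.
Proof.
split.
  move=> /cvgrPdist_lt h e e0; have := h (rC e); rewrite -rC0 lt_rC => /(_ e0).
  by apply: filterS => t; rewrite normE lt_rC modulusC.
move=> h; apply/cvgrPdist_lt => e /posC[d d0 ->]; move: (h d d0).
by apply: filterS => t; rewrite normE lt_rC modulusC.
Qed.

Lemma contCP (f : C -> C) x : {for x, continuous f} <->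
  forall e : R, 0 < e -> exists2 d : R, 0 < d & forall y, modulus (y - x) < d -> modulus (f y - f x) < e.
Proof.
have H := @cvgCP _ (nbhs x) _ f (f x).
split => [/H h e /h/nearCP//|h]; apply/H => e /h ?; exact/nearCP.
Qed.

Lemma contRCP (f : R -> C) (x : R) : {for x, continuous f} <->
  forall e : R, 0 < e -> exists2 d : R, 0 < d & forall y : R, `|y - x| < d -> modulus (f y - f x) < e.
Proof.
have H := @cvgCP _ (nbhs x) _ f (f x).
split => [/H h e /h/nearRP//|h]; apply/H => e /h ?; exact/nearRP.
Qed.

Lemma cvgRP (T : Type) (F : set_system T) {FF : Filter F} (f : T -> R) (l : R) :
  (f @ F --> l) <-> forall e : R, 0 < e -> \forall t \near F, `|f t - l| < e.
Proof.
split=> [/cvgrPdist_lt h e /h|h].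
  by apply: filterS => t; rewrite distrC.
by apply/cvgrPdist_lt => e /h; apply: filterS => t; rewrite distrC.
Qed.

Lemma contCR_lip (f : C -> R) : (forall x y, `|f y - f x| <= modulus (y - x)) ->
  continuous f.
Proof.
move=> h x; apply/(@cvgRP _ (nbhs x)) => e e0; apply/nearCP; exists e => // y.
exact: le_lt_trans.
Qed.

Lemma cont_reC : continuous reC.
Proof. by apply: contCR_lip => x y; rewrite -reB le_re. Qed.
Lemma cont_imC : continuous imC.
Proof. by apply: contCR_lip => x y; rewrite -imB le_im. Qed.
Lemma cont_modulus : continuous (@modulus R).
Proof.
apply: contCR_lip => x y; have := modulus_subD x y; have := modulus_subD y x.
by rewrite (modulusC x y) ler_norml => *; lra.
Qed.

Lemma cont_mkC (T : topologicalType) (a b : T -> R) : continuous a -> continuous b ->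
  continuous (fun t => mkC (a t) (b t)).
Proof.
move=> ca cb t; apply/(@cvgCP _ (nbhs t)) => e e0.
have e20 : 0 < e / 2 by rewrite divr_gt0.
near=> u; rewrite (le_lt_trans (modulus_le _))// !reimE (splitr e) ltrD//.
- by near: u; have /(@cvgRP _ (nbhs t))/(_ _ e20) := ca t.
- by near: u; have /(@cvgRP _ (nbhs t))/(_ _ e20) := cb t.
Unshelve. all: by end_near. Qed.

End ComplexBasics.
#[export] Hint Resolve modulus_ge0 : core.

(** * Complex derivatives and the exponential *)

Section Deriv.
Context {R : realType}.
Local Notation C := (Cplx R).

(** Differentiability as an estimate without division, which is the form used below. *)
Lemma derivP (K : numFieldType) (f : K -> K) (z l : K) : is_derive z (1 : K) f l <->
  forall e : K, 0 < e -> \forall h \near (0 : K), `|f (z + h) - f z - l * h| <= e * `|h|.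
Proof.
have key : (forall e : K, 0 < e -> \forall h \near (0 : K), `|f (z + h) - f z - l * h| <= e * `|h|) <->
    (fun h => h^-1 *: ((f \o shift z) (h *: (1:K)) - f z)) @ 0^' --> l.
  have E (x A : K) : x != 0 -> (`|l - x^-1 * A| * `|x| = `|A - l * x|).
    by move=> x0; rewrite -normrM mulrBl mulrAC mulVf// mul1r distrC.
  split.
    move=> h; apply/cvgrPdist_le => e /h; rewrite near_withinE.
    apply: filterS => x + x0; rewrite /= [x *: _]mulr1 => H.
    by rewrite -(ler_pM2r (x := `|x|)) ?normr_gt0// E// (addrC x).
  move/cvgrPdist_le => h e /h; rewrite near_withinE; apply: filterS => x H.
  have [->|x0] := eqVneq x 0; first by rewrite addr0 subrr mulr0 subrr normr0 mulr0.
  move: (H x0); rewrite /= [x *: _]mulr1 -(ler_pM2r (x := `|x|)) ?normr_gt0// E//.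
  by rewrite (addrC x).
split=> [[df dv]|/key h].
  by apply/key; rewrite -dv; exact: df.
split; first by apply/cvg_ex; exists l.
exact: cvg_lim.
Qed.

Lemma cderivP (f : C -> C) (z l : C) : is_derive z (1 : C) f l <->
  forall e : R, 0 < e -> exists2 d : R, 0 < d &
    forall h, modulus h < d -> modulus (f (z + h) - f z - l * h) <= e * modulus h.
Proof.
split.
  move/derivP => H e e0; have := H (rC e); rewrite -rC0 lt_rC => /(_ e0)/nearCP[d d0 h].
  exists d => // x xd; have := h x; rewrite subr0 => /(_ xd).
  by rewrite !normE -rCM le_rC.
move=> H; apply/derivP => e /posC[r /H[d d0 h] ->]; apply/nearCP; exists d => // x.
by rewrite subr0 => /h; rewrite !normE -rCM le_rC.
Qed.

Lemma rderivP (f : R -> R) (z l : R) : is_derive z (1 : R) f l <->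
  forall e : R, 0 < e -> exists2 d : R, 0 < d &
    forall h, `|h| < d -> `|f (z + h) - f z - l * h| <= e * `|h|.
Proof.
split.
  move/derivP => H e /H/nearRP[d d0 h]; exists d => // x xd; have := h x.
  by rewrite subr0; exact.
move=> H; apply/derivP => e /H[d d0 h]; apply/nearRP; exists d => // x.
by rewrite subr0; exact: h.
Qed.

Lemma derivable_cont (f : C -> C) z : derivable f z 1 -> {for z, continuous f}.
Proof. by move=> /derivable1_diffP/differentiable_continuous. Qed.

Lemma derivable_compC (f g : C -> C) z :
  derivable f z 1 -> derivable g (f z) 1 -> derivable (fun x => g (f x)) z 1.
Proof.
move=> /derivable1_diffP df /derivable1_diffP dg; apply/derivable1_diffP.
exact: (differentiable_comp df dg).
Qed.

Lemma expC0 : expC (0 : C) = 1.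
Proof. by rewrite /expC /= expR0 cos0 sin0 mul1r. Qed.

Lemma expCE (z : C) : expC z = mkC (expR (reC z) * cos (imC z)) (expR (reC z) * sin (imC z)).
Proof.
have -> : expC z = rC (expR (reC z)) * mkC (cos (imC z)) (sin (imC z)) by [].
by apply: eq_reim; rewrite !reimE; ring.
Qed.

Lemma expCD (z w : C) : expC (z + w) = expC z * expC w.
Proof.
rewrite !expCE; apply: eq_reim; rewrite !reimE expRD ?cosD ?sinD; ring.
Qed.

Lemma modulus_expC (z : C) : modulus (expC z) = expR (reC z).
Proof.
rewrite expCE mkCE modulusE !reimE.
have -> : forall a b c : R, (a * b + (0 * (a * c) - 1 * 0)) ^+ 2 + (0 + (0 * 0 + 1 * (a * c))) ^+ 2
  = a ^+ 2 * (b ^+ 2 + c ^+ 2) by move=> *; ring.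
by rewrite cos2Dsin2 mulr1 sqrtr_sqr ger0_norm// expR_ge0.
Qed.

Lemma expC_neq0 (z : C) : expC z != 0.
Proof. by rewrite -modulus_gt0 modulus_expC expR_gt0. Qed.


(** Real and imaginary parts of [exp h - 1 - h] are combinations of the errors of
[expR], [cos] and [sin] at [0] and of the product of the parts of [h]. *)
Lemma is_derive_expC0 : is_derive (0 : C) (1 : C) (@expC R) 1.
Proof.
apply/cderivP => e e0.
have [e' e'0 [e'1 e'2]] : exists2 e' : R, 0 < e' & e' <= e / 10 /\ e' <= 1 / 4.
  exists (Num.min (e / 10) (1 / 4)); first by rewrite lt_min !divr_gt0.
  by rewrite !ge_min !lexx orbT.
have /rderivP/(_ _ e'0)[d1 d10 h1] : is_derive (0:R) (1:R) expR 1.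
  by apply: is_derive_eq; rewrite expR0.
have /rderivP/(_ _ e'0)[d2 d20 h2] : is_derive (0:R) (1:R) cos 0.
  by apply: is_derive_eq; rewrite sin0 oppr0.
have /rderivP/(_ _ e'0)[d3 d30 h3] : is_derive (0:R) (1:R) sin 1.
  by apply: is_derive_eq; rewrite cos0.
exists (Num.min (Num.min d1 d2) (Num.min d3 e')); first by rewrite !lt_min d10 d20 d30 e'0.
move=> h; rewrite !lt_min => /andP[/andP[hd1 hd2] /andP[hd3 he]].
have ha := le_re h; have hb := le_im h.
have := h1 (reC h) (le_lt_trans ha hd1).
have := h2 (imC h) (le_lt_trans hb hd2).
have := h3 (imC h) (le_lt_trans hb hd3).
rewrite !add0r expR0 cos0 sin0 mul0r !mul1r !subr0 => H3 H2 H1.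
set al := expR _ - 1 - _ in H1; set ga := cos _ - 1 in H2; set be := sin _ - _ in H3.
have -> : expC h - expC 0 - h = rC al + rC (1 + reC h + al) * (rC ga + iC * rC be)
    + iC * (rC (imC h) * rC (reC h + al)).
  by rewrite expC0 expCE; apply: eq_reim; rewrite !reimE /al /be /ga; ring.
set m := modulus h in ha hb he *.
have m0 : 0 <= m by exact: modulus_ge0.
have Al : `|al| <= e' * m by rewrite (le_trans H1)// ler_wpM2l// ltW.
have Ga : `|ga| <= e' * m by rewrite (le_trans H2)// ler_wpM2l// ltW.
have Be : `|be| <= e' * m by rewrite (le_trans H3)// ler_wpM2l// ltW.
have em : e' * m <= m by rewrite -[leRHS]mul1r ler_wpM2r//; lra.
have rA : `|reC h + al| <= 2 * m by rewrite (le_trans (ler_normD _ _))//; lra.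
have A2 : `|1 + reC h + al| <= 2.
  by rewrite -addrA (le_trans (ler_normD _ _))// normr1; lra.
apply: (@le_trans _ _ (e' * m + 2 * (e' * m + e' * m) + m * (2 * m))).
  apply: (le_trans (modulusD _ _)); apply: lerD.
    apply: (le_trans (modulusD _ _)); apply: lerD; first by rewrite modulusR.
    rewrite modulusM; apply: ler_pM; rewrite ?modulus_ge0//; first by rewrite modulusR.
    apply: (le_trans (modulusD _ _)).
    by rewrite modulusM modulus_i mul1r !modulusR lerD.
  by rewrite modulusM modulus_i mul1r modulusM !modulusR ler_pM.
have : m * m <= e' * m by rewrite ler_wpM2r// ltW.
have : e' * m <= e / 10 * m by rewrite ler_wpM2r.
move=> ? ?; nra.
Qed.

Lemma derivable_expC (z : C) : derivable (@expC R) z 1.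
Proof.
suff [] : is_derive z (1 : C) (@expC R) (expC z) by [].
apply/cderivP => e e0.
have ez0 : 0 < e / modulus (expC z) by rewrite divr_gt0// modulus_gt0 expC_neq0.
have /cderivP/(_ _ ez0)[d d0 h] := is_derive_expC0; exists d => // x /h.
rewrite add0r mul1r expC0 expCD => H.
have -> : expC z * expC x - expC z - expC z * x = expC z * (expC x - 1 - x) by ring.
by rewrite modulusM mulrC -ler_pdivlMr ?modulus_gt0 ?expC_neq0// mulrAC.
Qed.

Lemma cont_expC : continuous (@expC R).
Proof. by move=> z; apply: derivable_cont; exact: derivable_expC. Qed.

Lemma expC_near0 (e : R) : 0 < e -> exists2 d : R, 0 < d &
  forall w : C, modulus w <= d -> modulus (expC w - 1) <= e.
Proof.
move=> e0; have /contCP/(_ _ e0)[d d0 h] := cont_expC (x := (0 : C)).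
exists (d / 2); first by rewrite divr_gt0.
move=> w wd; have := h w; rewrite subr0 expC0 => H; apply/ltW/H; lra.
Qed.

(** The derivative at [0] is [1], so the slope is below [2] nearby. *)
Lemma expC_lip0 : exists2 d : R, 0 < d &
  forall w : C, modulus w <= d -> modulus (expC w - 1) <= 2 * modulus w.
Proof.
have /cderivP/(_ _ ltr01)[d d0 h] := is_derive_expC0.
exists (d / 2); first by rewrite divr_gt0.
move=> w wd; have := h w; rewrite add0r expC0 !mul1r => H.
have {}H := H ltac:(lra).
have := modulusD (expC w - 1 - w) w; rewrite subrK; lra.
Qed.

End Deriv.
(* Below, complex numbers are only handled through the lemmas above. *)
Opaque Cplx modulus reC imC rC iC cjC mkC expC.

(** * Integrals of complex functions and the theorem of Goursat *)

Section ComplexIntegral.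
Context {R : realType}.
Local Notation C := (Cplx R).
Implicit Types (g h : R -> C) (a b : R).

Variant ccont (g : R -> C) : Prop := CCont of continuous g.

Lemma ccontE g : ccont g -> continuous g. Proof. by case. Qed.
Lemma contC_cst (c : C) : ccont (fun=> c).
Proof. by split => x; exact: cvg_cst. Qed.
Lemma contC_D g h : ccont g -> ccont h -> ccont (fun x => g x + h x).
Proof. by move=> [cg] [ch]; split => x; apply: cvgD; [exact: cg|exact: ch]. Qed.
Lemma contC_N g : ccont g -> ccont (fun x => - g x).
Proof. by move=> [cg]; split => x; apply: cvgN; exact: cg. Qed.
Lemma contC_B g h : ccont g -> ccont h -> ccont (fun x => g x - h x).
Proof. by move=> [cg] [ch]; split => x; apply: cvgB; [exact: cg|exact: ch]. Qed.
Lemma contC_M g h : ccont g -> ccont h -> ccont (fun x => g x * h x).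
Proof. by move=> [cg] [ch]; split => x; apply: cvgM; [exact: cg|exact: ch]. Qed.
Lemma ccont_eq g h : g =1 h -> ccont g -> ccont h.
Proof. by move=> /funext ->. Qed.
Lemma contC_X g n : ccont g -> ccont (fun x => g x ^+ n).
Proof.
move=> cg; elim: n => [|n ih]; first exact: contC_cst.
by apply: ccont_eq (contC_M cg ih) => x; rewrite exprS.
Qed.
Lemma contC_V g : ccont g -> (forall t, g t != 0) -> ccont (fun x => (g x)^-1).
Proof. by move=> [cg] g0; split => x; apply: cvgV; [exact: g0|exact: cg]. Qed.
Lemma contC_comp (f : C -> C) g : ccont g -> (forall t, {for g t, continuous f}) ->
  ccont (fun x => f (g x)).
Proof. by move=> [cg] cf; split => x; apply: continuous_comp; [exact: cg|exact: cf]. Qed.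
Lemma cont_re g : ccont g -> rcont (fun x => reC (g x)).
Proof. by move=> [cg]; split => x; apply: continuous_comp; [exact: cg|exact: cont_reC]. Qed.
Lemma cont_im g : ccont g -> rcont (fun x => imC (g x)).
Proof. by move=> [cg]; split => x; apply: continuous_comp; [exact: cg|exact: cont_imC]. Qed.
Lemma cont_mod g : ccont g -> rcont (fun x => modulus (g x)).
Proof. by move=> [cg]; split => x; apply: continuous_comp; [exact: cg|exact: cont_modulus]. Qed.
Lemma ccont_mk (a b : R -> R) : rcont a -> rcont b -> ccont (fun x => mkC (a x) (b x)).
Proof. by move=> [ca] [cb]; split; exact: cont_mkC. Qed.
Lemma cont_rC (f : R -> R) : rcont f -> ccont (fun x => rC (f x)).
Proof.
move=> cf; apply: ccont_eq (ccont_mk cf (rcont_cst 0)) => x.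
by apply: eq_reim; rewrite !reimE.
Qed.
Lemma cont_cj g : ccont g -> ccont (fun x => cjC (g x)).
Proof.
move=> cg; apply: ccont_eq (ccont_mk (cont_re cg) (rcontN (cont_im cg))) => x.
by apply: eq_reim; rewrite !reimE.
Qed.
Lemma contC_sum (I : Type) (s : seq I) (P : pred I) (F : I -> R -> C) :
  (forall i, ccont (F i)) -> ccont (fun x => \sum_(i <- s | P i) F i x).
Proof.
move=> cF; elim: s => [|i s ih].
  by apply: ccont_eq (contC_cst 0) => x; rewrite big_nil.
case Pi : (P i).
  by apply: ccont_eq (contC_D (cF i) ih) => x; rewrite big_cons Pi.
by apply: ccont_eq ih => x; rewrite big_cons Pi.
Qed.

Definition Cint a b g : C := mkC (Rint a b (fun t => reC (g t))) (Rint a b (fun t => imC (g t))).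

Lemma eq_Cint a b g h : (forall t, a <= t <= b -> g t = h t) -> Cint a b g = Cint a b h.
Proof. by move=> gh; rewrite /Cint; congr mkC; apply: eq_Rint => t /gh ->. Qed.

Lemma CintD a b g h : ccont g -> ccont h ->
  Cint a b (fun t => g t + h t) = Cint a b g + Cint a b h.
Proof.
move=> cg ch; apply: eq_reim; rewrite !reimE.
  rewrite -(RintD _ _ (cont_re cg) (cont_re ch)).
  by apply: eq_Rint => t _; rewrite reD.
rewrite -(RintD _ _ (cont_im cg) (cont_im ch)).
by apply: eq_Rint => t _; rewrite imD.
Qed.

Lemma CintZ a b (c : C) g : ccont g -> Cint a b (fun t => c * g t) = c * Cint a b g.
Proof.
move=> cg; have [cr ci] := (cont_re cg, cont_im cg).
have cc (k : R) (u : R -> R) : rcont u -> rcont (fun t => k * u t).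
  by move=> cu; apply: rcontM => //; exact: rcont_cst.
apply: eq_reim; rewrite !reimE.
  rewrite -(RintZ _ _ _ cr) -(RintZ _ _ _ ci) -(RintB _ _ (cc _ _ cr) (cc _ _ ci)).
  by apply: eq_Rint => t _; rewrite reM.
rewrite -(RintZ _ _ _ cr) -(RintZ _ _ _ ci) -(RintD _ _ (cc _ _ ci) (cc _ _ cr)).
by apply: eq_Rint => t _; rewrite imM.
Qed.

Lemma CintN a b g : ccont g -> Cint a b (fun t => - g t) = - Cint a b g.
Proof. by move=> cg; rewrite -mulN1r -CintZ//; apply: eq_Cint => t _; rewrite mulN1r. Qed.

Lemma CintB a b g h : ccont g -> ccont h ->
  Cint a b (fun t => g t - h t) = Cint a b g - Cint a b h.
Proof.
move=> cg ch; by rewrite -CintN// -CintD//; exact: contC_N.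
Qed.

Lemma Cint_cst a b (c : C) : a <= b -> Cint a b (fun=> c) = c * rC (b - a).
Proof. by move=> ab; apply: eq_reim; rewrite !reimE Rint_cst// !(mulr0, subr0, addr0, add0r). Qed.

Lemma Cint_split a b c g : a <= b -> b <= c -> ccont g ->
  Cint a c g = Cint a b g + Cint b c g.
Proof.
move=> ab bc cg; apply: eq_reim; rewrite !reimE (Rint_split ab bc)//;
 [exact: cont_re|exact: cont_im].
Qed.

(** Multiplying by the conjugate of the integral turns its modulus into a real part, which
commutes with integration. *)
Lemma Cint_modulus a b g : ccont g -> modulus (Cint a b g) <= Rint a b (fun t => modulus (g t)).
Proof.
move=> cg; set I := Cint a b g.
have [I0|I0] := eqVneq I 0.
  by rewrite I0 modulus0; apply: Rint_ge0 => t _; exact: modulus_ge0.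
have I0' : 0 < modulus I by rewrite modulus_gt0.
rewrite -(ler_pM2l I0') -expr2 -RintZ; last exact: cont_mod.
have -> : modulus I ^+ 2 = reC (Cint a b (fun t => cjC I * g t)).
  by rewrite CintZ// -/I mulrC mul_cj.
apply: le_Rint.
- by apply: cont_re; apply: contC_M => //; exact: contC_cst.
- by apply: rcontM; [exact: rcont_cst|exact: cont_mod].
- by move=> t _; rewrite (le_trans (re_le _))// modulusM modulus_cj.
Qed.

Lemma Cint_le a b g (B : R) : a <= b -> ccont g ->
  (forall t, a <= t <= b -> modulus (g t) <= B) -> modulus (Cint a b g) <= B * (b - a).
Proof.
move=> ab cg gB; rewrite (le_trans (Cint_modulus _ _ cg))// -Rint_cst//.
by apply: le_Rint => //; [exact: cont_mod|exact: rcont_cst].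
Qed.

End ComplexIntegral.

Section Goursat.
Context {R : realType}.
Local Notation C := (Cplx R).
Variable G : C -> C.
Hypothesis cG : continuous G.

Let ch0 (t : R) : ccont (fun s : R => mkC s t).
Proof. by apply: ccont_mk; [exact: rcont_id|exact: rcont_cst]. Qed.
Let cv0 (s : R) : ccont (fun t : R => mkC s t).
Proof. by apply: ccont_mk; [exact: rcont_cst|exact: rcont_id]. Qed.
Let cont_h (t : R) : ccont (fun s : R => G (mkC s t)).
Proof. by apply: contC_comp => // ?; exact: cG. Qed.
Let cont_v (s : R) : ccont (fun t : R => G (mkC s t)).
Proof. by apply: contC_comp => // ?; exact: cG. Qed.
Let cont_hor t t' : ccont (fun u => G (mkC u t) - G (mkC u t')).
Proof. exact: contC_B. Qed.
Let cont_ver s s' : ccont (fun u => G (mkC s' u) - G (mkC s u)).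
Proof. exact: contC_B. Qed.

(** The integral over the boundary of a rectangle, opposite sides being paired. *)
Definition rect_int (s s' t t' : R) : C :=
  Cint s s' (fun u => G (mkC u t) - G (mkC u t')) +
  iC * Cint t t' (fun u => G (mkC s' u) - G (mkC s u)).

Let rect_splits s s' s'' t t' : s <= s' -> s' <= s'' ->
  rect_int s s'' t t' = rect_int s s' t t' + rect_int s' s'' t t'.
Proof.
move=> ss ss'; rewrite /rect_int (Cint_split ss ss')//.
have -> : Cint t t' (fun u => G (mkC s'' u) - G (mkC s u)) =
  Cint t t' (fun u => G (mkC s' u) - G (mkC s u)) + Cint t t' (fun u => G (mkC s'' u) - G (mkC s' u)).
  by rewrite -CintD//; apply: eq_Cint => u _; ring.
ring.
Qed.

Let rect_splitt s s' t t' t'' : t <= t' -> t' <= t'' ->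
  rect_int s s' t t'' = rect_int s s' t t' + rect_int s s' t' t''.
Proof.
move=> tt tt'; rewrite /rect_int (Cint_split tt tt')//.
have -> : Cint s s' (fun u => G (mkC u t) - G (mkC u t'')) =
  Cint s s' (fun u => G (mkC u t) - G (mkC u t')) + Cint s s' (fun u => G (mkC u t') - G (mkC u t'')).
  by rewrite -CintD//; apply: eq_Cint => u _; ring.
ring.
Qed.

Let four_large (m : R) (x1 x2 x3 x4 : C) : 4 * m <= modulus (x1 + x2 + (x3 + x4)) ->
  [\/ m <= modulus x1, m <= modulus x2, m <= modulus x3 | m <= modulus x4].
Proof.
move=> H; have := modulusD (x1 + x2) (x3 + x4); have := modulusD x1 x2; have := modulusD x3 x4.
move=> h1 h2 h3.
have [|?] := leP m (modulus x1); first by constructor 1.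
have [|?] := leP m (modulus x2); first by constructor 2.
have [|?] := leP m (modulus x3); first by constructor 3.
have [|?] := leP m (modulus x4); first by constructor 4.
lra.
Qed.

(** The integral of an affine map over the boundary vanishes, so only the error of the
tangent map at [p] contributes. *)
Let rect_small (p l : C) (e D s s' t t' : R) : 0 <= e ->
  s <= reC p <= s' -> t <= imC p <= t' -> s' - s <= D -> t' - t <= D ->
  (forall w, modulus (w - p) <= 2 * D -> modulus (G w - G p - l * (w - p)) <= e * modulus (w - p)) ->
  modulus (rect_int s s' t t') <= 8 * e * D ^+ 2.
Proof.
move=> e0 /andP[sp ps] /andP[tp grid] sD tD H.
have ss : s <= s' by lra. have tt : t <= t' by lra.
have D0 : 0 <= D by lra.
pose E (w : C) := G w - G p - l * (w - p).
have EB (u v : R) : s <= u <= s' -> t <= v <= t' -> modulus (E (mkC u v)) <= e * (2 * D).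
  move=> /andP[? ?] /andP[? ?].
  have dD : modulus (mkC u v - p) <= 2 * D.
    rewrite (le_trans (modulus_le _))// !reimE.
    have : `|u - reC p| <= D by rewrite ler_norml; lra.
    have : `|v - imC p| <= D by rewrite ler_norml; lra.
    lra.
  by rewrite (le_trans (H _ dD))// ler_wpM2l.
have cE z : ccont z -> ccont (fun u => G (z u)) -> ccont (fun u : R => E (z u)).
  move=> cz cGz; apply: contC_B; first by apply: contC_B => //; exact: contC_cst.
  apply: contC_M; first exact: contC_cst.
  by apply: contC_B => //; exact: contC_cst.
have cE1 v := cE _ (ch0 v) (cont_h v).
have cE2 v := cE _ (cv0 v) (cont_v v).
have -> : rect_int s s' t t' = Cint s s' (fun u => E (mkC u t) - E (mkC u t')) +
  iC * Cint t t' (fun u => E (mkC s' u) - E (mkC s u)).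
  rewrite /rect_int.
  rewrite (@eq_Cint _ s s' _ (fun u => (E (mkC u t) - E (mkC u t')) + l * (iC * rC (t - t')))); last first.
    move=> u _; rewrite /E !mkCE rCB; ring.
  rewrite (@eq_Cint _ t t' _ (fun u => (E (mkC s' u) - E (mkC s u)) + l * rC (s' - s))); last first.
    move=> u _; rewrite /E !mkCE rCB; ring.
  rewrite (CintD _ _ (contC_B (cE1 _) (cE1 _)) (contC_cst _)).
  rewrite (CintD _ _ (contC_B (cE2 _) (cE2 _)) (contC_cst _)) !Cint_cst//.
  rewrite !rCB; ring.
have -> : 8 * e * D ^+ 2 = (2 * (e * (2 * D))) * D + (2 * (e * (2 * D))) * D by ring.
apply: (le_trans (modulusD _ _)); rewrite modulusM modulus_i mul1r; apply: lerD.
  apply: (@le_trans _ _ (2 * (e * (2 * D)) * (s' - s))).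
    apply: Cint_le => //; first exact: contC_B.
    move=> u us; apply: (le_trans (modulusB _ _)); rewrite mulrDl mul1r.
    by apply: lerD; apply: EB => //; rewrite lexx tt.
  by rewrite ler_wpM2l// !mulr_ge0.
apply: (@le_trans _ _ (2 * (e * (2 * D)) * (t' - t))).
  apply: Cint_le => //; first exact: contC_B.
  move=> u us; apply: (le_trans (modulusB _ _)); rewrite mulrDl mul1r.
  by apply: lerD; apply: EB => //; rewrite lexx ss.
by rewrite ler_wpM2l// !mulr_ge0.
Qed.

(** Bisection: if the integral were nonzero, one of the four quarters would carry at
least a quarter of it, and so on; at the common point of these rectangles differentiability
makes the integral of smaller order than the area. *)
Theorem goursat (s t a b : R) : 0 <= a -> 0 <= b ->
  (forall p, s <= reC p <= s + a -> t <= imC p <= t + b -> derivable G p 1) ->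
  rect_int s (s + a) t (t + b) = 0.
Proof.
move=> a0 b0 dG; apply/eqP; apply: contraT; rewrite -modulus_gt0.
set c := modulus _ => c0.
pose A k : R := a / 2 ^+ k; pose B k : R := b / 2 ^+ k.
have AS k : A k = A k.+1 + A k.+1 by rewrite /A exprS; field; rewrite expf_neq0.
have BS k : B k = B k.+1 + B k.+1 by rewrite /B exprS; field; rewrite expf_neq0.
have A0 k : 0 <= A k by rewrite divr_ge0// exprn_ge0.
have B0 k : 0 <= B k by rewrite divr_ge0// exprn_ge0.
pose big k (q : R * R) := c / 4 ^+ k <= modulus (rect_int q.1 (q.1 + A k) q.2 (q.2 + B k)).
(* one of the four quarters of a large rectangle is still large *)
have step (kq : nat * (R * R)) : exists q' : R * R, big kq.1 kq.2 ->
    [/\ big kq.1.+1 q', kq.2.1 <= q'.1, q'.1 + A kq.1.+1 <= kq.2.1 + A kq.1,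
       kq.2.2 <= q'.2 & q'.2 + B kq.1.+1 <= kq.2.2 + B kq.1].
  case: kq => k [u v] /=.
  pose h := A k.+1; pose h' := B k.+1.
  have h0 : 0 <= h by exact: A0. have h'0 : 0 <= h' by exact: B0.
  have [Q|nQ] := pselect (big k (u, v)); last by exists (u, v).
  have split4 : rect_int u (u + A k) v (v + B k) =
     rect_int u (u + h) v (v + h') + rect_int (u + h) (u + h + h) v (v + h') +
     (rect_int u (u + h) (v + h') (v + h' + h') + rect_int (u + h) (u + h + h) (v + h') (v + h' + h')).
    have uh : u <= u + h by lra.
    have uh2 : u + h <= u + h + h by lra.
    have vh : v <= v + h' by lra.
    have vh2 : v + h' <= v + h' + h' by lra.
    rewrite AS BS !addrA (rect_splitt _ _ vh vh2).
    by rewrite (rect_splits _ _ uh uh2) (rect_splits _ _ uh uh2) !addrA.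
  have E4 : c / 4 ^+ k = 4 * (c / 4 ^+ k.+1) by rewrite exprS; field; rewrite expf_neq0.
  move: Q; rewrite /big/= split4 E4 => /four_large.
  have uA : u + A k = u + h + h by rewrite AS addrA.
  have vB : v + B k = v + h' + h' by rewrite BS addrA.
  case=> H.
  - by exists (u, v); split => //=; rewrite ?uA ?vB ?lerDl// -/h -/h' ?lerDl.
  - by exists (u + h, v); split => //=; rewrite ?uA ?vB ?lerDl// -/h -/h' ?lerDl.
  - by exists (u, v + h'); split => //=; rewrite ?uA ?vB ?lerDl// -/h -/h' ?lerDl.
  - by exists (u + h, v + h'); split => //=; rewrite ?uA ?vB ?lerDl// -/h -/h' ?lerDl.
have [F HF] := boolp.choice step.
pose q := fix q k := if k is k'.+1 then F (k', q k') else (s, t).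
have bigq k : big k (q k).
  elim: k => [|k ih]; last by have [] := HF (k, q k) ih.
  by rewrite /big /A /B !expr0 !divr1.
have q1 k : (q k).1 <= (q k.+1).1 by have [] := HF (k, q k) (bigq k).
have q2 k : (q k).2 <= (q k.+1).2 by have [] := HF (k, q k) (bigq k).
have r1 k : (q k.+1).1 + A k.+1 <= (q k).1 + A k by have [] := HF (k, q k) (bigq k).
have r2 k : (q k.+1).2 + B k.+1 <= (q k).2 + B k by have [] := HF (k, q k) (bigq k).
have lim1 (x y : nat -> R) : (forall k, x k <= x k.+1) -> (forall k, 0 <= y k) ->
   (forall k, x k.+1 + y k.+1 <= x k + y k) -> exists z, forall k, x k <= z <= x k + y k.
  move=> x1 y0 xy.
  have xm i j : (i <= j)%N -> x i <= x j.
    by elim: j => [|j ih]; [rewrite leqn0 => /eqP ->|rewrite leq_eqVlt => /predU1P[->//|/ih h]; exact: le_trans h (x1 _)].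
  have ym i j : (i <= j)%N -> x j + y j <= x i + y i.
    by elim: j => [|j ih]; [rewrite leqn0 => /eqP ->|rewrite leq_eqVlt => /predU1P[->//|/ih h]; exact: le_trans (xy _) h].
  have ub k : ubound (range x) (x k + y k).
    move=> _ [j _ <-]; have [jk|kj] := leqP j k.
      by rewrite (le_trans (xm _ _ jk))// lerDl.
    by rewrite (le_trans _ (ym _ _ (ltnW kj)))// lerDl.
  exists (sup (range x)) => k; apply/andP; split.
    by apply: ub_le_sup; [exists (x 0%N + y 0%N); exact: ub|exists k].
  by apply: ge_sup; [exists (x 0%N); exists 0%N|exact: ub].
have [p1 Hp1] := lim1 (fun k => (q k).1) A q1 A0 r1.
have [p2 Hp2] := lim1 (fun k => (q k).2) B q2 B0 r2.
pose p := mkC p1 p2.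
have dp : derivable G p 1.
  apply: dG; rewrite !reimE.
    by have := Hp1 0%N; rewrite /= /A expr0 divr1.
  by have := Hp2 0%N; rewrite /= /B expr0 divr1.
have /derivableP := dp; set l := 'D_1 G p => /cderivP dl.
(* deep rectangles lie where the tangent map at p is accurate up to e; the powers of 4 cancel *)
have key (e : R) : 0 < e -> c <= 8 * e * (a + b) ^+ 2.
  move=> e0; have [d d0 Hd] := dl e e0.
  have [k kd] : exists k : nat, (a + b) / 2 ^+ k < d / 2.
    have /cvgrPdist_lt/(_ (d / 2 / (a + b + 1))) : (fun n => (1/2 : R) ^+ n) @ \oo --> (0 : R).
      by apply: cvg_expr; rewrite ger0_norm; lra.
    have ab1 : 0 < a + b + 1 by lra.
    rewrite !divr_gt0// => /(_ erefl)[k _ /(_ k (leqnn k))].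
    rewrite /= sub0r normrN ger0_norm; last by rewrite exprn_ge0// divr_ge0.
    rewrite expr_div_n expr1n mul1r ltr_pdivlMr// => H; exists k; apply: le_lt_trans H.
    by rewrite mulrC ler_wpM2l ?invr_ge0 ?exprn_ge0//; lra.
  have := @rect_small p l e ((a + b) / 2 ^+ k) (q k).1 ((q k).1 + A k) (q k).2 ((q k).2 + B k)
    (ltW e0) (Hp1 k) (Hp2 k).
  have AB : A k + B k = (a + b) / 2 ^+ k by rewrite /A /B mulrDl.
  have := A0 k; have := B0 k => Bk Ak.
  have AD : (q k).1 + A k - (q k).1 <= (a + b) / 2 ^+ k by lra.
  have BD : (q k).2 + B k - (q k).2 <= (a + b) / 2 ^+ k by lra.
  move=> /(_ AD BD) H.
  have {}H : modulus (rect_int (q k).1 ((q k).1 + A k) (q k).2 ((q k).2 + B k)) <=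
     8 * e * ((a + b) / 2 ^+ k) ^+ 2.
    apply: H => w wp; have := Hd (w - p); rewrite (addrC p) subrK; apply.
    by rewrite (le_lt_trans wp)// mulrC -ltr_pdivlMr.
  have := le_trans (bigq k) H.
  rewrite exprMn exprVn -exprM mulnC exprM (_ : 2 ^+ 2 = 4 :> R)//; last by rewrite -natrX.
  by rewrite mulrA ler_pdivrMr ?exprn_gt0// divfK// expf_neq0.
have ab0 : 0 <= (a + b) ^+ 2 by exact: sqr_ge0.
have : c <= c / 2.
  apply: (le_trans (key (c / (16 * ((a + b) ^+ 2 + 1))) _)).
    by rewrite divr_gt0// mulr_gt0//; lra.
  rewrite -[leLHS]/(8 * (c / (16 * ((a + b) ^+ 2 + 1))) * (a + b) ^+ 2).
  set x := (a + b) ^+ 2 in ab0 *.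
  have -> : 8 * (c / (16 * (x + 1))) * x = c / 2 * (x / (x + 1)) by field; lra.
  rewrite -[leRHS]mulr1 ler_wpM2l//; first lra.
  by rewrite ler_pdivrMr; lra.
lra.
Qed.

End Goursat.

(** * Means over circles *)

Section Mean.
Context {R : realType}.
Local Notation C := (Cplx R).
Implicit Types (g h : R -> C).

(** The point [exp (i t)] of the unit circle. *)
Definition ec (t : R) : C := mkC (cos t) (sin t).

Lemma ec0 : ec 0 = 1.
Proof. by apply: eq_reim; rewrite !reimE ?cos0 ?sin0. Qed.
Lemma ecD s t : ec (s + t) = ec s * ec t.
Proof. by apply: eq_reim; rewrite !reimE ?cosD ?sinD; ring. Qed.
Lemma modulus_ec t : modulus (ec t) = 1.
Proof. by rewrite modulusE !reimE cos2Dsin2 sqrtr1. Qed.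
Lemma ec_neq0 t : ec t != 0.
Proof. by rewrite -modulus_gt0 modulus_ec. Qed.
Lemma ecX t n : ec t ^+ n = ec (n%:R * t).
Proof.
elim: n => [|n ih]; first by rewrite expr0 mul0r ec0.
by rewrite exprS ih -ecD -natr1 mulrDl mul1r addrC.
Qed.
Lemma ec_cj t : cjC (ec t) = (ec t)^-1.
Proof.
have := mul_cj (ec t); rewrite modulus_ec expr1n rC1 => H.
by rewrite -[LHS](mulKf (ec_neq0 t)) H mulr1.
Qed.
Lemma ec2pi n : ec (2 * pi) ^+ n = 1.
Proof.
by rewrite (_ : ec (2 * pi) = 1) ?expr1n//; apply: eq_reim; rewrite !reimE mulr_natl ?cos2pi ?sin2pi.
Qed.
Lemma expC_mk s t : expC (mkC s t) = rC (expR s) * ec t.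
Proof. by rewrite expCE; apply: eq_reim; rewrite !reimE; ring. Qed.

Lemma ccont_ec : ccont ec.
Proof. by apply: ccont_mk; split; [exact: continuous_cos|exact: continuous_sin]. Qed.

Lemma modulus_circ (r t : R) : 0 <= r -> modulus (rC r * ec t) = r.
Proof. by move=> r0; rewrite modulusM modulus_ec mulr1 modulusR ger0_norm. Qed.

Lemma modulus_circp (r t : R) : 0 < r -> modulus (rC r * ec t) = r.
Proof. by move=> r0; rewrite modulus_circ// ltW. Qed.

Lemma ccont_circ (r : R) : ccont (fun t => rC r * ec t).
Proof. by apply: contC_M; [exact: contC_cst|exact: ccont_ec]. Qed.

(** [exp (i n t)] is [exp (i n t) / (i n)] differentiated. *)
Lemma Cint_ecX a b n : a <= b ->
  Cint a b (fun t => ec t ^+ n.+1) = (ec b ^+ n.+1 - ec a ^+ n.+1) / (iC * n.+1%:R).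
Proof.
move=> ab; have n0 : n.+1%:R != 0 :> C by rewrite pnatr_eq0.
have n0' : n.+1%:R != 0 :> R by rewrite pnatr_eq0.
have i0 : iC != 0 :> C by rewrite -modulus_gt0 modulus_i.
have ii : iC * iC = -1 :> C by apply: eq_reim; rewrite !reimE; ring.
have cn : rcont (fun t : R => n.+1%:R * t) by apply: rcontM; [exact: rcont_cst|exact: rcont_id].
have E1 : Rint a b (fun t => cos (n.+1%:R * t)) = (sin (n.+1%:R * b) - sin (n.+1%:R * a)) / n.+1%:R.
  have D x : is_derive x (1 : R) (fun t => n.+1%:R^-1 * sin (n.+1%:R * t)) (cos (n.+1%:R * x)).
    by apply: is_derive_eq; rewrite /GRing.scale/= !(mulr0, addr0, mulr1); field.
  by rewrite (Rint_FTC ab (rcont_comp (@continuous_cos R) cn) D); ring.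
have E2 : Rint a b (fun t => sin (n.+1%:R * t)) = - (cos (n.+1%:R * b) - cos (n.+1%:R * a)) / n.+1%:R.
  have D x : is_derive x (1 : R) (fun t => - n.+1%:R^-1 * cos (n.+1%:R * t)) (sin (n.+1%:R * x)).
    by apply: is_derive_eq; rewrite /GRing.scale/= !(mulr0, addr0, mulr1); field.
  by rewrite (Rint_FTC ab (rcont_comp (@continuous_sin R) cn) D); ring.
have -> : (ec b ^+ n.+1 - ec a ^+ n.+1) / (iC * n.+1%:R) =
   - iC * (ec b ^+ n.+1 - ec a ^+ n.+1) * rC (n.+1%:R^-1).
  rewrite rCV rCn invfM mulrA; congr (_ * _); rewrite mulrC; congr (_ * _).
  by rewrite -[LHS]mulr1 -[1]opprK -ii; field.
apply: eq_reim; rewrite !ecX !reimE.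
  rewrite (eq_Rint (g := fun t => cos (n.+1%:R * t))) ?E1; first by ring.
  by move=> t _; rewrite ecX !reimE.
rewrite (eq_Rint (g := fun t => sin (n.+1%:R * t))) ?E2; first by ring.
by move=> t _; rewrite ecX !reimE.
Qed.

Lemma Cint_cj a b g : ccont g -> Cint a b (fun t => cjC (g t)) = cjC (Cint a b g).
Proof.
move=> cg; apply: eq_reim; rewrite !reimE; first by apply: eq_Rint => t _; rewrite re_cj.
rewrite -RintN; last exact: cont_im.
by apply: eq_Rint => t _; rewrite im_cj.
Qed.

Lemma tau_gt0 : 0 < 2 * pi :> R. Proof. by rewrite mulr_gt0// pi_gt0. Qed.
Lemma tau_ge0 : 0 <= 2 * pi :> R. Proof. exact: ltW tau_gt0. Qed.
Lemma tau_neq0 : 2 * pi != 0 :> R. Proof. exact: lt0r_neq0 tau_gt0. Qed.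

Definition Mean g : C := rC ((2 * pi)^-1) * Cint 0 (2 * pi) g.

Lemma eq_Mean g h : g =1 h -> Mean g = Mean h.
Proof. by move=> /funext ->. Qed.
Lemma MeanD g h : ccont g -> ccont h -> Mean (fun t => g t + h t) = Mean g + Mean h.
Proof. by move=> cg ch; rewrite /Mean CintD// mulrDr. Qed.
Lemma MeanB g h : ccont g -> ccont h -> Mean (fun t => g t - h t) = Mean g - Mean h.
Proof. by move=> cg ch; rewrite /Mean CintB// mulrBr. Qed.
Lemma MeanZ c g : ccont g -> Mean (fun t => c * g t) = c * Mean g.
Proof. by move=> cg; rewrite /Mean CintZ// mulrCA. Qed.
Lemma Mean_cst c : Mean (fun=> c) = c.
Proof.
rewrite /Mean Cint_cst ?tau_ge0// subr0 mulrCA -rCM mulVf ?tau_neq0// rC1 mulr1//.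
Qed.
Lemma Mean_sum (I : Type) (s : seq I) (P : pred I) (F : I -> R -> C) :
  (forall i, ccont (F i)) -> Mean (fun t => \sum_(i <- s | P i) F i t) = \sum_(i <- s | P i) Mean (F i).
Proof.
move=> cF; elim: s => [|i s ih].
  by rewrite big_nil -[RHS]Mean_cst; apply: eq_Mean => t; rewrite big_nil.
rewrite big_cons; case Pi : (P i).
  rewrite -ih -MeanD//; last exact: contC_sum.
  by apply: eq_Mean => t; rewrite big_cons Pi.
by rewrite -ih; apply: eq_Mean => t; rewrite big_cons Pi.
Qed.
Lemma Mean_cj g : ccont g -> Mean (fun t => cjC (g t)) = cjC (Mean g).
Proof.
by move=> cg; rewrite /Mean Cint_cj// cjM cjR.
Qed.
Lemma Mean_le_on g (B : R) : ccont g -> (forall t, 0 <= t <= 2 * pi -> modulus (g t) <= B) -> modulus (Mean g) <= B.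
Proof.
move=> cg gB; rewrite /Mean modulusM modulusR ger0_norm ?invr_ge0 ?tau_ge0//.
rewrite ler_pdivrMl ?tau_gt0// [leRHS]mulrC.
by have := Cint_le tau_ge0 cg gB; rewrite subr0.
Qed.
Lemma Mean_le g (B : R) : ccont g -> (forall t, modulus (g t) <= B) -> modulus (Mean g) <= B.
Proof. by move=> cg gB; apply: Mean_le_on. Qed.
Lemma Mean_ecX n : Mean (fun t => ec t ^+ n) = (n == 0%N)%:R.
Proof.
case: n => [|n]; first by rewrite -[RHS]Mean_cst; apply: eq_Mean => t; rewrite expr0.
by rewrite /Mean Cint_ecX ?tau_ge0// ec2pi ec0 expr1n subrr mul0r mulr0.
Qed.
Lemma Mean_ecV n : Mean (fun t => ec t ^- n) = (n == 0%N)%:R.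
Proof.
rewrite (eq_Mean (h := fun t => cjC (ec t ^+ n))).
  rewrite Mean_cj ?Mean_ecX; last by apply: contC_X; exact: ccont_ec.
  by rewrite -rCn cjR.
by move=> t; rewrite cjX ec_cj exprVn.
Qed.

(** With [w = exp p] the annulus becomes a rectangle of height [2 pi] in the plane of [p]. The two
horizontal sides cancel by periodicity, and the vertical ones give the two means. The real part of [p] is
truncated at [ln r3] to obtain a function that is continuous on the whole plane. *)
Lemma mean_annulus (g : C -> C) (r1 r2 r3 : R) : 0 < r1 -> r1 <= r2 -> r2 < r3 ->
  (forall w : C, w != 0 -> modulus w <= r3 -> {for w, continuous g}) ->
  (forall w, r1 <= modulus w <= r2 -> derivable g w 1) ->
  Mean (fun t => g (rC r1 * ec t)) = Mean (fun t => g (rC r2 * ec t)).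
Proof.
move=> r10 r12 r23 cg dg.
have r20 : 0 < r2 by lra. have r30 : 0 < r3 by lra.
pose cl (w : C) : C := mkC (Num.min (reC w) (ln r3)) (imC w).
pose G (w : C) : C := g (expC (cl w)).
have cG : continuous G.
  move=> w; apply: continuous_comp; last first.
    apply: cg; first exact: expC_neq0.
    rewrite modulus_expC re_mk -[leRHS](@lnK _ r3) ?posrE// ler_expR.
    by rewrite ge_min lexx orbT.
  apply: continuous_comp; last exact: cont_expC.
  apply: cont_mkC => x; last exact: cont_imC.
  apply: contCR_lip => {}x y; have := le_re (y - x); rewrite reB !ler_norml /Num.min.
  by case: (ltP (reC x)) => ?; case: (ltP (reC y)) => ? /andP[? ?]; apply/andP; split; lra.
have Gr (r t : R) : 0 < r -> r <= r3 -> G (mkC (ln r) t) = g (rC r * ec t).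
  move=> r0 r3r; rewrite /G /cl re_mk im_mk.
  have -> : Num.min (ln r) (ln r3) = ln r by apply/min_idPl; rewrite ler_ln.
  by rewrite expC_mk lnK.
have := @goursat R G cG (ln r1) 0 (ln r2 - ln r1) (2 * pi).
rewrite subr_ge0 ler_ln// r12 tau_ge0 => /(_ erefl erefl).
rewrite addrC subrK add0r => H.
have {}H : rect_int G (ln r1) (ln r2) 0 (2 * pi) = 0.
  apply: H => p /andP[p1 p2] _.
  have dGp : derivable (fun w => g (expC w)) p 1.
    apply: derivable_compC; first exact: derivable_expC.
    by apply: dg; rewrite modulus_expC -[X in X <= _](@lnK _ r1)// -[X in _ <= _ <= X](@lnK _ r2)// !ler_expR p1.
  have /derivableP/cderivP H' := dGp.
  suff [] : is_derive p 1 G ('D_1 (fun w => g (expC w)) p) by [].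
  apply/cderivP => e /H'[d d0 Hd].
  have lr : 0 < ln r3 - ln r2 by rewrite subr_gt0 ltr_ln.
  exists (Num.min d (ln r3 - ln r2)); first by rewrite lt_min d0.
  move=> h; rewrite lt_min => /andP[/Hd + hd2].
  have E w : reC w <= ln r3 -> G w = g (expC w).
    move=> wr; rewrite /G /cl (_ : Num.min _ _ = reC w); first by rewrite -ReImE.
    exact/min_idPl.
  rewrite !E//; first by lra.
  by rewrite reD; have := re_le h; lra.
move: H; rewrite /rect_int (eq_Cint (h := fun=> 0)); last first.
  move=> t _; rewrite /G /cl !re_mk !im_mk !expC_mk.
  by have := ec2pi 1; rewrite expr1 => ->; rewrite ec0 subrr.
rewrite Cint_cst; last by rewrite ler_ln.
rewrite mul0r add0r => /eqP.
rewrite mulf_eq0 -modulus_eq0 modulus_i oner_eq0/= => /eqP H.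
apply/eqP; rewrite eq_sym -subr_eq0 -mulrBr; apply/eqP.
have cc (r : R) : 0 < r -> r <= r3 -> ccont (fun t => g (rC r * ec t)).
  move=> r0 r3r; apply: (@contC_comp _ g (fun t => rC r * ec t) (ccont_circ r)).
  move=> t; apply: cg; last by rewrite modulus_circ// ltW.
  by rewrite -modulus_gt0 modulus_circ// ltW.
rewrite -CintB; [|by apply: cc; lra|by apply: cc; lra].
rewrite (_ : Cint _ _ _ = 0) ?mulr0// -[RHS]H.
by apply: eq_Cint => t _; rewrite !Gr//; lra.
Qed.

(** Uniform continuity in the angle, by compactness of the interval of angles. *)
Lemma mean_cont (g : C -> C) (r0 : R) : 0 <= r0 -> r0 < 1 ->
  (forall w, modulus w < 1 -> {for w, continuous g}) ->
  forall e : R, 0 < e -> exists2 d : R, 0 < d & forall r, 0 <= r -> r < 1 -> `|r - r0| < d ->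
   modulus (Mean (fun t => g (rC r * ec t)) - Mean (fun t => g (rC r0 * ec t))) <= e.
Proof.
move=> r00 r01 cg e e0.
have cc (r : R) : 0 <= r -> r < 1 -> ccont (fun t => g (rC r * ec t)).
  move=> r_0 r_1; apply: (@contC_comp _ g (fun t => rC r * ec t) (ccont_circ r)).
  by move=> t; apply: cg; rewrite modulus_circ.
have := @segment_compact R 0 (2 * pi) => /compact_near_coveringP.
move=> /(_ R (nbhs r0) (fun r t => modulus (g (rC r * ec t) - g (rC r0 * ec t)) < e)).
have K : forall x : R, `[0, 2 * pi]%classic x ->
  \forall x' \near x & i \near r0, modulus (g (rC i * ec x') - g (rC r0 * ec x')) < e.
  move=> t _; have /contCP/(_ (e / 2)) := cg (rC r0 * ec t) ltac:(by rewrite modulus_circ).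
  rewrite divr_gt0// => /(_ erefl)[d d0 Hd].
  have /contRCP/(_ (d / 2)) := ccontE ccont_ec (x := t).
  rewrite divr_gt0// => /(_ erefl)[d1 d10 Hd1].
  exists ([set t' | `|t' - t| < d1], [set r | `|r - r0| < d / 2]); first split => /=.
  - by apply/nearRP; exists d1.
  - by apply/nearRP; exists (d / 2); rewrite ?divr_gt0.
  move=> [t' r] /= [/Hd1 ht hr].
  have ht2 : modulus (rC r0 * ec t' - rC r0 * ec t) < d / 2.
    rewrite -mulrBr modulusM modulusR ger0_norm// (le_lt_trans _ ht)//.
    by rewrite ler_piMl ?modulus_ge0 ?ltW.
  have hr2 : modulus (rC r * ec t' - rC r0 * ec t') < d / 2.
    by rewrite -mulrBl -rCB modulusM modulus_ec mulr1 modulusR.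
  have h1 : modulus (rC r0 * ec t' - rC r0 * ec t) < d by lra.
  have h2 : modulus (rC r * ec t' - rC r0 * ec t) < d.
    by have := modulus_tri (rC r * ec t') (rC r0 * ec t) (rC r0 * ec t'); lra.
  have := Hd _ h1; have := Hd _ h2 => A B.
  have := modulus_tri (g (rC r * ec t')) (g (rC r0 * ec t')) (g (rC r0 * ec t)).
  by rewrite (modulusC (g (rC r0 * ec t))); lra.
move=> /(_ _ K)/nearRP[d d0 Hd]; exists d => // r r_0 r_1 /Hd H.
rewrite -MeanB; [|exact: cc|exact: cc].
apply: Mean_le_on; first by apply: contC_B; exact: cc.
by move=> t tI; apply/ltW/H; rewrite /= in_itv.
Qed.

End Mean.
Opaque ec.

(** * The Cauchy formula and Taylor expansions *)

Section Cauchy.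
Context {R : realType}.
Local Notation C := (Cplx R).
Implicit Types (f : C -> C) (z w : C).

Definition holo f := forall z : C, modulus z < 1 -> derivable f z 1.

Lemma expr_small (q e : R) : 0 <= q -> q < 1 -> 0 < e -> exists N0, forall N, (N0 <= N)%N -> q ^+ N < e.
Proof.
move=> q0 q1 e0; have /cvgrPdist_lt/(_ e e0)[N0 _ H] : (fun n => q ^+ n) @ \oo --> (0 : R).
  by apply: cvg_expr; rewrite ger0_norm.
exists N0 => N /H; rewrite /= sub0r normrN ger0_norm//; exact: exprn_ge0.
Qed.

Lemma modulus_small0 z : (forall e : R, 0 < e -> modulus z <= e) -> z = 0.
Proof.
move=> H; apply/eqP; rewrite -modulus_eq0 eq_le modulus_ge0 andbT leNgt; apply/negP => z0.
by have := H (modulus z / 2) ltac:(lra); lra.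
Qed.

Lemma derivable_near f (g : C -> C) z (d : R) : 0 < d ->
  (forall y, modulus (y - z) < d -> f y = g y) -> derivable f z 1 -> derivable g z 1.
Proof.
move=> d0 fg /derivableP/cderivP H; suff [] : is_derive z 1 g ('D_1 f z) by [].
apply/cderivP => e /H[d1 d10 Hd]; exists (Num.min d d1); first by rewrite lt_min d0.
move=> h; rewrite lt_min => /andP[hd /Hd]; rewrite !fg//.
  by rewrite subrr modulus0.
by rewrite addrAC subrr add0r.
Qed.

Lemma derivable_pow n z : derivable (fun y : C => y ^+ n) z 1.
Proof.
elim: n => [|n ih]; first exact: derivable_cst.
rewrite (_ : (fun y => _) = (fun y : C => y * y ^+ n)); last by apply/funext => y; rewrite exprS.
by apply: derivableM; [exact: derivable_id|exact: ih].
Qed.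

Section Kernel.
Variables (f : C -> C) (z0 : C).
Hypotheses (hf : holo f) (z01 : modulus z0 < 1).

Let q w := if w == z0 then 'D_1 f z0 else (f w - f z0) / (w - z0).
Let k w := w * q w.

Let dq w : modulus w < 1 -> w != z0 -> derivable q w 1.
Proof.
move=> w1 wz; have d0 : 0 < modulus (w - z0) by rewrite modulus_gt0 subr_eq0.
apply: (@derivable_near (fun y => (f y - f z0) * (y - z0)^-1) _ _ _ d0).
  move=> y yd; rewrite /q; case: eqP => // yz; move: yd.
  by rewrite yz modulusC ltxx.
apply: derivableM.
  by apply: derivableB; [exact: hf|exact: derivable_cst].
apply: derivableV; first by rewrite subr_eq0.
by apply: derivableB; [exact: derivable_id|exact: derivable_cst].
Qed.

Let cq w : modulus w < 1 -> {for w, continuous q}.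
Proof.
move=> w1; have [->|wz] := eqVneq w z0; last exact/derivable_cont/dq.
have /derivableP/cderivP H := hf z01.
apply/contCP => e e0; have e20 : 0 < e / 2 by lra.
have [d d0 Hd] := H _ e20; exists d => // y /Hd; rewrite (addrC z0) subrK /q eqxx.
case: eqP => [->|/eqP yz]; first by move=> _; rewrite subrr modulus0.
have yz0 : 0 < modulus (y - z0) by rewrite modulus_gt0 subr_eq0.
move=> Hy; apply: (@le_lt_trans _ _ (e / 2)); last by lra.
rewrite -(ler_pM2r yz0) -modulusM mulrBl divfK// subr_eq0//.
Qed.

Let ck w : modulus w < 1 -> {for w, continuous k}.
Proof. by move=> w1; apply: (@continuousM C C (fun w => w) q w); [exact: cvg_id|exact: cq]. Qed.

Let dk w : modulus w < 1 -> w != z0 -> derivable k w 1.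
Proof. by move=> w1 wz; apply: derivableM; [exact: derivable_id|exact: dq]. Qed.

Let Phi (r : R) := Mean (fun t => k (rC r * ec t)).

Let Phi_out (r1 r2 : R) : modulus z0 < r1 -> r1 <= r2 -> r2 < 1 -> Phi r1 = Phi r2.
Proof.
move=> zr r12 r21; have r10 := le_lt_trans (modulus_ge0 _) zr.
apply: (@mean_annulus R k r1 r2 ((r2 + 1) / 2)) => //; first by lra.
  by move=> w _ wr; apply: ck; lra.
move=> w /andP[w1 w2]; apply: dk; first by lra.
by apply: contraTneq w1 => ->; rewrite -ltNge.
Qed.

Let Phi_in (r1 r2 : R) : 0 < r1 -> r1 <= r2 -> r2 < modulus z0 -> Phi r1 = Phi r2.
Proof.
move=> r10 r12 r21.
apply: (@mean_annulus R k r1 r2 (modulus z0)) => //.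
  by move=> w _ wr; apply: ck; exact: le_lt_trans wr z01.
move=> w /andP[w1 w2]; apply: dk; first exact: le_lt_trans w2 (lt_trans r21 z01).
by apply: contraTneq w2 => ->; rewrite -ltNge.
Qed.

Let Phi0 : Phi 0 = 0.
Proof.
rewrite /Phi -[RHS](Mean_cst 0); apply: eq_Mean => t.
by rewrite rC0 mul0r /k mul0r.
Qed.

Let Phi_z0 : Phi (modulus z0) = 0.
Proof.
have z1 := z01.
have := modulus_ge0 z0; rewrite le_eqVlt => /predU1P[<-|zpos]; first exact: Phi0.
apply: modulus_small0 => e e0; have e20 : 0 < e / 2 by lra.
have [d1 d10 H1] := mean_cont (lexx 0) ltr01 ck e20.
have [d2 d20 H2] := mean_cont (ltW zpos) z01 ck e20.
rewrite -/(Phi 0) Phi0 in H1.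
have [r1 [r10 r1d r1z]] : exists r1 : R, [/\ 0 < r1, r1 < d1 & r1 < modulus z0].
  exists (Num.min d1 (modulus z0) / 2).
  have m0 : 0 < Num.min d1 (modulus z0) by rewrite lt_min d10.
  have m1 : Num.min d1 (modulus z0) <= d1 by rewrite ge_min lexx.
  have m2 : Num.min d1 (modulus z0) <= modulus z0 by rewrite ge_min lexx orbT.
  by split; lra.
have [r2 [r12 r2z r2d]] : exists r2 : R, [/\ r1 <= r2, r2 < modulus z0 & `|r2 - modulus z0| < d2].
  exists (Num.max r1 (modulus z0 - d2 / 2)).
  have m0 : r1 <= Num.max r1 (modulus z0 - d2 / 2) by rewrite le_max lexx.
  have m1 : modulus z0 - d2 / 2 <= Num.max r1 (modulus z0 - d2 / 2) by rewrite le_max lexx orbT.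
  have m2 : Num.max r1 (modulus z0 - d2 / 2) < modulus z0 by rewrite gt_max r1z/=; lra.
  by split=> //; rewrite ltr_norml; lra.
have r1d' : `|r1 - 0| < d1 by rewrite subr0 gtr0_norm.
have r11 : r1 < 1 by lra.
have h1 : modulus (Phi r1 - 0) <= e / 2 by exact: H1 (ltW r10) r11 r1d'.
have r20 : 0 <= r2 by lra.
have r21 : r2 < 1 by lra.
have h2 : modulus (Phi r2 - Phi (modulus z0)) <= e / 2 := H2 r2 r20 r21 r2d.
rewrite (Phi_in r10 r12 r2z) in h1.
move: h1 h2; generalize (Phi (modulus z0)) (Phi r2) => x y; rewrite subr0 => h1 h2.
by have := modulusD (x - y) y; rewrite subrK modulusC; lra.
Qed.

(** The function [w * (f w - f z0) / (w - z0)] extends continuously to [z0] and vanishes at [0]. Its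
mean over the circle of radius [r] does not depend on [r] on either side of the radius of [z0]; by continuity it is
constant, and it vanishes for [r = 0]. This is the formula of Cauchy for [f]. *)
Lemma cauchy_kernel (r : R) : modulus z0 < r -> r < 1 ->
  Mean (fun t => rC r * ec t * (f (rC r * ec t) - f z0) / (rC r * ec t - z0)) = 0.
Proof.
move=> zr r1; have r0 := le_lt_trans (modulus_ge0 _) zr.
have -> : Mean (fun t => rC r * ec t * (f (rC r * ec t) - f z0) / (rC r * ec t - z0)) = Phi r.
  apply: eq_Mean => t; rewrite /k /q; case: eqP => [wz|_]; last by rewrite mulrA.
  by move: zr; rewrite -wz modulus_circp// ltxx.
apply: modulus_small0 => e e0.
have [d d0 H] := mean_cont (modulus_ge0 z0) z01 ck e0.
rewrite -/(Phi (modulus z0)) Phi_z0 in H; have z1 := z01.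
have [r' [zr' rr' r'd]] : exists r', [/\ modulus z0 < r', r' <= r & `|r' - modulus z0| < d].
  exists (Num.min r (modulus z0 + d / 2)).
  have m1 : Num.min r (modulus z0 + d / 2) <= modulus z0 + d / 2 by rewrite ge_min lexx orbT.
  have m2 : modulus z0 < Num.min r (modulus z0 + d / 2) by rewrite lt_min zr/=; lra.
  by split=> //; [rewrite ge_min lexx|rewrite ltr_norml; lra].
have r'1 : r' < 1 by lra.
have r'0 : 0 <= r' by have := modulus_ge0 z0; lra.
by have := H r' r'0 r'1 r'd; rewrite subr0 -/(Phi r') (Phi_out zr' rr' r1).
Qed.

End Kernel.

(** The Taylor coefficient as a mean over the circle of radius [r]. *)
Definition coefR f (r : R) n : C := Mean (fun t => f (rC r * ec t) * (rC r * ec t) ^- n).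
(** The radius [1 / 2] is arbitrary, by [coefRE]. *)
Definition tcoef f n := coefR f (1 / 2) n.

Lemma circ_neq0 (r t : R) : 0 < r -> rC r * ec t != 0.
Proof. by move=> r0; rewrite -modulus_gt0 modulus_circp//. Qed.

Lemma ccont_holo f (r : R) : holo f -> 0 < r -> r < 1 -> ccont (fun t => f (rC r * ec t)).
Proof.
move=> hf r0 r1; apply: (@contC_comp _ f (fun t => rC r * ec t) (ccont_circ r)) => t.
by apply/derivable_cont/hf; rewrite modulus_circp//.
Qed.

Lemma ccont_circV (r : R) n : 0 < r -> ccont (fun t => (rC r * ec t) ^- n).
Proof.
move=> r0; apply: contC_V; first by apply: contC_X; exact: ccont_circ.
by move=> t; rewrite expf_neq0// circ_neq0.
Qed.

Lemma coefR_indep f (r1 r2 : R) n : holo f -> 0 < r1 -> r1 <= r2 -> r2 < 1 ->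
  coefR f r1 n = coefR f r2 n.
Proof.
move=> hf r10 r12 r21.
have dg w : w != 0 -> modulus w < 1 -> derivable (fun w => f w * w ^- n) w 1.
  move=> w0 w1; apply: derivableM; first exact: hf.
  apply: derivableV; first by rewrite expf_neq0.
  exact: derivable_pow.
apply: (@mean_annulus R (fun w => f w * w ^- n) r1 r2 ((r2 + 1) / 2)) => //; first by lra.
  by move=> w w0 wr; apply: derivable_cont; apply: dg => //; lra.
move=> w /andP[w1 w2]; apply: dg; last by lra.
by rewrite -modulus_gt0; lra.
Qed.

Lemma coefRE f (r : R) n : holo f -> 0 < r -> r < 1 -> coefR f r n = tcoef f n.
Proof.
move=> hf r0 r1; have [rh|hr] := leP r (1 / 2).
  by apply: coefR_indep => //; lra.
by rewrite /tcoef; symmetry; apply: coefR_indep => //; lra.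
Qed.

Lemma circle_bound f (r : R) : holo f -> 0 < r -> r < 1 ->
  exists B, forall t, 0 <= t <= 2 * pi -> modulus (f (rC r * ec t)) <= B.
Proof.
move=> hf r0 r1; have [c _ Hc] := @EVT_max R _ _ _ (@tau_ge0 R)
  (continuous_subspaceT (rcontE (cont_mod (ccont_holo hf r0 r1)))).
by exists (modulus (f (rC r * ec c))) => t tI; apply: Hc; rewrite in_itv.
Qed.

Lemma geo_expand (x : C) N : x != 1 -> (1 - x)^-1 = \sum_(n < N) x ^+ n + x ^+ N / (1 - x).
Proof.
move=> x1; have x1' : 1 - x != 0 by rewrite subr_eq0 eq_sym.
elim: N => [|N ih]; first by rewrite big_ord0 add0r expr0 mul1r.
rewrite big_ord_recr/= {1}ih -addrA; congr (_ + _).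
by rewrite -[X in _ = X + _](mulfK x1') -mulrDl exprS; congr (_ / _); ring.
Qed.

(** Geometric expansion of the kernel [w / (w - z)] to order [N]. *)
Lemma cauchy_expand f z (r : R) N : holo f -> modulus z < r -> r < 1 ->
  Mean (fun t => f (rC r * ec t) * (rC r * ec t / (rC r * ec t - z))) =
  \sum_(n < N) tcoef f n * z ^+ n +
  Mean (fun t => f (rC r * ec t) * ((z / (rC r * ec t)) ^+ N * (rC r * ec t / (rC r * ec t - z)))).
Proof.
move=> hf zr r1; have r0 := le_lt_trans (modulus_ge0 _) zr.
have nz t : rC r * ec t - z != 0.
  rewrite subr_eq0; apply: contraTneq zr => <-; by rewrite modulus_circp// ltxx.
have n0 t := circ_neq0 t r0.
have cf := ccont_holo hf r0 r1.
have cw := ccont_circ r.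
have cwi : ccont (fun t => (rC r * ec t)^-1) by exact: contC_V.
have cwz : ccont (fun t => rC r * ec t / (rC r * ec t - z)).
  by apply: contC_M => //; apply: contC_V => //; apply: contC_B => //; exact: contC_cst.
have ct n : ccont (fun t => f (rC r * ec t) * (rC r * ec t) ^- n * z ^+ n).
  apply: contC_M; last exact: contC_cst.
  by apply: contC_M => //; exact: ccont_circV.
rewrite (eq_bigr (fun n : 'I_N => Mean (fun t => f (rC r * ec t) * (rC r * ec t) ^- n * z ^+ n))); last first.
  move=> n _; rewrite -(coefRE n hf r0 r1) mulrC -MeanZ; last by apply: contC_M => //; exact: ccont_circV.
  by apply: eq_Mean => t; rewrite mulrC.
rewrite -Mean_sum// -MeanD; last 2 first.
- exact: contC_sum.
- apply: contC_M => //; apply: contC_M => //; apply: contC_X; apply: contC_M => //; exact: contC_cst.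
apply: eq_Mean => t; set w := rC r * ec t.
have w0 : w != 0 := n0 t. have wz : w - z != 0 := nz t.
have E : w / (w - z) = (1 - z / w)^-1.
  by rewrite -[1](divff w0) -mulrBl invf_div.
rewrite {1}E (geo_expand N); last first.
  by apply: contra_neq wz => H; rewrite -[z](divfK w0) H mul1r subrr.
rewrite mulrDr; congr (_ + _); last by rewrite E.
rewrite mulr_sumr; apply: eq_bigr => n _; rewrite expr_div_n; ring.
Qed.

Lemma cauchy_rem (g : R -> C) z (r B : R) N : ccont g -> 0 <= B -> modulus z < r ->
  (forall t, 0 <= t <= 2 * pi -> modulus (g t) <= B) ->
  modulus (Mean (fun t => g t * ((z / (rC r * ec t)) ^+ N * (rC r * ec t / (rC r * ec t - z))))) <=
  B * ((modulus z / r) ^+ N * (r / (r - modulus z))).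
Proof.
move=> cg B0 zr gB; have r0 := le_lt_trans (modulus_ge0 _) zr.
have nz t : rC r * ec t - z != 0.
  rewrite subr_eq0; apply: contraTneq zr => <-; by rewrite modulus_circp// ltxx.
have n0 t := circ_neq0 t r0.
apply: Mean_le_on.
  apply: contC_M => //; apply: contC_M.
    apply: contC_X; apply: contC_M; first exact: contC_cst.
    by apply: contC_V => //; exact: ccont_circ.
  apply: contC_M; first exact: ccont_circ.
  by apply: contC_V => //; apply: contC_B; [exact: ccont_circ|exact: contC_cst].
move=> t /gB gt; have mw := modulus_circp t r0; have wz := nz t.
move: mw wz; generalize (rC r * ec t) => w mw wz.
rewrite !modulusM modulusX !modulusM !modulusV mw.
apply: ler_pM => //; rewrite ?modulus_ge0//.
  by rewrite mulr_ge0 ?exprn_ge0 ?divr_ge0 ?modulus_ge0 ?(ltW r0).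
apply: ler_wpM2l; first by rewrite exprn_ge0// divr_ge0 ?modulus_ge0 ?(ltW r0).
apply: ler_wpM2l; first exact: ltW.
rewrite lef_pV2 ?posrE ?modulus_gt0 ?subr_gt0//.
by rewrite -mw; exact: modulus_subD.
Qed.

(** The mean of the kernel [w / (w - z)] is [1], so [cauchy_kernel] expresses [f z] as the mean of [f] against
this kernel, which is then expanded. *)
Lemma taylor_rem f z (r B : R) N : holo f -> modulus z < r -> r < 1 -> 0 <= B ->
  (forall t, 0 <= t <= 2 * pi -> modulus (f (rC r * ec t)) <= B) ->
  modulus (f z - \sum_(n < N) tcoef f n * z ^+ n) <= B * ((modulus z / r) ^+ N * (r / (r - modulus z))).
Proof.
move=> hf zr r1 B0 fB; have r0 := le_lt_trans (modulus_ge0 _) zr.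
have z1 : modulus z < 1 by lra.
have nz t : rC r * ec t - z != 0.
  rewrite subr_eq0; apply: contraTneq zr => <-; by rewrite modulus_circp// ltxx.
have cf := ccont_holo hf r0 r1.
have cw := ccont_circ r.
have cwz : ccont (fun t => rC r * ec t / (rC r * ec t - z)).
  by apply: contC_M => //; apply: contC_V => //; apply: contC_B => //; exact: contC_cst.
have K1 : Mean (fun t => rC r * ec t / (rC r * ec t - z)) = 1.
  apply/eqP; rewrite -subr_eq0; apply/eqP/modulus_small0 => e e0.
  have h1 : holo (fun=> 1) by move=> w _; exact: derivable_cst.
  have q0 : 0 <= modulus z / r by rewrite divr_ge0 ?modulus_ge0// ltW.
  have q1 : modulus z / r < 1 by rewrite ltr_pdivrMr// mul1r.
  have c0 : 0 < r / (r - modulus z) by rewrite divr_gt0// subr_gt0.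
  have [M HM] := expr_small q0 q1 (divr_gt0 e0 c0).
  have := @cauchy_expand (fun=> 1) z r M.+1 h1 zr r1.
  have -> : Mean (fun t => 1 * (rC r * ec t / (rC r * ec t - z))) = Mean (fun t => rC r * ec t / (rC r * ec t - z)).
    by apply: eq_Mean => t; rewrite mul1r.
  rewrite (_ : \sum_(n < M.+1) _ = 1); last first.
    rewrite big_ord_recl/= expr0 mulr1 big1 ?addr0.
      by rewrite /tcoef /coefR -[RHS](Mean_cst 1); apply: eq_Mean => t; rewrite expr0 invr1 mulr1.
    move=> i _; rewrite -(coefRE _ h1 r0 r1) /coefR (eq_Mean (h := fun t => (rC r) ^- (lift ord0 i) * ec t ^- (lift ord0 i))).
      rewrite MeanZ ?Mean_ecV ?mulr0 ?mul0r//.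
      by apply: contC_V; [apply: contC_X; exact: ccont_ec|move=> t; rewrite expf_neq0// ec_neq0].
    by move=> t; rewrite mul1r exprMn invfM.
  move=> ->; rewrite addrAC subrr add0r.
  have := @cauchy_rem (fun=> 1) z r 1 M.+1 (contC_cst 1) ler01 zr.
  move=> H; apply: (le_trans (H _)); first by move=> t _; rewrite modulus1.
  by rewrite mul1r -ler_pdivlMr// ltW// HM.
have := cauchy_kernel hf z1 zr r1.
rewrite (eq_Mean (h := fun t => f (rC r * ec t) * (rC r * ec t / (rC r * ec t - z)) -
   f z * (rC r * ec t / (rC r * ec t - z)))); last first.
  by move=> t; field; exact: nz.
rewrite MeanB; [|exact: contC_M|by apply: contC_M => //; exact: contC_cst].
rewrite MeanZ// K1 mulr1 (cauchy_expand N hf zr r1) => /eqP; rewrite subr_eq0 => /eqP <-.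
rewrite addrAC subrr add0r; exact: (cauchy_rem N cf B0 zr fB).
Qed.

(** [f] is the sum of the power series [a] at every point of the disc. *)
Definition has_coefs (a : nat -> C) f := forall z, modulus z < 1 ->
  forall e : R, 0 < e -> exists N0, forall N, (N0 <= N)%N ->
    modulus (f z - \sum_(n < N) a n * z ^+ n) <= e.

Lemma taylor f : holo f -> has_coefs (tcoef f) f.
Proof.
move=> hf z z1 e e0; pose r := (modulus z + 1) / 2.
have z0 := modulus_ge0 z.
have zr : modulus z < r by rewrite /r; lra.
have r1 : r < 1 by rewrite /r; lra.
have r0 : 0 < r by lra.
have [B HB] := circle_bound hf r0 r1.
have B0 : 0 <= B by apply: le_trans (HB 0 _); rewrite ?modulus_ge0// lexx tau_ge0.
have q0 : 0 <= modulus z / r by rewrite divr_ge0 ?modulus_ge0// ltW.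
have q1 : modulus z / r < 1 by rewrite ltr_pdivrMr// mul1r.
have c0 : 0 < (B + 1) * (r / (r - modulus z)) by rewrite mulr_gt0 ?divr_gt0 ?subr_gt0//; lra.
have [M HM] := expr_small q0 q1 (divr_gt0 e0 c0); exists M => N /HM H.
apply: (le_trans (taylor_rem N hf zr r1 B0 HB)).
apply: (@le_trans _ _ ((B + 1) * (r / (r - modulus z)) * (modulus z / r) ^+ N)).
  rewrite -mulrA [X in _ <= _ * X]mulrC ler_wpM2r//; last lra.
  apply: mulr_ge0; first exact: exprn_ge0.
  by apply: ltW; rewrite divr_gt0 ?subr_gt0.
by rewrite mulrC -ler_pdivlMr// ltW.
Qed.

End Cauchy.

(** * The Bessel inequality and Taylor coefficients *)

Section Bessel.
Context {R : realType}.
Local Notation C := (Cplx R).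
Implicit Types (f : C -> C) (g h : R -> C).

Lemma re_Mean g : reC (Mean g) = (2 * pi)^-1 * Rint 0 (2 * pi) (fun t => reC (g t)).
Proof. by rewrite /Mean reM reR imR mul0r subr0 [reC (Cint _ _ _)]re_mk. Qed.

Lemma le_re_Mean g h : ccont g -> ccont h -> (forall t, reC (g t) <= reC (h t)) ->
  reC (Mean g) <= reC (Mean h).
Proof.
move=> cg ch gh; rewrite !re_Mean; apply: ler_wpM2l; first by rewrite invr_ge0 tau_ge0.
by apply: le_Rint; [exact: cont_re|exact: cont_re|move=> t _; exact: gh].
Qed.

Lemma ccont_ecV n : ccont (fun t : R => ec t ^- n).
Proof.
apply: contC_V; first by apply: contC_X; exact: ccont_ec.
by move=> t; rewrite expf_neq0// ec_neq0.
Qed.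
Lemma ccont_ecX n : ccont (fun t : R => ec t ^+ n).
Proof. by apply: contC_X; exact: ccont_ec. Qed.

Lemma Mean_ecXV n m : Mean (fun t : R => ec t ^+ n * ec t ^- m) = (n == m)%:R.
Proof.
have [mn|/ltnW nm] := leqP m n.
  have := subnK mn; move: (n - m)%N => k <-.
  rewrite (eq_Mean (h := fun t => ec t ^+ k)); first by rewrite Mean_ecX -{2}[m]add0n eqn_add2r.
  by move=> t; rewrite exprD mulfK// expf_neq0// ec_neq0.
have := subnK nm; move: (m - n)%N => k <-.
rewrite (eq_Mean (h := fun t => ec t ^- k)).
  by rewrite Mean_ecV -{1}[n]add0n eqn_add2r eq_sym.
by move=> t; rewrite exprD invfM mulrC mulfVK// expf_neq0// ec_neq0.
Qed.

Lemma re_sum (I : Type) (s : seq I) (P : pred I) (F : I -> C) :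
  reC (\sum_(i <- s | P i) F i) = \sum_(i <- s | P i) reC (F i).
Proof. by elim/big_ind2 : _ => [|? ? ? ? <- <-|//]; rewrite ?re0 ?reD. Qed.

(** With [p] the trigonometric polynomial of the coefficients, [2 Re (g conj p) - |p|^2 <= |g|^2] pointwise, and the
means of [g conj p] and [|p|^2] are both the sum on the left. *)
Lemma bessel g (B : R) N : ccont g -> (forall t, modulus (g t) <= B) ->
  \sum_(n < N) modulus (Mean (fun t => g t * ec t ^- n)) ^+ 2 <= B ^+ 2.
Proof.
move=> cg gB; pose c n : C := Mean (fun t => g t * ec t ^- n).
pose p (t : R) : C := \sum_(n < N) c n * ec t ^+ n.
have cp : ccont p.
  by apply: contC_sum => n; apply: contC_M; [exact: contC_cst|exact: ccont_ecX].
have cpj : ccont (fun t => cjC (p t)) by exact: cont_cj.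
have cge n : ccont (fun t => g t * ec t ^- n) by apply: contC_M => //; exact: ccont_ecV.
have pjE t : cjC (p t) = \sum_(n < N) cjC (c n) * ec t ^- n.
  rewrite /p (big_morph _ cjD (id1 := 0)); last by rewrite -rC0 cjR.
  by apply: eq_bigr => n _; rewrite cjM cjX ec_cj exprVn.
have Mpj h : ccont h -> Mean (fun t => h t * cjC (p t)) = \sum_(n < N) cjC (c n) * Mean (fun t => h t * ec t ^- n).
  move=> ch; rewrite (eq_Mean (h := fun t => \sum_(n < N) cjC (c n) * (h t * ec t ^- n))).
    have che n : ccont (fun t => h t * ec t ^- n) by apply: contC_M => //; exact: ccont_ecV.
    rewrite Mean_sum; first by apply: eq_bigr => n _; rewrite MeanZ.
    by move=> n; apply: contC_M; [exact: contC_cst|exact: che].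
  by move=> t; rewrite pjE mulr_sumr; apply: eq_bigr => n _; ring.
have Mp n : (n < N)%N -> Mean (fun t => p t * ec t ^- n) = c n.
  move=> nN; rewrite (eq_Mean (h := fun t => \sum_(m < N) c m * (ec t ^+ m * ec t ^- n))).
    have che m : ccont (fun t : R => ec t ^+ m * ec t ^- n).
      by apply: contC_M; [exact: ccont_ecX|exact: ccont_ecV].
    rewrite Mean_sum; last by move=> m; apply: contC_M; [exact: contC_cst|exact: che].
    rewrite (bigD1 (Ordinal nN))//= big1 ?addr0; first by rewrite MeanZ// Mean_ecXV eqxx mulr1.
    by move=> m mn; rewrite MeanZ// Mean_ecXV (negPf (_ : m != n :> nat)) ?mulr0.
  by move=> t; rewrite /p mulr_suml; apply: eq_bigr => m _; ring.
have E : \sum_(n < N) modulus (c n) ^+ 2 = reC (Mean (fun t => p t * cjC (p t))).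
  rewrite Mpj// re_sum; apply: eq_bigr => n _; rewrite Mp// mulrC mul_cj reR//.
have E2 : reC (Mean (fun t => g t * cjC (p t))) = \sum_(n < N) modulus (c n) ^+ 2.
  by rewrite Mpj// re_sum; apply: eq_bigr => n _; rewrite -/(c n) mulrC mul_cj reR.
rewrite -/(c _) (_ : B ^+ 2 = reC (Mean (fun=> rC (B ^+ 2)))); last by rewrite Mean_cst reR.
have cgp : ccont (fun t => g t * cjC (p t)) by exact: contC_M.
have cpp : ccont (fun t => p t * cjC (p t)) by exact: contC_M.
have : reC (Mean (fun t => g t * cjC (p t) + g t * cjC (p t) - p t * cjC (p t))) <=
   reC (Mean (fun=> rC (B ^+ 2))).
  apply: le_re_Mean.
  - by apply: contC_B => //; exact: contC_D.
  - exact: contC_cst.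
  move=> t; rewrite reR mul_cj reB reD reR; have := gB t; move: (g t) (p t) => u v uB.
  apply: (@le_trans _ _ (modulus u ^+ 2)); last by rewrite lerXn2r ?nnegrE ?modulus_ge0 ?(le_trans (modulus_ge0 _) uB).
  rewrite !modulus_sq !reimE.
  have := sqr_ge0 (reC u - reC v); have := sqr_ge0 (imC u - imC v); nra.
rewrite MeanB//; last exact: contC_D.
by rewrite MeanD// reB reD -E E2; lra.
Qed.

Lemma sum_sq_small (u : nat -> R) (K : R) : (forall n, 0 <= u n) ->
  (forall N, \sum_(n < N) u n ^+ 2 <= K) ->
  forall e, 0 < e -> exists N0, forall n, (N0 <= n)%N -> u n <= e.
Proof.
move=> u0 uK e e0.
have cs : cvgn (series (fun n => u n ^+ 2)).
  apply: nondecreasing_is_cvgn.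
    by apply/nondecreasing_seqP => n; rewrite /series/= big_nat_recr//= lerDl sqr_ge0.
  by exists K => _ [N _ <-]; rewrite /series/= big_mkord.
have /cvgrPdist_lt/(_ (e ^+ 2)) := cvg_series_cvg_0 cs.
rewrite exprn_gt0// => /(_ erefl)[N0 _ H]; exists N0 => n /H.
rewrite /= sub0r normrN ger0_norm ?sqr_ge0// => h.
by rewrite -(@ler_pXn2r _ 2) ?nnegrE ?u0 ?ltW.
Qed.

(** Square summable sequences tend to zero, so this follows from the Bessel inequality for the conjugate of [g]. *)
Lemma riemann_lebesgue g (B : R) : ccont g -> (forall t, modulus (g t) <= B) ->
  forall e : R, 0 < e -> exists N0, forall n, (N0 <= n)%N ->
    modulus (Mean (fun t => g t * ec t ^+ n)) <= e.
Proof.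
move=> cg gB e e0.
have cj : ccont (fun t => cjC (g t)) by exact: cont_cj.
have jB t : modulus (cjC (g t)) <= B by rewrite modulus_cj.
have [N0 H] := @sum_sq_small (fun n => modulus (Mean (fun t => cjC (g t) * ec t ^- n))) (B ^+ 2)
  (fun n => modulus_ge0 _) (fun N => bessel N cj jB) e e0.
exists N0 => n /H; rewrite -modulus_cj -Mean_cj; last by apply: contC_M => //; exact: ccont_ecV.
rewrite (eq_Mean (h := fun t => g t * ec t ^+ n))// => t.
rewrite cjM -[g t in RHS](@conjcK R); congr (_ * _).
by rewrite -exprVn -ec_cj cjX -[ec t in RHS](@conjcK R).
Qed.

Lemma tcoef_mean f n (r : R) : holo f -> 0 < r -> r < 1 ->
  tcoef f n * rC r ^+ n = Mean (fun t => f (rC r * ec t) * ec t ^- n).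
Proof.
move=> hf r0 r1; rewrite -(coefRE n hf r0 r1) /coefR mulrC -MeanZ.
  apply: eq_Mean => t; rewrite exprMn invfM mulrCA mulVKf//.
  by rewrite expf_neq0// rC_eq0 lt0r_neq0.
apply: contC_M; first exact: ccont_holo.
exact: ccont_circV.
Qed.

Lemma bernoulli (e : R) n : 0 <= e -> e <= 1 -> 1 - n%:R * e <= (1 - e) ^+ n.
Proof.
move=> e0 e1; elim: n => [|n ih]; first by rewrite mul0r subr0 expr0.
have e1' : 0 <= 1 - e by lra.
rewrite exprS; apply: le_trans (ler_wpM2l e1' ih).
have n0 : 0 <= n%:R :> R by [].
rewrite -natr1; nra.
Qed.

(** The Bessel inequality on the circle of radius [r] carries weights [r ^ (2 n)], which tend to [1] with [r]. *)
Lemma tcoef_bessel f (B : R) N : holo f -> (forall z : C, modulus z < 1 -> modulus (f z) <= B) ->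
  \sum_(n < N) modulus (tcoef f n) ^+ 2 <= B ^+ 2.
Proof.
move=> hf fB; set S := \sum_(n < N) _.
have S0 : 0 <= S by apply: sumr_ge0 => n _; exact: sqr_ge0.
have key (r : R) : 0 < r -> r < 1 -> S * r ^+ (2 * N) <= B ^+ 2.
  move=> r0 r1.
  have b := bessel N (ccont_holo hf r0 r1) (fun t => fB (rC r * ec t) ltac:(by rewrite modulus_circp)).
  apply: le_trans b; rewrite /S mulr_suml; apply: ler_sum => n _.
  rewrite -(tcoef_mean n hf r0 r1) modulusM modulusX modulusR ger0_norm ?(ltW r0)// exprMn.
  apply: ler_wpM2l; first exact: sqr_ge0.
  rewrite -exprM mulnC; apply: ler_wiXn2l; rewrite ?(ltW r0) ?(ltW r1)//.
  by rewrite leq_mul2r/= ltnW.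
rewrite leNgt; apply/negP => BS.
(* by the Bernoulli inequality the weights for r = 1 - e are too close to 1 *)
pose e := (S - B ^+ 2) / (2 * (S + 1) * ((2 * N)%:R + 1)).
have D0 : 0 < 2 * (S + 1) * ((2 * N)%:R + 1) by rewrite !mulr_gt0//; lra.
have e0 : 0 < e by rewrite divr_gt0// subr_gt0.
have B0 : 0 <= B ^+ 2 by exact: sqr_ge0.
have n0 : 0 <= (2 * N)%:R :> R by [].
have eD : e * (2 * (S + 1) * ((2 * N)%:R + 1)) = S - B ^+ 2 by rewrite /e divfK// lt0r_neq0.
have e1 : e < 1 by rewrite ltr_pdivrMr//; nra.
have /key : 0 < 1 - e by lra.
move=> /(_ ltac:(lra)); have := @bernoulli e (2 * N) (ltW e0) (ltW e1).
move: e0 e1 eD n0; move: e ((2 * N)%:R : R) => e' x e0 e1 eD n0 h1 h2.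
have : S * (1 - x * e') <= B ^+ 2 by apply: le_trans h2; rewrite ler_wpM2l.
have : S * (x * e') <= e' * ((S + 1) * (x + 1)) by nra.
nra.
Qed.

Lemma tcoef_le f (B : R) n : 0 <= B -> holo f ->
  (forall z : C, modulus z < 1 -> modulus (f z) <= B) -> modulus (tcoef f n) <= B.
Proof.
move=> B0 hf fB; have := tcoef_bessel n.+1 hf fB; rewrite big_ord_recr/= => H.
rewrite -(@ler_pXn2r _ 2) ?nnegrE ?modulus_ge0//; apply: le_trans H.
by rewrite lerDr; apply: sumr_ge0 => i _; exact: sqr_ge0.
Qed.

Lemma tcoef_tends0 f (B : R) : holo f ->
  (forall z : C, modulus z < 1 -> modulus (f z) <= B) ->
  forall e : R, 0 < e -> exists N0, forall n, (N0 <= n)%N -> modulus (tcoef f n) <= e.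
Proof.
move=> hf fB; exact: (@sum_sq_small (fun n => modulus (tcoef f n)) (B ^+ 2)
  (fun n => modulus_ge0 _) (fun N => tcoef_bessel N hf fB)).
Qed.

(** Compare the mean defining the coefficient with the order of vanishing on small circles. *)
Lemma tcoef_vanish f m (K d : R) n : holo f -> 0 < d ->
  (forall z : C, modulus z <= d -> modulus (f z) <= K * modulus z ^+ m) -> (n < m)%N -> tcoef f n = 0.
Proof.
move=> hf d0 fK nm; apply: modulus_small0 => e e0.
have K0 : 0 <= K.
  have := fK (rC d); rewrite modulusR ger0_norm ?(ltW d0)// => /(_ (lexx _)) H.
  have dm : 0 < d ^+ m by rewrite exprn_gt0.
  by rewrite -(pmulr_lge0 _ dm) (le_trans _ H)// modulus_ge0.
pose r := Num.min (Num.min d (1 / 2)) (e / (K + 1)).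
have [r0 rd r2 rK] : [/\ 0 < r, r <= d, r <= 1 / 2 & r <= e / (K + 1)].
  by rewrite !lt_min !ge_min !lexx !orbT d0 !divr_gt0//; lra.
have r1 : r < 1 by lra.
have H : modulus (tcoef f n) * r ^+ n <= K * r ^+ m.
  have -> : modulus (tcoef f n) * r ^+ n = modulus (tcoef f n * rC r ^+ n).
    by rewrite modulusM modulusX modulusR ger0_norm ?(ltW r0).
  rewrite (tcoef_mean n hf r0 r1); apply: Mean_le.
    by apply: contC_M; [exact: ccont_holo|exact: ccont_ecV].
  move=> t; rewrite modulusM modulusV modulusX modulus_ec expr1n invr1 mulr1.
  by have := fK (rC r * ec t); rewrite modulus_circp//; exact.
have rn : 0 < r ^+ n by rewrite exprn_gt0.
rewrite -(ler_pM2r rn) (le_trans H)//.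
have -> : m = (n + (m - n).-1.+1)%N by rewrite prednK ?subn_gt0// subnKC// ltnW.
rewrite exprD exprS mulrCA [leRHS]mulrC ler_wpM2l ?(ltW rn)//.
have p1 : r ^+ (m - n).-1 <= 1 by rewrite exprn_ile1 ?(ltW r0) ?(ltW r1).
have p0 : 0 <= r ^+ (m - n).-1 by rewrite exprn_ge0 ?(ltW r0).
apply: (@le_trans _ _ (K * r)).
  by rewrite ler_wpM2l// ler_piMr// ltW.
have : r * (K + 1) <= e by rewrite -ler_pdivlMr//; lra.
nra.
Qed.

End Bessel.

(** * Power series *)

Section PowerSeries.
Context {R : realType}.
Local Notation C := (Cplx R).
Implicit Types (f : C -> C) (a c : nat -> C).

Lemma geo_sum_le (x : R) m n : 0 <= x -> x < 1 -> \sum_(m <= k < n) x ^+ k <= x ^+ m / (1 - x).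
Proof.
move=> x0 x1; have x1' : 0 < 1 - x by lra.
have xm k : 0 <= x ^+ k by exact: exprn_ge0.
have [nm|mn] := leqP n m; first by rewrite big_geq// divr_ge0// ltW.
rewrite ler_pdivlMr//.
have -> : (\sum_(m <= k < n) x ^+ k) * (1 - x) = x ^+ m - x ^+ n.
  elim: n mn => // n ih; rewrite ltnS leq_eqVlt => /predU1P[<-|mn].
    by rewrite big_nat1 exprS; ring.
  by rewrite big_nat_recr ?(ltnW mn)//= mulrDl ih// exprS; ring.
by rewrite lerBlDr lerDl.
Qed.

(** Each of the [n + 1] first terms of the geometric series is at least [x ^ n]. *)
Lemma nat_geo (x : R) n : 0 <= x -> x < 1 -> n.+1%:R * x ^+ n <= (1 - x)^-1.
Proof.
move=> x0 x1; have := @geo_sum_le x 0 n.+1 x0 x1; rewrite expr0 mul1r; apply: le_trans.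
rewrite big_mkord.
have -> : n.+1%:R * x ^+ n = \sum_(i < n.+1) x ^+ n by rewrite sumr_const card_ord mulr_natl.
by apply: ler_sum => i _; apply: ler_wiXn2l; rewrite ?(ltW x1)// -ltnS.
Qed.

Lemma sum_diff (c : nat -> C) m n : (m <= n)%N ->
  \sum_(k < n) c k - \sum_(k < m) c k = \sum_(m <= k < n) c k.
Proof.
move=> mn; rewrite -!(big_mkord xpredT) (@big_cat_nat _ _ _ m 0 n)//=.
by rewrite addrAC subrr add0r.
Qed.

Lemma geo_series c (K x : R) : 0 <= x -> x < 1 -> (forall n, modulus (c n) <= K * x ^+ n) ->
  exists L : C, forall N, modulus (L - \sum_(n < N) c n) <= K * (x ^+ N / (1 - x)).
Proof.
move=> x0 x1 cK.
have K0 : 0 <= K by have := cK 0%N; rewrite expr0 mulr1; exact/le_trans/modulus_ge0.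
have tail m n : (m <= n)%N -> modulus (\sum_(k < n) c k - \sum_(k < m) c k) <= K * (x ^+ m / (1 - x)).
  move=> mn; rewrite sum_diff//; apply: (le_trans (modulus_sum _ _ _)).
  apply: (@le_trans _ _ (\sum_(m <= k < n) K * x ^+ k)); first by apply: ler_sum => k _; exact: cK.
  by rewrite -mulr_sumr ler_wpM2l// geo_sum_le.
have real (u : nat -> R) : (forall n, `|u n| <= K * x ^+ n) ->
  exists l : R, forall e : R, 0 < e -> exists N0, forall N, (N0 <= N)%N -> `|l - \sum_(k < N) u k| < e.
  move=> uK.
  have cu : cvgn (series u).
    apply: normed_cvg; apply: (@series_le_cvg R _ (geometric K x)).
    - by move=> n; exact: normr_ge0.
    - by move=> n; rewrite mulr_ge0// exprn_ge0.
    - exact: uK.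
    - by apply: is_cvg_geometric_series; rewrite ger0_norm.
  exists (limn (series u)) => e e0.
  have /cvgrPdist_lt/(_ e e0)[N0 _ H] := cu.
  by exists N0 => N /H; rewrite /series/= big_mkord.
have [l1 H1] := real (fun k => reC (c k)) (fun k => le_trans (le_re _) (cK k)).
have [l2 H2] := real (fun k => imC (c k)) (fun k => le_trans (le_im _) (cK k)).
have im_sumo n : imC (\sum_(k < n) c k) = \sum_(k < n) imC (c k).
  by elim/big_ind2 : _ => [|? ? ? ? <- <-|//]; rewrite ?im0 ?imD.
exists (mkC l1 l2) => N; apply/ler_addgt0Pr => e e0.
have e20 : 0 < e / 2 by rewrite divr_gt0.
have [N1 {}H1] := H1 _ e20; have [N2 {}H2] := H2 _ e20.
pose M := maxn N (maxn N1 N2).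
have NM : (N <= M)%N by rewrite leq_maxl.
have N1M : (N1 <= M)%N by rewrite /M maxnCA leq_maxl.
have N2M : (N2 <= M)%N by rewrite /M maxnA leq_maxr.
have h : modulus (mkC l1 l2 - \sum_(k < M) c k) <= e.
  rewrite (le_trans (modulus_le _))// reB imB re_mk im_mk re_sum im_sumo.
  by have := H1 M N1M; have := H2 M N2M; lra.
have := modulus_tri (mkC l1 l2) (\sum_(k < N) c k) (\sum_(k < M) c k); have := tail _ _ NM; lra.
Qed.

(** The terms of a convergent series are differences of partial sums, hence bounded. *)
Lemma has_coefs_bound a f (r : R) : has_coefs a f -> 0 <= r -> r < 1 ->
  exists2 B : R, 0 <= B & forall n, modulus (a n) * r ^+ n <= B.
Proof.
move=> haf r0 r1; have := haf (rC r); rewrite modulusR ger0_norm// => /(_ r1 1 ltr01)[N0 H].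
pose B := 2 + \sum_(n < N0) modulus (a n) * r ^+ n.
have t0 n : 0 <= modulus (a n) * r ^+ n by rewrite mulr_ge0 ?modulus_ge0// exprn_ge0.
exists B; first by rewrite addr_ge0// sumr_ge0.
move=> n; have [nN|Nn] := ltnP n N0.
  rewrite /B (bigD1 (Ordinal nN))//= addrCA lerDl addr_ge0// sumr_ge0//.
have -> : modulus (a n) * r ^+ n = modulus (a n * rC r ^+ n).
  by rewrite modulusM modulusX modulusR ger0_norm.
apply: (@le_trans _ _ 2); last by rewrite lerDl sumr_ge0.
have h1 := H n Nn; have h2 := H n.+1 (leqW Nn).
have -> : a n * rC r ^+ n = (f (rC r) - \sum_(k < n) a k * rC r ^+ k) -
  (f (rC r) - \sum_(k < n.+1) a k * rC r ^+ k).
  by rewrite big_ord_recr/=; ring.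
by apply: (le_trans (modulusB _ _)); lra.
Qed.

Definition dcoef a n : C := n.+1%:R * a n.+1.

(** The powers are estimated by induction on [n]; the factor [s ^ 2] on the left avoids the exponent [n - 2]. *)
Lemma pow_taylor2 (z h : C) (s : R) n : modulus z <= s -> modulus (z + h) <= s ->
  modulus ((z + h) ^+ n - z ^+ n - n%:R * z ^+ n.-1 * h) * s ^+ 2 <= n%:R ^+ 2 * s ^+ n * modulus h ^+ 2.
Proof.
move=> zs zhs; have s0 := le_trans (modulus_ge0 _) zs.
elim: n => [|n ih].
  by rewrite !expr0 subrr !mul0r subrr modulus0 mul0r expr0n/= !mul0r.
have -> : (z + h) ^+ n.+1 - z ^+ n.+1 - n.+1%:R * z ^+ n.+1.-1 * h =
  (z + h) * ((z + h) ^+ n - z ^+ n - n%:R * z ^+ n.-1 * h) + n%:R * z ^+ n.-1 * h * h.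
  case: n {ih} => [|n]; first by rewrite !expr0 !expr1; ring.
  by rewrite /= -[n.+2%:R]natr1 !exprS; ring.
set D := modulus (_ - _ - _) in ih *.
have h0 := modulus_ge0 h.
have zn : n%:R * modulus z ^+ n.-1 * s ^+ 2 <= n%:R * s ^+ n.+1.
  case: n {ih D} => [|n]; first by rewrite !mul0r.
  rewrite /= -mulrA ler_wpM2l// (_ : s ^+ n.+2 = s ^+ n * s ^+ 2); last by rewrite -exprD addn2.
  by rewrite ler_wpM2r ?sqr_ge0// lerXn2r ?nnegrE ?modulus_ge0.
apply: (@le_trans _ _ (s * (n%:R ^+ 2 * s ^+ n * modulus h ^+ 2) + n%:R * s ^+ n.+1 * modulus h ^+ 2)).
  apply: (@le_trans _ _ ((modulus (z + h) * D + n%:R * modulus z ^+ n.-1 * modulus h * modulus h) * s ^+ 2)).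
    rewrite ler_wpM2r ?sqr_ge0// (le_trans (modulusD _ _))// !modulusM modulusX modulus_nat//.
  rewrite mulrDl; apply: lerD.
    rewrite -mulrA; apply: ler_pM => //; rewrite ?modulus_ge0// mulr_ge0 ?sqr_ge0 ?modulus_ge0//.
  have -> : n%:R * modulus z ^+ n.-1 * modulus h * modulus h * s ^+ 2 =
    n%:R * modulus z ^+ n.-1 * s ^+ 2 * modulus h ^+ 2 by ring.
  by rewrite ler_wpM2r ?sqr_ge0.
have -> : s * (n%:R ^+ 2 * s ^+ n * modulus h ^+ 2) + n%:R * s ^+ n.+1 * modulus h ^+ 2 =
  (n%:R ^+ 2 + n%:R) * s ^+ n.+1 * modulus h ^+ 2 by rewrite [s ^+ n.+1]exprS; ring.
rewrite ler_wpM2r ?sqr_ge0// ler_wpM2r ?exprn_ge0// -natr1.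
have n0 : 0 <= n%:R :> R by []. nra.
Qed.

(** Termwise differentiation: the difference quotients differ from the derived series by at most
[|h|] times the sum of [n^2 |a_n| s^(n-2)], which converges geometrically. *)
Lemma has_coefs_derive a f : has_coefs a f ->
  exists2 g : C -> C, has_coefs (dcoef a) g &
    forall z : C, modulus z < 1 -> is_derive z (1 : C) f (g z).
Proof.
move=> haf.
(* half of the geometric decay absorbs the factor n of the derived series *)
have dK (z : C) : modulus z < 1 -> exists K v : R, [/\ 0 <= K, 0 <= v, v < 1 &
   forall n, modulus (dcoef a n * z ^+ n) <= K * v ^+ n].
  move=> z1; have z0 := modulus_ge0 z; pose r := (1 + modulus z) / 2.
  have r1 : r < 1 by rewrite /r; lra. have zr : modulus z < r by rewrite /r; lra.
  have r0 : 0 < r by lra.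
  have [B B0 HB] := has_coefs_bound haf (ltW r0) r1.
  pose x := modulus z / r.
  have x0 : 0 <= x by rewrite divr_ge0// ltW.
  have x1 : x < 1 by rewrite ltr_pdivrMr// mul1r.
  pose v := Num.sqrt x.
  have v0 : 0 <= v by exact: sqrtr_ge0.
  have vv : v ^+ 2 = x by rewrite sqr_sqrtr.
  have v1 : v < 1 by rewrite -(@ltr_pXn2r _ 2) ?nnegrE// vv expr1n.
  exists (B / r * (1 - v)^-1), v; split => //.
    by apply: mulr_ge0; [apply: divr_ge0 => //; exact: ltW|rewrite invr_ge0 subr_ge0; exact: ltW].
  move=> n; rewrite /dcoef !modulusM modulus_nat modulusX.
  have an : modulus (a n.+1) <= B / r ^+ n.+1 by rewrite ler_pdivlMr ?exprn_gt0.
  apply: (@le_trans _ _ (n.+1%:R * (B / r ^+ n.+1) * modulus z ^+ n)).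
    by rewrite ler_wpM2r ?exprn_ge0// ler_wpM2l.
  have -> : n.+1%:R * (B / r ^+ n.+1) * modulus z ^+ n = B / r * (n.+1%:R * v ^+ n) * v ^+ n.
    have E : v ^+ n * v ^+ n = modulus z ^+ n / r ^+ n.
      by rewrite -exprMn -expr2 vv expr_div_n.
    have -> : B / r * (n.+1%:R * v ^+ n) * v ^+ n = B / r * n.+1%:R * (v ^+ n * v ^+ n) by ring.
    rewrite E exprS; field.
    by rewrite expf_neq0 lt0r_neq0.
  apply: ler_wpM2r; first exact: exprn_ge0.
  apply: ler_wpM2l; first by apply: divr_ge0 => //; exact: ltW.
  exact: nat_geo.
have [g Hg] : exists g : C -> C, forall z : C, modulus z < 1 ->
   forall e : R, 0 < e -> exists N0, forall N, (N0 <= N)%N ->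
    modulus (g z - \sum_(n < N) dcoef a n * z ^+ n) <= e.
  suff /boolp.choice[g Hg] : forall z : C, exists L : C, modulus z < 1 ->
      forall e : R, 0 < e -> exists N0, forall N, (N0 <= N)%N ->
    modulus (L - \sum_(n < N) dcoef a n * z ^+ n) <= e by exists g.
  move=> z; have [z1|z1] := boolP (modulus z < 1); last by exists 0.
  have [K [v [K0 v0 v1 HK]]] := dK z z1.
  have [L HL] := geo_series v0 v1 HK; exists L => _ e e0.
  have v1' : 0 < 1 - v by lra.
  have c0 : 0 < (K + 1) / (1 - v) by rewrite divr_gt0//; lra.
  have [N0 H] := expr_small v0 v1 (divr_gt0 e0 c0).
  exists N0 => N /H h; apply: (le_trans (HL N)).
  apply: (@le_trans _ _ ((K + 1) / (1 - v) * v ^+ N)).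
    rewrite mulrA mulrAC ler_wpM2r ?exprn_ge0// ler_wpM2r ?invr_ge0 ?(ltW v1')//; lra.
  by rewrite mulrC -ler_pdivlMr// ltW.
exists g => // z z1; have z0 := modulus_ge0 z.
pose s := (1 + modulus z) / 2; pose r := (1 + s) / 2.
have zs : modulus z < s by rewrite /s; lra.
have s1 : s < 1 by rewrite /s; lra.
have sr : s < r by rewrite /r; lra.
have r1 : r < 1 by rewrite /r; lra.
have s0 : 0 < s by lra. have r0 : 0 < r by lra.
have [B B0 HB] := has_coefs_bound haf (ltW r0) r1.
pose x := s / r.
have x0 : 0 <= x by rewrite divr_ge0// ltW.
have x1 : x < 1 by rewrite ltr_pdivrMr// mul1r.
(* [n x^(n/4)] is bounded, so the sum of [n^2 x^n] is dominated by a geometric series *)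
have [Q Q0 HQ] : exists2 Q : R, 0 <= Q & forall N, \sum_(n < N) n%:R ^+ 2 * x ^+ n <= Q.
  pose v := Num.sqrt x; pose u := Num.sqrt v.
  have v0 : 0 <= v by exact: sqrtr_ge0.
  have vv : v ^+ 2 = x by rewrite sqr_sqrtr.
  have v1 : v < 1 by rewrite -(@ltr_pXn2r _ 2) ?nnegrE// vv expr1n.
  have u0 : 0 <= u by exact: sqrtr_ge0.
  have uu : u ^+ 2 = v by rewrite sqr_sqrtr.
  have u1 : u < 1 by rewrite -(@ltr_pXn2r _ 2) ?nnegrE// uu expr1n.
  exists ((1 - u)^-1 ^+ 2 * (1 - v)^-1); first by rewrite mulr_ge0 ?sqr_ge0// invr_ge0; lra.
  move=> N; apply: (@le_trans _ _ (\sum_(n < N) (1 - u)^-1 ^+ 2 * v ^+ n)).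
    apply: ler_sum => n _; rewrite -[in leLHS]vv -uu.
    have -> : n%:R ^+ 2 * u ^+ 2 ^+ 2 ^+ n = (n%:R * u ^+ n) ^+ 2 * u ^+ 2 ^+ n.
      rewrite [(n%:R * _) ^+ 2]exprMn -!exprM -[RHS]mulrA -exprD; congr (_ * u ^+ _).
      by rewrite [(n * 2)%N]mulnC addnn -mul2n.
    rewrite ler_wpM2r ?exprn_ge0// lerXn2r ?nnegrE ?mulr_ge0 ?exprn_ge0 ?invr_ge0//; first by lra.
    apply: le_trans (nat_geo n u0 u1); rewrite ler_wpM2r ?exprn_ge0// ler_nat//.
  rewrite -mulr_sumr ler_wpM2l ?sqr_ge0//.
  by have := @geo_sum_le v 0 N v0 v1; rewrite expr0 mul1r big_mkord.
pose K := B * Q / s ^+ 2.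
have K0 : 0 <= K by apply: divr_ge0; [exact: mulr_ge0|exact: sqr_ge0].
have key h : modulus h <= s - modulus z -> modulus (f (z + h) - f z - g z * h) <= K * modulus h ^+ 2.
  move=> hs; have zh : modulus (z + h) <= s by have := modulusD z h; lra.
  apply/ler_addgt0Pr => e e0; have e3 : 0 < e / 3 by lra.
  have [N1 H1] := haf (z + h) ltac:(lra) _ e3.
  have [N2 H2] := haf z z1 _ e3.
  have [N3 H3] := Hg z z1 _ e3.
  pose N := maxn N1 (maxn N2 N3).
  have {}H1 := H1 N.+1 ltac:(rewrite leqW// leq_maxl//).
  have {}H2 := H2 N.+1 ltac:(rewrite leqW// /N maxnCA leq_maxl//).
  have {}H3 := H3 N ltac:(rewrite /N maxnA leq_maxr//).
  have dE : \sum_(n < N.+1) a n * (n%:R * z ^+ n.-1) = \sum_(n < N) dcoef a n * z ^+ n.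
    rewrite big_ord_recl/= mul0r mulr0 add0r; apply: eq_bigr => n _.
    by rewrite /dcoef /bump/= add1n; ring.
  have ms : modulus (\sum_(n < N.+1) a n * ((z + h) ^+ n - z ^+ n - n%:R * z ^+ n.-1 * h)) <= K * modulus h ^+ 2.
    apply: (le_trans (modulus_sum _ _ _)).
    apply: (@le_trans _ _ (\sum_(n < N.+1) B / s ^+ 2 * modulus h ^+ 2 * (n%:R ^+ 2 * x ^+ n))).
      apply: ler_sum => n _; rewrite modulusM.
      have an : modulus (a n) <= B / r ^+ n by rewrite ler_pdivlMr ?exprn_gt0.
      have grid : modulus ((z + h) ^+ n - z ^+ n - n%:R * z ^+ n.-1 * h) <= n%:R ^+ 2 * s ^+ n * modulus h ^+ 2 / s ^+ 2.
        by rewrite ler_pdivlMr ?exprn_gt0// pow_taylor2// ltW.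
      apply: (le_trans (ler_pM (modulus_ge0 _) (modulus_ge0 _) an grid)).
      rewrite le_eqVlt; apply/orP; left; apply/eqP.
      rewrite /x [(s / r) ^+ n]expr_div_n; move: (s ^+ n) (r ^+ n) (s ^+ 2) (modulus h ^+ 2) (n%:R ^+ 2) => p1 p2 p3 p4 p5.
      ring.
    rewrite -mulr_sumr.
    have -> : K * modulus h ^+ 2 = B / s ^+ 2 * modulus h ^+ 2 * Q by rewrite /K; ring.
    apply: ler_wpM2l => //; apply: mulr_ge0; last exact: sqr_ge0.
    by apply: divr_ge0 => //; exact: sqr_ge0.
  have h1 : modulus h <= 1 by lra.
  have -> : f (z + h) - f z - g z * h =
    (f (z + h) - \sum_(n < N.+1) a n * (z + h) ^+ n) - (f z - \sum_(n < N.+1) a n * z ^+ n)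
    - (g z - \sum_(n < N) dcoef a n * z ^+ n) * h
    + \sum_(n < N.+1) a n * ((z + h) ^+ n - z ^+ n - n%:R * z ^+ n.-1 * h).
    rewrite -dE.
    have -> : \sum_(n < N.+1) a n * ((z + h) ^+ n - z ^+ n - n%:R * z ^+ n.-1 * h) =
      \sum_(n < N.+1) a n * (z + h) ^+ n - \sum_(n < N.+1) a n * z ^+ n - (\sum_(n < N.+1) a n * (n%:R * z ^+ n.-1)) * h.
      by rewrite mulr_suml -!sumrB; apply: eq_bigr => n _; ring.
    ring.
  apply: (le_trans (modulusD _ _)); rewrite addrC; apply: lerD => //.
  apply: (le_trans (modulusB _ _)).
  have := modulusB (f (z + h) - \sum_(n < N.+1) a n * (z + h) ^+ n) (f z - \sum_(n < N.+1) a n * z ^+ n).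
  have : modulus ((g z - \sum_(n < N) dcoef a n * z ^+ n) * h) <= e / 3.
    rewrite modulusM -[leRHS]mulr1; apply: ler_pM => //; exact: modulus_ge0.
  by lra.
apply/cderivP => e e0.
exists (Num.min (s - modulus z) (e / (K + 1))).
  by rewrite lt_min subr_gt0 zs divr_gt0//; lra.
move=> h; rewrite lt_min => /andP[/ltW/key H he]; apply: (le_trans H).
rewrite expr2 mulrA ler_wpM2r ?modulus_ge0//.
move: he; rewrite ltr_pdivlMr; last by lra.
have := modulus_ge0 h; nra.
Qed.

Lemma has_coefs_holo a f : has_coefs a f -> holo f.
Proof. by move=> /has_coefs_derive[g _ dg] z /dg[]. Qed.

Lemma has_coefs0 a f : has_coefs a f -> f 0 = a 0%N.
Proof.
move=> haf; apply/eqP; rewrite -subr_eq0; apply/eqP/modulus_small0 => e e0.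
have [N0 H] := haf 0 ltac:(by rewrite modulus0) e e0.
have := H N0.+1 (leqnSn _).
rewrite big_ord_recl/= expr0 mulr1 big1 ?addr0// => i _.
by rewrite exprS mul0r mulr0.
Qed.

Lemma has_coefs_eq a f f' : has_coefs a f -> (forall z : C, modulus z < 1 -> f z = f' z) -> has_coefs a f'.
Proof. by move=> haf ff z z1 e e0; rewrite -ff//; exact: haf. Qed.

Lemma has_coefs_eqa a a' f : has_coefs a f -> a =1 a' -> has_coefs a' f.
Proof. by move=> haf /funext <-. Qed.

Lemma has_coefs_derive1 a f : has_coefs a f -> has_coefs (dcoef a) (derive1 f).
Proof.
move=> /has_coefs_derive[g ag dg]; apply: has_coefs_eq ag _ => z z1.
by rewrite derive1E; have [_ ->] := dg z z1.
Qed.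

Lemma has_coefs_derive1n a f n : has_coefs a f -> has_coefs (iter n dcoef a) (derive1n n f).
Proof. by move=> haf; elim: n => // n ih; exact: has_coefs_derive1. Qed.

Lemma iter_dcoef a n m : iter n dcoef a m * m`!%:R = a (m + n)%N * (m + n)`!%:R.
Proof.
elim: n m => [|n ih] m; first by rewrite addn0.
rewrite /= /dcoef mulrAC -natrM -factS mulrC ih addSnnS//.
Qed.

(** Links the iterated derivatives at [0] with the coefficients of any power series for [f]. *)
Lemma taylor_coefE a f n : has_coefs a f -> taylor_coef f n = a n.
Proof.
move=> haf; rewrite /taylor_coef (has_coefs0 (has_coefs_derive1n n haf)).
have := iter_dcoef a n 0; rewrite fact0 mulr1 add0n => ->.
by rewrite mulfK// pnatr_eq0 -lt0n fact_gt0.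
Qed.

Lemma taylor_coef_tcoef f : holo f -> taylor_coef f =1 tcoef f.
Proof. by move=> hf n; exact: taylor_coefE (taylor hf). Qed.

Lemma tcoefE a f : has_coefs a f -> tcoef f =1 a.
Proof. by move=> haf n; rewrite -(taylor_coef_tcoef (has_coefs_holo haf)) (taylor_coefE _ haf). Qed.


Lemma has_coefsD a b f g : has_coefs a f -> has_coefs b g ->
  has_coefs (fun n => a n + b n) (fun z => f z + g z).
Proof.
move=> haf hbg z z1 e e0; have e20 : 0 < e / 2 by rewrite divr_gt0.
have [N1 H1] := haf z z1 _ e20; have [N2 H2] := hbg z z1 _ e20.
exists (maxn N1 N2) => N; rewrite geq_max => /andP[/H1 h1 /H2 h2].
have -> : f z + g z - \sum_(n < N) (a n + b n) * z ^+ n =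
   (f z - \sum_(n < N) a n * z ^+ n) + (g z - \sum_(n < N) b n * z ^+ n).
  have -> : \sum_(n < N) (a n + b n) * z ^+ n = \sum_(n < N) a n * z ^+ n + \sum_(n < N) b n * z ^+ n.
    by rewrite -big_split/=; apply: eq_bigr => n _; ring.
  ring.
by apply: (le_trans (modulusD _ _)); lra.
Qed.

Lemma has_coefsZ a f (c : C) : has_coefs a f -> has_coefs (fun n => c * a n) (fun z => c * f z).
Proof.
move=> haf z z1 e e0.
have c0 : 0 < modulus c + 1 by have := modulus_ge0 c; lra.
have [N0 H] := haf z z1 _ (divr_gt0 e0 c0); exists N0 => N /H h.
have -> : c * f z - \sum_(n < N) c * a n * z ^+ n = c * (f z - \sum_(n < N) a n * z ^+ n).
  by rewrite mulrBr mulr_sumr; congr (_ - _); apply: eq_bigr => n _; ring.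
rewrite modulusM; move: h; rewrite ler_pdivlMr//; have := modulus_ge0 (f z - \sum_(n < N) a n * z ^+ n).
by nra.
Qed.

Lemma has_coefs_shift a f : has_coefs a f ->
  has_coefs (fun n => if n is m.+1 then a m else 0) (fun z => z * f z).
Proof.
move=> haf z z1 e e0; have [N0 H] := haf z z1 e e0; exists N0.+1 => [[//|N]].
rewrite ltnS => /H h; rewrite big_ord_recl/= mul0r add0r.
rewrite (eq_bigr (fun i : 'I_N => z * (a i * z ^+ i))) => [|i _]; last first.
  by rewrite /bump/= add1n exprS; ring.
rewrite -mulr_sumr -mulrBr modulusM (le_trans _ h)// ler_piMl ?modulus_ge0//; exact: ltW.
Qed.

Lemma has_coefs_poly (p : {poly C}) : has_coefs (fun n => p`_n) (fun z => p.[z]).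
Proof.
move=> z z1 e e0; exists (size p) => N pN.
rewrite (horner_coef_wide _ pN) subrr modulus0; exact: ltW.
Qed.

End PowerSeries.

(** * Entire functions and polynomials on the circle *)

Section Entire.
Context {R : realType}.
Local Notation C := (Cplx R).
Implicit Types (f g : C -> C) (p q : {poly C}).

Definition entire f := forall z : C, derivable f z 1.

Lemma entire_holo f : entire f -> holo f.
Proof. by move=> ef z _; exact: ef. Qed.

Lemma entire_cst (c : C) : entire (fun=> c).
Proof. by move=> z; exact: derivable_cst. Qed.
Lemma entireD f g : entire f -> entire g -> entire (fun z => f z + g z).
Proof. by move=> ef eg z; apply: derivableD; [exact: ef|exact: eg]. Qed.
Lemma entireM f g : entire f -> entire g -> entire (fun z => f z * g z).
Proof. by move=> ef eg z; apply: derivableM; [exact: ef|exact: eg]. Qed.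
Lemma entire_id : entire (fun z => z).
Proof. by move=> z; exact: derivable_id. Qed.
Lemma entire_poly p : entire (fun z => p.[z]).
Proof.
elim/poly_ind: p => [|p c ih].
  rewrite (_ : (fun z => _) = fun=> 0); first exact: entire_cst.
  by apply/funext => z; rewrite horner0.
rewrite (_ : (fun z => _) = fun z => p.[z] * z + c).
  by apply: entireD; [apply: entireM; [exact: ih|exact: entire_id]|exact: entire_cst].
by apply/funext => z; rewrite hornerMXaddC.
Qed.
Lemma entire_comp f g : entire f -> entire g -> entire (fun z => g (f z)).
Proof. by move=> ef eg z; apply: derivable_compC; [exact: ef|exact: eg]. Qed.
Lemma entire_exp f : entire f -> entire (fun z => expC (f z)).
Proof. by move=> ef; exact: (entire_comp ef (@derivable_expC R)). Qed.

Lemma holo_cst (c : C) : holo (fun=> c).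
Proof. exact/entire_holo/entire_cst. Qed.
Lemma holoD f g : holo f -> holo g -> holo (fun z => f z + g z).
Proof. by move=> ef eg z z1; apply: derivableD; [exact: ef|exact: eg]. Qed.
Lemma holoN f : holo f -> holo (fun z => - f z).
Proof. by move=> ef z z1; apply: derivableN; exact: ef. Qed.
Lemma holoB f g : holo f -> holo g -> holo (fun z => f z - g z).
Proof. by move=> ef eg; exact: (holoD ef (holoN eg)). Qed.
Lemma holoM f g : holo f -> holo g -> holo (fun z => f z * g z).
Proof. by move=> ef eg z z1; apply: derivableM; [exact: ef|exact: eg]. Qed.
Lemma holoX f n : holo f -> holo (fun z => f z ^+ n).
Proof. by move=> hf z z1; exact: (@derivable_compC R f (fun y => y ^+ n) z (hf z z1) (@derivable_pow R n (f z))). Qed.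
Lemma holo_exp f : holo f -> holo (fun z => expC (f z)).
Proof. by move=> hf z z1; exact: (@derivable_compC R f (@expC R) z (hf z z1) (@derivable_expC R (f z))). Qed.
Lemma holo_poly p : holo (fun z => p.[z]).
Proof. exact/entire_holo/entire_poly. Qed.
Lemma holo_sum (I : Type) (s : seq I) (F : I -> C -> C) : (forall i, holo (F i)) ->
  holo (fun z => \sum_(i <- s) F i z).
Proof.
move=> hF; elim: s => [|i s ih].
  by rewrite (_ : (fun z => _) = fun=> 0); [exact: holo_cst|apply/funext => z; rewrite big_nil].
rewrite (_ : (fun z => _) = fun z => F i z + \sum_(i <- s) F i z).
  by apply: holoD; [exact: hF|exact: ih].
by apply/funext => z; rewrite big_cons.
Qed.

Lemma entire_double f : entire f -> entire (fun z => f (2 * z)).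
Proof.
by move=> ef; exact: (@entire_comp (fun z => 2 * z) f (entireM (@entire_cst 2) entire_id) ef).
Qed.

Lemma double_half (t : R) : 2 * (rC (2^-1) * ec t) = ec t :> C.
Proof. by rewrite mulrA -[2]rCn -rCM divff// rC1 mul1r. Qed.

(** The formula of Cauchy for [f ^ k] on the unit circle bounds [|f z| ^ k] by [B ^ k] times a constant independent
of [k]. The function [f (2 w)] is used to place that circle inside the unit disc. *)
Lemma max_principle f (B : R) : entire f -> (forall t, modulus (f (ec t)) <= B) ->
  forall z, modulus z < 1 -> modulus (f z) <= B.
Proof.
move=> ef fB z z1; rewrite leNgt; apply/negP => Bf.
have B0 : 0 <= B := le_trans (modulus_ge0 _) (fB 0).
have f0 := le_lt_trans B0 Bf.
have zh : modulus (rC (2^-1) * z) = modulus z / 2.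
  by rewrite modulusM modulusR ger0_norm// mulrC.
have zr : modulus (rC (2^-1) * z) < 2^-1 by rewrite zh; lra.
have h1 : (2^-1 : R) < 1 by lra.
pose c := (2^-1 : R) / (2^-1 - modulus (rC (2^-1) * z)).
have c0 : 0 < c by rewrite divr_gt0// subr_gt0.
(* c does not depend on k, so it is beaten by the k-th power of a ratio greater than 1 *)
have key k : modulus (f z) ^+ k <= B ^+ k * c.
  have hk : holo (fun w => f (2 * w) ^+ k).
    exact: (holoX (entire_holo (entire_double ef))).
  have := @taylor_rem R _ (rC (2^-1) * z) (2^-1) (B ^+ k) 0 hk zr h1 (exprn_ge0 _ B0).
  rewrite big_ord0 subr0 expr0 mul1r modulusX.
  have -> : 2 * (rC (2^-1) * z) = z.
    by rewrite mulrA -[2]rCn -rCM divff// rC1 mul1r.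
  apply=> t _; rewrite double_half modulusX lerXn2r ?nnegrE ?modulus_ge0//.
have q0 : 0 <= B / modulus (f z) by rewrite divr_ge0// modulus_ge0.
have q1 : B / modulus (f z) < 1 by rewrite ltr_pdivrMr// mul1r.
have [N0 H] := expr_small q0 q1 (divr_gt0 ltr01 c0).
have := H N0 (leqnn _); rewrite expr_div_n ltr_pdivrMr ?exprn_gt0// => h.
have : B ^+ N0 * c < modulus (f z) ^+ N0 by rewrite -ltr_pdivlMr// mulrC -[c^-1]div1r.
by rewrite ltNge key.
Qed.

Lemma entire_bound f : entire f -> exists2 B : R, 0 <= B & forall z, modulus z < 1 -> modulus (f z) <= B.
Proof.
move=> ef; have hf2 := entire_holo (entire_double ef).
have r34 : (3 / 4 : R) < 1 by lra.
have [B' HB'] := circle_bound hf2 (r := 3 / 4) ltac:(lra) r34.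
have B'0 : 0 <= B' by apply: le_trans (HB' 0 _); rewrite ?modulus_ge0// lexx tau_ge0.
exists (B' * 3); first by rewrite mulr_ge0.
move=> z z1.
have zh : modulus (rC (2^-1) * z) = modulus z / 2.
  by rewrite modulusM modulusR ger0_norm// mulrC.
have zr : modulus (rC (2^-1) * z) < 3 / 4 by rewrite zh; have := modulus_ge0 z; lra.
have := @taylor_rem R _ (rC (2^-1) * z) (3 / 4) B' 0 hf2 zr r34 B'0 HB'.
rewrite big_ord0 subr0 expr0 mul1r.
have -> : 2 * (rC (2^-1) * z) = z.
  by rewrite mulrA -[2]rCn -rCM divff// rC1 mul1r.
move=> h; apply: (le_trans h); rewrite ler_wpM2l// ler_pdivrMr ?subr_gt0// zh; lra.
Qed.

(** The Taylor polynomials of [f (2 w)] converge uniformly on a disc of radius less than [1]. *)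
Lemma entire_approx f (tau : R) : entire f -> 0 < tau ->
  exists p, forall z, modulus z < 1 -> modulus (f z - p.[z]) <= tau.
Proof.
move=> ef t0; have hf2 := entire_holo (entire_double ef).
have r34 : (3 / 4 : R) < 1 by lra.
have [B' HB'] := circle_bound hf2 (r := 3 / 4) ltac:(lra) r34.
have B'0 : 0 <= B' by apply: le_trans (HB' 0 _); rewrite ?modulus_ge0// lexx tau_ge0.
have q0 : (0 : R) <= 2 / 3 by lra. have q1 : (2 / 3 : R) < 1 by lra.
have c0 : 0 < (B' + 1) * 3 by lra.
have [N H] := expr_small q0 q1 (divr_gt0 t0 c0).
pose a := tcoef (fun z => f (2 * z)).
exists (\poly_(i < N) (a i * rC ((2^-1) ^+ i))) => z z1.
have zh : modulus (rC (2^-1) * z) = modulus z / 2.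
  by rewrite modulusM modulusR ger0_norm// mulrC.
have z0 := modulus_ge0 z.
have zr : modulus (rC (2^-1) * z) < 3 / 4 by rewrite zh; lra.
have := @taylor_rem R _ (rC (2^-1) * z) (3 / 4) B' N hf2 zr r34 B'0 HB'.
have -> : 2 * (rC (2^-1) * z) = z.
  by rewrite mulrA -[2]rCn -rCM divff// rC1 mul1r.
rewrite horner_poly; under eq_bigr do rewrite exprMn -rCX mulrA.
move=> h; apply: (le_trans h).
have := H N (leqnn _); rewrite ltr_pdivlMr// => HN.
apply: le_trans (ltW HN).
have qN : (modulus (rC (2^-1) * z) / (3 / 4)) ^+ N <= (2 / 3) ^+ N.
  rewrite lerXn2r ?nnegrE ?divr_ge0 ?modulus_ge0// zh; lra.
have c3 : 3 / 4 / (3 / 4 - modulus (rC (2^-1) * z)) <= 3.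
  by rewrite ler_pdivrMr ?subr_gt0// zh; lra.
have c30 : 0 <= 3 / 4 / (3 / 4 - modulus (rC (2^-1) * z)) by rewrite divr_ge0// subr_ge0 ltW.
have qN0 : 0 <= (modulus (rC (2^-1) * z) / (3 / 4)) ^+ N by rewrite exprn_ge0// divr_ge0 ?modulus_ge0.
apply: (@le_trans _ _ (B' * ((2 / 3) ^+ N * 3))).
  by rewrite ler_wpM2l// ler_pM.
have : 0 <= (2 / 3 : R) ^+ N by exact: exprn_ge0.
by move: ((2 / 3 : R) ^+ N) => x; nra.
Qed.

Lemma ccont_entire f : entire f -> ccont (fun t => f (ec t)).
Proof. by move=> ef; apply: (@contC_comp R f ec (@ccont_ec R)) => t; exact: (derivable_cont (ef _)). Qed.

Lemma ccont_poly p : ccont (fun t => p.[ec t]).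
Proof. exact: (@ccont_entire (fun z => p.[z]) (@entire_poly p)). Qed.

Definition pnorm p : R := \sum_(i < size p) modulus p`_i.

Lemma pnorm_ge0 p : 0 <= pnorm p.
Proof. by apply: sumr_ge0 => i _; exact: modulus_ge0. Qed.

Lemma poly_le_pnorm p (z : C) : modulus z <= 1 -> modulus p.[z] <= pnorm p.
Proof.
move=> z1; rewrite horner_coef (le_trans (modulus_sum _ _ _))//; apply: ler_sum => i _.
by rewrite modulusM modulusX ler_piMr ?modulus_ge0// exprn_ile1// modulus_ge0.
Qed.

Lemma Mean_poly p n : Mean (fun t => p.[ec t] * ec t ^- n) = p`_n.
Proof.
rewrite (eq_Mean (h := fun t => \sum_(i < size p) p`_i * (ec t ^+ i * ec t ^- n))).
  have cX i : ccont (fun t : R => ec t ^+ i * ec t ^- n).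
    by apply: contC_M; [exact: ccont_ecX|exact: ccont_ecV].
  rewrite Mean_sum; last by move=> i; apply: contC_M; [exact: contC_cst|exact: cX].
  rewrite (eq_bigr (fun i : 'I_(size p) => p`_i * (i == n :> nat)%:R)); last first.
    by move=> i _; rewrite MeanZ; [rewrite Mean_ecXV|exact: cX].
  have [np|pn] := ltnP n (size p).
    rewrite (bigD1 (Ordinal np))//= eqxx mulr1 big1 ?addr0// => i ni.
    by rewrite (_ : (i == n :> nat) = false) ?mulr0//; apply: contra_neqF ni => /eqP ni; exact: val_inj.
  rewrite nth_default// big1// => i _.
  by rewrite ltn_eqF ?mulr0// (leq_trans (ltn_ord i)).
by move=> t; rewrite horner_coef mulr_suml; apply: eq_bigr => i _; rewrite mulrA.
Qed.

Lemma Mean_poly0 p : Mean (fun t => p.[ec t]) = p`_0.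
Proof. by rewrite -Mean_poly; apply: eq_Mean => t; rewrite expr0 invr1 mulr1. Qed.

(** On the circle the conjugate of [z] is its inverse, so a power of [z] clears the denominators. *)
Lemma circ_conj p : exists A d, forall t : R, A.[ec t] = ec t ^+ d * cjC p.[ec t].
Proof.
elim/poly_ind: p => [|p c [A [d HA]]].
  by exists 0, 0%N => t; rewrite !horner0 -rC0 cjR mulr0.
exists (A + (cjC c)%:P * 'X^(d.+1)), d.+1 => t.
rewrite hornerMXaddC cjD cjM ec_cj hornerD HA hornerM hornerC hornerXn exprS.
by field; exact: ec_neq0.
Qed.

Lemma circ_re p : exists A d, forall t : R, A.[ec t] = ec t ^+ d * rC (reC p.[ec t]).
Proof.
have [A [d HA]] := circ_conj p; exists ((2^-1)%:P * (A + p * 'X^d)), d => t.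
rewrite hornerM hornerC hornerD HA hornerM hornerXn.
have -> : rC (reC p.[ec t]) = (p.[ec t] + cjC p.[ec t]) / 2.
  have -> : p.[ec t] + cjC p.[ec t] = 2 * rC (reC p.[ec t]).
    by rewrite -[2]rCn; apply: eq_reim; rewrite !reimE; ring.
  by rewrite mulrAC divff ?mul1r// pnatr_eq0.
ring.
Qed.

(** The bump is a polynomial in the real part, hence a polynomial in [z] up to a power of [z], which does not
change the modulus on the circle. *)
Lemma circ_bump p (n : nat) : (0 < n)%N -> exists B D, forall t : R,
  B.[ec t] = ec t ^+ D * rC (reC p.[ec t] * (1 - reC p.[ec t] / n%:R) ^+ n).
Proof.
move=> n0; have [A [d HA]] := circ_re p.
exists (A * ('X^d - (n%:R^-1)%:P * A) ^+ n), (d + d * n)%N => t.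
rewrite hornerM horner_exp hornerD hornerN hornerXn hornerM hornerC HA.
have -> : ec t ^+ d - n%:R^-1 * (ec t ^+ d * rC (reC p.[ec t])) =
  ec t ^+ d * rC (1 - reC p.[ec t] / n%:R).
  by rewrite rCB rC1 rCM rCV rCn; ring.
by rewrite exprMn -exprM exprD rCM rCX; ring.
Qed.

Lemma unif_cont (f : R -> R) (a b : R) : rcont f -> forall e : R, 0 < e ->
  exists2 d : R, 0 < d & forall s t : R, a <= s <= b -> `|t - s| < d -> `|f t - f s| < e.
Proof.
move=> [cf] e e0.
have := @segment_compact R a b => /compact_near_coveringP.
move=> /(_ R (nbhs (0 : R)) (fun h s => `|f (s + h) - f s| < e)).
have K : forall x : R, `[a, b]%classic x ->
  \forall x' \near x & i \near (0 : R), `|f (x' + i) - f x'| < e.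
  move=> x _; have /(@cvgRP _ _ (nbhs x))/(_ (e / 2)) := cf x.
  rewrite divr_gt0// => /(_ erefl)/nearRP[d d0 Hd].
  have d20 : 0 < d / 2 by rewrite divr_gt0.
  exists ([set y | `|y - x| < d / 2], [set h | `|h - 0| < d / 2]); first split => /=.
  - by apply/nearRP; exists (d / 2).
  - by apply/nearRP; exists (d / 2).
  move=> [y h] /= [yx]; rewrite subr0 => hd.
  have h1 := Hd y ltac:(lra).
  have h2 : `|f (y + h) - f x| < e / 2.
    apply: Hd; have := ler_normD (y - x) h; rewrite addrAC; lra.
  have := ler_distD (f x) (f (y + h)) (f y); rewrite (distrC (f x) (f y)); lra.
move=> /(_ _ K)/nearRP[d d0 Hd]; exists d => // s t sab ts.
have := Hd (t - s); rewrite subr0 => /(_ ts s); rewrite /= in_itv/= sab => /(_ isT).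
by rewrite subrKC.
Qed.

End Entire.

(** * One step of the construction *)

Section Step.
Context {R : realType}.
Local Notation C := (Cplx R).
Implicit Types (H B G : {poly C}) (u v : R -> R).

Definition RMean u : R := (2 * pi)^-1 * Rint 0 (2 * pi) u.

Lemma re_MeanE (g : R -> C) : reC (Mean g) = RMean (fun t => reC (g t)).
Proof. exact: re_Mean. Qed.

Lemma RMeanD u v : rcont u -> rcont v -> RMean (fun t => u t + v t) = RMean u + RMean v.
Proof. by move=> cu cv; rewrite /RMean RintD// mulrDr. Qed.
Lemma RMeanZ c u : rcont u -> RMean (fun t => c * u t) = c * RMean u.
Proof. by move=> cu; rewrite /RMean RintZ// mulrCA. Qed.
Lemma RMean_cst c : RMean (fun=> c) = c.
Proof. by rewrite /RMean Rint_cst ?tau_ge0// subr0 mulrCA mulVf ?mulr1// tau_neq0. Qed.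
Lemma le_RMean u v : rcont u -> rcont v -> (forall t, u t <= v t) -> RMean u <= RMean v.
Proof.
move=> cu cv uv; rewrite /RMean ler_wpM2l ?invr_ge0 ?tau_ge0//.
by apply: le_Rint => // t _; exact: uv.
Qed.

Definition bdry H (t : R) : R := reC H.[ec t].
(** Polynomials of the class of functions of Caratheodory: normalized at the origin, with positive real part. *)
Definition carath H := H`_0 = 1 /\ forall t, 0 < bdry H t.
(** It lies between [0] and [1] on the class [carath], which bounds the number of steps of a stage. *)
Definition potential H : R := RMean (fun t => expR (- bdry H t)).
(** A smooth substitute for [f] cut off where it is large, vanishing with [f], obtained by a polynomial expression in [f]. *)
Definition bump H n (t : R) : R := bdry H t * (1 - bdry H t / n%:R) ^+ n.

Lemma rcont_bdry H : rcont (bdry H).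
Proof. exact: cont_re (ccont_poly H). Qed.
Lemma rcont_exp u : rcont u -> rcont (fun t => expR (u t)).
Proof. exact: rcont_comp (@continuous_expR R). Qed.
Lemma rcont_efH H : rcont (fun t => expR (- bdry H t)).
Proof. exact: rcont_exp (rcontN (rcont_bdry H)). Qed.
Lemma rcont_bump H n : rcont (bump H n).
Proof.
apply: rcontM; first exact: rcont_bdry.
apply: rcontX; apply: rcontB; first exact: rcont_cst.
by apply: rcontM; [exact: rcont_bdry|exact: rcont_cst].
Qed.

Lemma RMean_bdry H : carath H -> RMean (bdry H) = 1.
Proof. by move=> [H0 _]; rewrite -(re_MeanE (fun t => H.[ec t])) Mean_poly0 H0 re1. Qed.

Lemma potential_le1 H : carath H -> potential H <= 1.
Proof.
move=> [_ Hp]; rewrite -[leRHS]RMean_cst; apply: le_RMean; first exact: rcont_efH.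
  exact: rcont_cst.
by move=> t; rewrite -[leRHS]expR0 ler_expR oppr_le0 ltW.
Qed.
Lemma potential_ge0 H : 0 <= potential H.
Proof.
rewrite -[leLHS]RMean_cst; apply: le_RMean; [exact: rcont_cst|exact: rcont_efH|].
by move=> t; exact: expR_ge0.
Qed.

(** The last bound comes from [(1 - x / n) ^ n <= exp (- x) <= 1 / x]. *)
Lemma bumpP H n t : carath H -> (0 < n)%N -> bdry H t <= n%:R ->
  [/\ 0 <= bump H n t, bump H n t <= bdry H t & bump H n t <= 1].
Proof.
move=> [_ /(_ t)]; rewrite /bump; move: (bdry H t) => x x0 n0 xn.
have n0' : 0 < n%:R :> R by rewrite ltr0n.
have y1 : x / n%:R <= 1 by rewrite ler_pdivrMr// mul1r.
have y0 : 0 <= x / n%:R by rewrite divr_ge0// ltW.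
have q0 : 0 <= (1 - x / n%:R) ^+ n by rewrite exprn_ge0// subr_ge0.
have q1 : (1 - x / n%:R) ^+ n <= 1 by rewrite exprn_ile1// ?subr_ge0// lerBlDr lerDl.
split; first by rewrite mulr_ge0// ltW.
  by rewrite ler_piMr// ltW.
have qe : (1 - x / n%:R) ^+ n <= expR (- x).
  have -> : - x = n%:R * - (x / n%:R) by field; rewrite lt0r_neq0.
  rewrite expRM_natl lerXn2r ?nnegrE ?subr_ge0 ?expR_ge0//.
  exact: expR_ge1Dx.
apply: (@le_trans _ _ (x * expR (- x))); first by rewrite ler_wpM2l// ltW.
rewrite expRN -[leRHS](divff (lt0r_neq0 (expR_gt0 x))) ler_pM2r ?invr_gt0 ?expR_gt0//.
by apply: le_trans (expR_ge1Dx x); rewrite lerDr.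
Qed.

Definition modif H B (d : R) K : {poly C} := H + (rC d)%:P * ('X^K * B).

Lemma modif_ec H B d K (z : C) : (modif H B d K).[z] = H.[z] + rC d * (z ^+ K * B.[z]).
Proof. by rewrite /modif hornerD hornerM hornerC hornerM hornerXn. Qed.

Lemma bdry_modif H B d K t : bdry (modif H B d K) t = bdry H t + d * reC (ec t ^+ K * B.[ec t]).
Proof. by rewrite /bdry modif_ec reD [reC (rC d * _)]reM reR imR mul0r subr0. Qed.

(** The square of [1 - y / 2 <= exp (- y / 2)]. *)
Lemma expR_quad (y : R) : y <= 2 -> 1 - y + y ^+ 2 / 4 <= expR (- y).
Proof.
move=> y2; rewrite [X in expR X](_ : - y = 2%:R * (- y / 2)); last by field.
rewrite expRM_natl.
have -> : 1 - y + y ^+ 2 / 4 = (1 - y / 2) ^+ 2 by field.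
rewrite lerXn2r ?nnegrE ?expR_ge0//; first by lra.
by have := expR_ge1Dx (- y / 2); lra.
Qed.

Lemma re_sq (w : C) : reC w ^+ 2 = (modulus w ^+ 2 + reC (w ^+ 2)) / 2.
Proof. by rewrite modulus_sq expr2 [reC (w ^+ 2)]reM; field. Qed.

(** Expand [exp (- f - d Re q)] by [expR_quad], with [q = z^K B]. The square of [Re q] is [|q|^2 / 2] plus an oscillating term;
the means of the oscillating terms are small by the lemma of Riemann and Lebesgue. *)
Lemma step_gain H (d : R) n : carath H -> 0 < d -> d < 1 -> (0 < n)%N -> (forall t, bdry H t <= n%:R) ->
  exists2 B, (forall t, modulus B.[ec t] = bump H n t) &
    forall eta : R, 0 < eta -> exists K0, forall K, (K0 <= K)%N ->
    potential H + d ^+ 2 / 8 * RMean (fun t => expR (- bdry H t) * bump H n t ^+ 2) - eta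
      <= potential (modif H B d K).
Proof.
move=> gH d0 d1 n0 fn; have [B [D HB]] := circ_bump H n0; exists B.
  move=> t; rewrite HB modulusM modulusX modulus_ec expr1n mul1r modulusR ger0_norm//.
  by have [] := bumpP gH n0 (fn t).
have mB t : modulus B.[ec t] = bump H n t.
  rewrite HB modulusM modulusX modulus_ec expr1n mul1r modulusR ger0_norm//.
  by have [] := bumpP gH n0 (fn t).
move=> eta eta0.
pose E t := expR (- bdry H t).
have cE : rcont E by exact: rcont_efH.
pose g1 t : C := rC (E t) * B.[ec t].
pose g2 t : C := rC (E t) * B.[ec t] ^+ 2.
have cB := ccont_poly B.
have cg1 : ccont g1 by apply: contC_M => //; exact: cont_rC.
have cg2 : ccont g2 by apply: contC_M; [exact: cont_rC|exact: contC_X].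
have E1 t : E t <= 1.
  by rewrite -[leRHS]expR0 ler_expR oppr_le0; case: gH => _ /(_ t) /ltW.
have E0 t : 0 <= E t by exact: expR_ge0.
have b1 t : bump H n t <= 1 by have [] := bumpP gH n0 (fn t).
have b0 t : 0 <= bump H n t by have [] := bumpP gH n0 (fn t).
have g1B t : modulus (g1 t) <= 1.
  by rewrite modulusM modulusR ger0_norm// mB -[leRHS]mul1r ler_pM.
have g2B t : modulus (g2 t) <= 1.
  rewrite modulusM modulusR ger0_norm// modulusX mB -[leRHS]mul1r ler_pM ?exprn_ge0//.
  by rewrite exprn_ile1.
have eta2 : 0 < eta / 2 by rewrite divr_gt0.
have [K1 H1] := riemann_lebesgue cg1 g1B eta2.
have [K2 H2] := riemann_lebesgue cg2 g2B eta2.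
exists (maxn K1 K2) => K; rewrite geq_max => /andP[/H1 h1 K2K].
have KK : (K2 <= 2 * K)%N by rewrite (leq_trans K2K)// leq_pmull.
have h2 := H2 _ KK.
have cw : ccont (fun t => ec t ^+ K * B.[ec t]) by apply: contC_M => //; exact: ccont_ecX.
have cr1 : rcont (fun t => reC (g1 t * ec t ^+ K)).
  by apply: cont_re; apply: contC_M => //; exact: ccont_ecX.
have cr2 : rcont (fun t => reC (g2 t * ec t ^+ (2 * K))).
  by apply: cont_re; apply: contC_M => //; exact: ccont_ecX.
have cEb : rcont (fun t => E t * bump H n t ^+ 2).
  by apply: rcontM => //; apply: rcontX; exact: rcont_bump.
have key : RMean (fun t => E t + (- d) * reC (g1 t * ec t ^+ K) + (d ^+ 2 / 8 * (E t * bump H n t ^+ 2) +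
    d ^+ 2 / 8 * reC (g2 t * ec t ^+ (2 * K)))) <= potential (modif H B d K).
  apply: le_RMean.
  - apply: rcontD; first by apply: rcontD => //; apply: rcontM => //; exact: rcont_cst.
    by apply: rcontD; apply: rcontM => //; exact: rcont_cst.
  - exact: rcont_efH.
  move=> t; rewrite bdry_modif opprD expRD.
  set w := ec t ^+ K * B.[ec t].
  have wb : modulus w = bump H n t by rewrite modulusM modulusX modulus_ec expr1n mul1r mB.
  have -> : g1 t * ec t ^+ K = rC (E t) * w by rewrite /g1 /w; ring.
  have -> : g2 t * ec t ^+ (2 * K) = rC (E t) * w ^+ 2.
    by rewrite /g2 /w exprMn -exprM mulnC; ring.
  clearbody w; have Er (x : R) (v : C) : reC (rC x * v) = x * reC v.
    by rewrite reM reR imR mul0r subr0.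
  rewrite !Er.
  have y2 : d * reC w <= 2.
    have := re_le w; rewrite wb => rw; have := b1 t => berr.
    have : d * reC w <= d * 1 by rewrite ler_wpM2l ?(ltW d0)// (le_trans rw).
    by lra.
  apply: le_trans (ler_wpM2l (E0 t) (expR_quad y2)).
  rewrite le_eqVlt; apply/orP; left; apply/eqP.
  by rewrite [(d * reC w) ^+ 2]exprMn [reC w ^+ 2]re_sq wb -/(E t); field.
have cst k : rcont (fun=> k : R) by exact: rcont_cst.
have c1 := rcontM (cst (- d)) cr1.
have c2 := rcontM (cst (d ^+ 2 / 8)) cEb.
have c3 := rcontM (cst (d ^+ 2 / 8)) cr2.
rewrite (RMeanD (rcontD cE c1) (rcontD c2 c3)) (RMeanD cE c1) (RMeanD c2 c3) in key.
rewrite (RMeanZ _ cr1) (RMeanZ _ cEb) (RMeanZ _ cr2) -!re_MeanE in key.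
have r1 : `|reC (Mean (fun t => g1 t * ec t ^+ K))| <= eta / 2 := le_trans (le_re _) h1.
have r2 : `|reC (Mean (fun t => g2 t * ec t ^+ (2 * K)))| <= eta / 2 := le_trans (le_re _) h2.
apply: le_trans key; rewrite -/(potential H).
move: r1 r2; rewrite !ler_norml; move: (reC _) (reC _) (RMean _) (potential H) => x y z p /andP[x1 x2] /andP[y1 y2].
have : - d * x >= - (eta / 2) by nra.
have d2 : 0 <= d ^+ 2 <= 1 by rewrite sqr_ge0 exprn_ile1// ltW.
have : d ^+ 2 / 8 * y >= - (eta / 2) by nra.
nra.
Qed.

Definition concentrated (e : R) H := (lebesgue_measure (`[0%R, (2 * pi)%R[ `&` [set t : R | (e <= bdry H t)%R])
  <= (e * (2 * pi))%:E)%E.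

Lemma levelset_le u (P : set R) : rcont u -> (forall t, 0 <= u t) -> measurable (`[0%R, (2 * pi)%R[ `&` P) ->
  (forall t, P t -> 1 <= u t) ->
  (lebesgue_measure (`[0%R, (2 * pi)%R[ `&` P) <= (Rint 0 (2 * pi) u)%:E)%E.
Proof.
move=> cu u0 mS Pu; set S := _ `&` _ in mS *.
have iu := cont_integrable 0 (2 * pi) cu.
have mu := measurable_int _ iu.
have Sab : S `<=` `[0%R, (2 * pi)%R] by move=> x [+ _]; rewrite /= !in_itv/= => /andP[-> /ltW].
rewrite /Rint /Rintegral fineK; last exact: integrable_fin_num.
apply: (@le_trans _ _ (\int[lebesgue_measure]_(x in S) (u x)%:E)%E).
  rewrite -[leLHS]mul1e -integral_cst//; apply: ge0_le_integral => //.
  - exact: (measurable_funS _ Sab mu).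
  - by move=> x [_ /Pu]; rewrite lee_fin.
apply: ge0_subset_integral => //.
by move=> x _; rewrite lee_fin.
Qed.

(** Where [f] lies between [e] and [2 / e], both [exp (- f)] and the bump are bounded below by constants that depend on
[e] alone; the set where [f] exceeds [2 / e] is small because [f] has mean [1]. So, if the mean of [exp (- f) b^2] is small,
the function [u] has mean at most [e], and it dominates the indicator of the set where [f >= e]. *)
Lemma concentrated_or_gain (e : R) : 0 < e -> exists2 w0 : R, 0 < w0 &
  forall H n, carath H -> (0 < n)%N -> (forall t, bdry H t <= n%:R) -> 4 / e <= n%:R ->
  concentrated e H \/ w0 <= RMean (fun t => expR (- bdry H t) * bump H n t ^+ 2).
Proof.
move=> e0; pose c : R := e * expR (- (4 / e)).
have c0 : 0 < c by rewrite mulr_gt0// expR_gt0.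
pose K : R := expR (2 / e) / c ^+ 2.
have K0 : 0 < K by rewrite divr_gt0 ?expR_gt0// exprn_gt0.
exists (e / (2 * K)); first by rewrite divr_gt0// mulr_gt0.
move=> H n gH n0 fn en; have f0 t : 0 < bdry H t by case: gH.
have n0' : 0 < n%:R :> R by rewrite ltr0n.
set W := RMean _.
have [|wW] := leP (e / (2 * K)) W; [by right|left].
(* u is at least 1 where f >= e: by its first term when f >= 2 / e, by the second one below *)
pose u t := e / 2 * bdry H t + K * (expR (- bdry H t) * bump H n t ^+ 2).
have cEb : rcont (fun t => expR (- bdry H t) * bump H n t ^+ 2).
  by apply: rcontM; [exact: rcont_efH|apply: rcontX; exact: rcont_bump].
have cf := rcont_bdry H.
have cst k : rcont (fun=> k : R) by exact: rcont_cst.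
have cu : rcont u by apply: rcontD; exact: rcontM.
have e2 : 0 <= e / 2 by lra.
have uf0 t : 0 <= e / 2 * bdry H t := mulr_ge0 e2 (ltW (f0 t)).
have uW0 t : 0 <= K * (expR (- bdry H t) * bump H n t ^+ 2) :=
  mulr_ge0 (ltW K0) (mulr_ge0 (expR_ge0 _) (sqr_ge0 _)).
have u0 t : 0 <= u t := addr_ge0 (uf0 t) (uW0 t).
have Pu t : e <= bdry H t -> 1 <= u t.
  move=> ef; have [fe|fe] := leP (2 / e) (bdry H t).
    apply: (@le_trans _ _ (e / 2 * bdry H t)).
      move: fe; rewrite ler_pdivrMr//; lra.
    by rewrite lerDl uW0.
  apply: (@le_trans _ _ (K * (expR (- bdry H t) * bump H n t ^+ 2))); last first.
    by rewrite lerDr uf0.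
  have cb : c <= bump H n t.
    rewrite /c /bump; apply: ler_pM; [exact: ltW|exact: expR_ge0|exact: ef|].
    set x := bdry H t in ef fe *.
    pose y := x / n%:R.
    have x0 : 0 < x by exact: f0.
    have y0 : 0 <= y by rewrite divr_ge0// ltW.
    have y2 : y <= 1 / 2.
      rewrite ler_pdivrMr//; apply: (@le_trans _ _ (2 / e)); first exact: ltW.
      have : 4 / e = 2 * (2 / e) by ring.
      lra.
    have -> : - (4 / e) = n%:R * (- (4 / e) / n%:R) by field; rewrite !lt0r_neq0.
    rewrite expRM_natl lerXn2r ?nnegrE ?expR_ge0//; first by rewrite -/y; lra.
    apply: (@le_trans _ _ (expR (- (2 * y)))).
      rewrite ler_expR mulNr lerN2 /y mulrA ler_pM2r ?invr_gt0//.
      have -> : 4 / e = 2 * (2 / e) by ring.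
      by rewrite ler_pM2l// ltW.
    rewrite -/y expRN -[leLHS]div1r ler_pdivrMr ?expR_gt0//.
    have := expR_ge1Dx (2 * y) => ey.
    apply: (@le_trans _ _ ((1 - y) * (1 + 2 * y))); first by nra.
    by rewrite ler_wpM2l//; lra.
  have c2 : c ^+ 2 <= bump H n t ^+ 2 by rewrite lerXn2r ?nnegrE ?(le_trans _ cb) ?(ltW c0).
  have ee : expR (- (2 / e)) <= expR (- bdry H t) by rewrite ler_expR lerN2 ltW.
  have -> : 1 = K * (expR (- (2 / e)) * c ^+ 2).
    by rewrite /K expRN mulrACA divff ?mulVf ?mulr1 ?expf_neq0 ?lt0r_neq0 ?expR_gt0.
  by rewrite ler_wpM2l ?(ltW K0)// ler_pM ?expR_ge0 ?sqr_ge0.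
have mS : measurable (`[0%R, (2 * pi)%R[ `&` [set t : R | e <= bdry H t]).
  apply: measurableI => //.
  have := measurable_realfun.continuous_measurable_fun (rcontE cf) measurableT (measurable_itv `[e, +oo[).
  rewrite setTI; congr measurable; apply/seteqP; split => t /=; rewrite in_itv/= andbT//.
apply: (le_trans (levelset_le cu u0 mS Pu)); rewrite lee_fin.
have : RMean u <= e.
  rewrite RMeanD; [|exact: rcontM|exact: rcontM].
  rewrite !RMeanZ// RMean_bdry// -/W mulr1.
  move: wW; rewrite ltr_pdivlMr; last exact: mulr_gt0.
  by move=> wW; lra.
by rewrite /RMean ler_pdivrMl ?tau_gt0// [_ * e]mulrC.
Qed.

End Step.

(** * The sequence of polynomials *)

Section Stage.
Context {R : realType}.
Local Notation C := (Cplx R).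
Implicit Types (H B G A : {poly C}) (f g : C -> C).

Lemma tcoefD f g n : holo f -> holo g -> tcoef (fun z => f z + g z) n = tcoef f n + tcoef g n.
Proof. by move=> hf hg; rewrite (tcoefE (has_coefsD (taylor hf) (taylor hg))). Qed.

(** The maximum principle for [exp (- H)]. *)
Lemma carath_exp_le1 H (z : C) : carath H -> modulus z < 1 -> modulus (expC (- H.[z])) <= 1.
Proof.
move=> [_ Hp] z1.
have eN : entire (fun w => - H.[w]) by move=> w; apply: derivableN; exact: entire_poly.
apply: (@max_principle R (fun w => expC (- H.[w])) 1 (entire_exp eN)) => // t.
by rewrite modulus_expC reN -[leRHS]expR0 ler_expR oppr_le0 ltW// Hp.
Qed.

Definition expd A H (z : C) : C := expC (A.[z] - H.[z]).

Lemma expdE A H z : expd A H z = expC A.[z] * expC (- H.[z]).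
Proof. by rewrite /expd expCD. Qed.

Lemma entire_expd A H : entire (expd A H).
Proof.
have e1 : entire (fun z => A.[z] - H.[z]).
  by move=> z; apply: derivableB; exact: entire_poly.
exact: (entire_exp e1).
Qed.

Lemma expd_bound A H (c : R) (z : C) : carath H -> (forall z : C, modulus z < 1 -> modulus (expC A.[z]) <= c) ->
  modulus z < 1 -> modulus (expd A H z) <= c.
Proof.
move=> gH Ac z1; rewrite expdE modulusM -[leRHS]mulr1.
apply: ler_pM; [exact: modulus_ge0|exact: modulus_ge0|exact: (Ac z z1)|exact: carath_exp_le1].
Qed.

Lemma exp_poly_bound A : exists2 c : R, 1 <= c & forall z : C, modulus z < 1 -> modulus (expC A.[z]) <= c.
Proof.
have [c c0 Hc] := entire_bound (entire_exp (@entire_poly R A)).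
exists (1 + c); first by rewrite lerDl.
by move=> z /Hc h; rewrite (le_trans h)// lerDr.
Qed.

(** Coefficients of a bounded function tend to zero. *)
Lemma expd_tail A H (e : R) : carath H -> 0 < e ->
  exists N0, forall n, (N0 <= n)%N -> modulus (tcoef (expd A H) n) <= e.
Proof.
move=> gH e0; have [c _ Hc] := exp_poly_bound A.
exact: (tcoef_tends0 (entire_holo (@entire_expd A H)) (fun z => expd_bound gH Hc (z := z)) e0).
Qed.

Lemma eventually_all (T : eqType) (l : seq T) (P : T -> nat -> Prop) :
  (forall x, x \in l -> exists N0, forall n, (N0 <= n)%N -> P x n) ->
  exists N0, forall n, (N0 <= n)%N -> forall x, x \in l -> P x n.
Proof.
elim: l => [|a l ih] h; first by exists 0%N.
have [N1 H1] := h a (mem_head _ _).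
have [|N2 H2] := ih; first by move=> x xl; apply: h; rewrite inE xl orbT.
exists (maxn N1 N2) => n; rewrite geq_max => /andP[/H1 h1 /H2 h2] x.
by rewrite inE => /predU1P[->|/h2].
Qed.

(** Finitely many smallness conditions can be met at once; used for the list of anchors. *)
Lemma small_all (T : eqType) (l : seq T) (P : T -> R -> Prop) :
  (forall x, x \in l -> exists2 d0 : R, 0 < d0 & forall d, 0 < d -> d <= d0 -> P x d) ->
  exists2 d : R, 0 < d & d < 1 /\ forall x, x \in l -> P x d.
Proof.
move=> h; suff [d0 d00 Hd] : exists2 d0 : R, 0 < d0 & forall d, 0 < d -> d <= d0 -> forall x, x \in l -> P x d.
  exists (Num.min d0 (1 / 2)); first by rewrite lt_min d00 divr_gt0.
  split; first by rewrite gt_min orbC ltr_pdivrMr// mul1r ltr1n.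
  by apply: Hd; [rewrite lt_min d00 divr_gt0|rewrite ge_min lexx].
elim: l h => [|a l ih] h; first by exists 1.
have [d1 d10 H1] := h a (mem_head _ _).
have [|d2 d20 H2] := ih; first by move=> x xl; apply: h; rewrite inE xl orbT.
exists (Num.min d1 d2); first by rewrite lt_min d10.
move=> d dp; rewrite le_min => /andP[/(H1 d dp) h1 /(H2 d dp) h2] x.
by rewrite inE => /predU1P[->|/h2].
Qed.

Lemma Cint_sum (a b : R) (I : Type) (s : seq I) (F : I -> R -> C) : a <= b ->
  (forall i, ccont (F i)) -> Cint a b (fun t => \sum_(i <- s) F i t) = \sum_(i <- s) Cint a b (F i).
Proof.
move=> ab cF; elim: s => [|i s ih].
  rewrite big_nil (eq_Cint (h := fun=> 0)); first by rewrite Cint_cst// mul0r.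
  by move=> t _; rewrite big_nil.
rewrite big_cons -ih -CintD; [|exact: cF|exact: contC_sum].
by apply: eq_Cint => t _; rewrite big_cons.
Qed.

(** Primitives of [exp (i n s)] are of size [1 / n]. *)
Lemma high_freq_primitive B K (t : R) : 0 <= t ->
  modulus (Cint 0 t (fun s => ec s ^+ K.+1 * B.[ec s])) <= 2 * pnorm B / K.+1%:R.
Proof.
move=> t0.
have cX i : ccont (fun s : R => ec s ^+ i) by exact: ccont_ecX.
rewrite (eq_Cint (h := fun s => \sum_(i < size B) B`_i * ec s ^+ (K + i).+1)); last first.
  move=> s _; rewrite horner_coef mulr_sumr; apply: eq_bigr => i _.
  by rewrite mulrCA -exprD addSn.
rewrite Cint_sum//; last by move=> i; apply: contC_M; [exact: contC_cst|exact: cX].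
apply: (le_trans (modulus_sum _ _ _)).
rewrite /pnorm mulr_sumr mulr_suml; apply: ler_sum => i _.
rewrite CintZ; last exact: cX.
rewrite modulusM mulrAC [2 / _ * _]mulrC; apply: ler_wpM2l; first exact: modulus_ge0.
rewrite Cint_ecX// modulusM modulusV modulusM modulus_i mul1r modulus_nat.
have h2 : modulus (ec t ^+ (K + i).+1 - ec 0 ^+ (K + i).+1) <= 2.
  by rewrite (le_trans (modulusB _ _))// !modulusX !modulus_ec !expr1n.
apply: ler_pM; rewrite ?modulus_ge0 ?invr_ge0//.
by rewrite lef_pV2 ?posrE// ler_nat ltnS leq_addr.
Qed.

(** What the steps of a stage preserve, starting from [H]: the anchors, listed in [l] with their tolerances, keep
their coefficients of order at least [K0] small, and primitives move by strictly less than [e], which leaves room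
for a further step. *)
Definition reach K0 (l : seq ({poly C} * R)) (e : R) H H' :=
  [/\ carath H', exists G, H' = H + 'X^K0 * G,
    exists2 e' : R, e' < e & forall t, 0 <= t <= 2 * pi -> `|Rint 0 t (fun s => bdry H' s - bdry H s)| <= e' &
    forall x, x \in l -> forall n, (K0 <= n)%N -> modulus (tcoef (expd x.1 H') n) <= x.2].

(** Each step gains [kap] for the potential unless concentration is reached, and the potential is at most [1]. For a
step of order [M], the coefficients of order less than [M] of an anchored exponential do not move; at order at least
[M] those of the old exponential are already at most half the tolerance, and the change is at most the other half because
the step size [d] is small. *)
Lemma stage H (l : seq ({poly C} * R)) (e eps : R) K1 : carath H ->
  (forall x, x \in l -> 0 < x.2) -> 0 < e -> 0 < eps ->
  exists K0 H', [/\ (K1 <= K0)%N, reach K0 l e H H' & concentrated eps H'].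
Proof.
move=> gH l0 e0 eps0.
have [w0 w00 Hw] := concentrated_or_gain eps0.
have [lip lip0 Hlip] := @expC_lip0 R.
(* [d] is so small that a step changes every anchored exponential by at most half its tolerance *)
have [d d0 [d1 Hd]] : exists2 d : R, 0 < d & d < 1 /\ forall x, x \in l ->
    exists2 c : R, (forall z : C, modulus z < 1 -> modulus (expC x.1.[z]) <= c) &
      1 <= c /\ forall w : C, modulus w <= d -> c * modulus (expC w - 1) <= x.2 / 2.
  apply: small_all => x /l0 x0; have [c c1 Hc] := exp_poly_bound x.1.
  have c0 : 0 < c by lra.
  have [d0 d00 H0] := @expC_near0 R (x.2 / 2 / c) ltac:(by rewrite !divr_gt0).
  exists d0 => // d dp dd; exists c => //; split => // w wd.
  by rewrite mulrC -ler_pdivlMr// H0// (le_trans wd).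
have [K0 HK0] : exists K0, forall n, (K0 <= n)%N -> forall x, x \in l -> modulus (tcoef (expd x.1 H) n) <= x.2.
  by apply: eventually_all => x xl; apply: expd_tail => //; exact: l0.
pose K := maxn K0 K1.
have r0 : reach K l e H H.
  split => //; first by exists 0; rewrite mulr0 addr0.
    exists 0 => // t /andP[t0 _]; rewrite (eq_Rint (g := fun=> 0)); first by rewrite Rint_cst// mul0r normr0.
    by move=> s _; rewrite subrr.
  by move=> x xl n Kn; apply: HK0 => //; rewrite (leq_trans _ Kn)// leq_maxl.
pose kap := d ^+ 2 / 16 * w0.
have kap0 : 0 < kap by rewrite mulr_gt0// divr_gt0// exprn_gt0.
have gain H' : reach K l e H H' -> concentrated eps H' \/ exists2 H'', reach K l e H H'' & potential H' + kap <= potential H''.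
  move=> [gH' [G HG] [e' e'e He'] Hc'].
  have [n n0 [fn en]] : exists2 n, (0 < n)%N & (forall t, bdry H' t <= n%:R) /\ 4 / eps <= n%:R.
    exists (Num.bound (pnorm H' + 4 / eps)).+1 => //.
    have p0 := pnorm_ge0 H'. have ep0 : 0 <= 4 / eps by rewrite divr_ge0// ltW.
    have := archi_boundP (addr_ge0 p0 ep0); rewrite -natr1 => h.
    split=> [t|]; last by lra.
    apply: (@le_trans _ _ (pnorm H')); last by lra.
    by rewrite (le_trans (re_le _))// poly_le_pnorm// modulus_ec.
  have [cc|W] := Hw H' n gH' n0 fn en; [by left|right].
  have [B mB HB] := step_gain gH' d0 d1 n0 fn.
  have [N1 HN1] := HB kap kap0.
  have [N2 HN2] : exists N2, forall m, (N2 <= m)%N -> forall x, x \in l -> modulus (tcoef (expd x.1 H') m) <= x.2 / 2.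
    by apply: eventually_all => x xl; apply: expd_tail => //; rewrite divr_gt0// l0.
  (* the slack left for primitives; half of it is spent on this step *)
  pose sl := e - e'.
  have sl0 : 0 < sl by rewrite subr_gt0.
  pose N3 := Num.bound (2 * pnorm B / (sl / 2)).
  pose M := (maxn K (maxn N1 (maxn N2 N3))).+1.
  have KM : (K <= M)%N by rewrite leqW// leq_maxl.
  have N1M : (N1 <= M)%N by rewrite leqW// (leq_trans _ (leq_maxr _ _))// leq_maxl.
  have N2M : (N2 <= M)%N by rewrite leqW// (leq_trans _ (leq_maxr _ _))// (leq_trans _ (leq_maxr _ _))// leq_maxl.
  have N3M : (N3 <= M)%N by rewrite leqW// (leq_trans _ (leq_maxr _ _))// (leq_trans _ (leq_maxr _ _))// leq_maxr.
  have B1 t : modulus B.[ec t] <= 1 by rewrite mB; have [] := bumpP gH' n0 (fn t).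
  have Bf t : modulus B.[ec t] <= bdry H' t by rewrite mB; have [] := bumpP gH' n0 (fn t).
  have Bd (z : C) : modulus z < 1 -> modulus B.[z] <= 1.
    exact: (@max_principle R (fun z => B.[z]) 1 (@entire_poly R B) B1).
  pose q (z : C) : C := rC d * (z ^+ M * B.[z]).
  have qz (z : C) : modulus z < 1 -> modulus (q z) <= d * modulus z ^+ M.
    move=> z1; rewrite /q !modulusM modulusR ger0_norm ?(ltW d0)// ler_wpM2l ?(ltW d0)//.
    by rewrite modulusX ler_piMr ?exprn_ge0 ?modulus_ge0// Bd.
  have qd (z : C) : modulus z < 1 -> modulus (q z) <= d.
    move=> z1; apply: (le_trans (qz z z1)); rewrite ler_piMr ?(ltW d0)//.
    by rewrite exprn_ile1 ?modulus_ge0// ltW.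
  pose H'' := modif H' B d M.
  have gH'' : carath H''.
    split.
      rewrite /H'' /modif coefD coefCM coefXnM /= mulr0 addr0.
      by case: gH'.
    move=> t; rewrite bdry_modif.
    have : `|reC (ec t ^+ M * B.[ec t])| <= bdry H' t.
      by rewrite (le_trans (le_re _))// modulusM modulusX modulus_ec expr1n mul1r.
    have := proj2 gH' t; rewrite ler_norml; move: (bdry H' t) (reC _) => x y x0 /andP[h _].
    nra.
  exists H''; last first.
    have := HN1 M N1M; rewrite -/H''.
    have : d ^+ 2 / 8 * w0 <= d ^+ 2 / 8 * RMean (fun t => expR (- bdry H' t) * bump H' n t ^+ 2).
      by rewrite ler_wpM2l// divr_ge0// exprn_ge0// ltW.
    have -> : d ^+ 2 / 8 * w0 = kap + kap by rewrite /kap; field.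
    lra.
  split=> //.
  - exists (G + (rC d)%:P * ('X^(M - K) * B)).
    rewrite /H'' /modif HG -addrA mulrDr; congr (_ + (_ + _)).
    by rewrite -[M in LHS](subnKC KM) exprD; ring.
  - exists (e' + sl / 2); first by rewrite /sl; lra.
    move=> t tI; have t0 : 0 <= t by case/andP: tI.
    have cB : ccont (fun s => ec s ^+ M * B.[ec s]) by apply: contC_M; [exact: ccont_ecX|exact: ccont_poly].
    have cr := cont_re cB.
    have cd : rcont (fun s => bdry H' s - bdry H s) by apply: rcontB; exact: rcont_bdry.
    have cr' : rcont (fun s => d * reC (ec s ^+ M * B.[ec s])) by apply: rcontM => //; exact: rcont_cst.
    rewrite (eq_Rint (g := fun s => (bdry H' s - bdry H s) + d * reC (ec s ^+ M * B.[ec s]))); last first.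
      by move=> s _; rewrite bdry_modif addrAC.
    rewrite (RintD _ _ cd cr') (RintZ _ _ _ cr).
    apply: (le_trans (ler_normD _ _)); apply: lerD; first exact: He'.
    rewrite normrM gtr0_norm//.
    have hf : `|Rint 0 t (fun s => reC (ec s ^+ M * B.[ec s]))| <= sl / 2.
      have -> : Rint 0 t (fun s => reC (ec s ^+ M * B.[ec s])) = reC (Cint 0 t (fun s => ec s ^+ M * B.[ec s])).
        by rewrite re_mk.
      apply: (le_trans (le_re _)); apply: (le_trans (high_freq_primitive _ _ t0)).
      rewrite ler_pdivrMr// [leRHS]mulrC -ler_pdivrMr ?divr_gt0//.
      have p0 : 0 <= 2 * pnorm B / (sl / 2) by rewrite divr_ge0 ?mulr_ge0 ?pnorm_ge0// ltW// divr_gt0.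
      apply: (le_trans (ltW (archi_boundP p0))).
      by rewrite ler_nat -/N3 -[_.+1]/M.
    rewrite -[leRHS]mul1r; apply: ler_pM => //; exact: ltW.
  - move=> x xl m Km; have [c Hc [c1 Hcd]] := Hd x xl.
    pose P := expd x.1 H'.
    pose E z := P z * (expC (- q z) - 1).
    have hP : holo P := entire_holo (@entire_expd x.1 H').
    have hq : holo q.
      apply: holoM; first exact: holo_cst.
      by apply: holoM; [apply: holoX; exact: (entire_holo (@entire_id R))|exact: holo_poly].
    have h1 : holo (fun z => - q z) := @holoN R q hq.
    have h2 : holo (fun z => expC (- q z)) := @holo_exp R (fun z => - q z) h1.
    have h3 : holo (fun z => expC (- q z) - 1) := @holoB R (fun z => expC (- q z)) (fun=> 1) h2 (@holo_cst R 1).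
    have hE : holo E := @holoM R P (fun z => expC (- q z) - 1) hP h3.
    have PE : expd x.1 H'' = fun z => P z + E z.
      apply/funext => z; rewrite /E /P /expd /H'' modif_ec -/(q z).
      by rewrite opprD addrA expCD; ring.
    rewrite PE tcoefD//.
    have Pc (z : C) : modulus z < 1 -> modulus (P z) <= c by move=> z1; exact: (expd_bound gH' Hc z1).
    have c0 : 0 < c by lra.
    (* the change E vanishes to order M at the origin, so lower coefficients do not move *)
    have [mM|Mm] := ltnP m M.
      have -> : tcoef E m = 0.
        apply: (@tcoef_vanish R E M (2 * c) (Num.min lip (1 / 2))) => //; first by rewrite lt_min lip0 divr_gt0.
        move=> z; rewrite le_min => /andP[zl z2].
        have z1 : modulus z < 1 by lra.
        have qM : modulus (q z) <= modulus z ^+ M.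
          by rewrite (le_trans (qz z z1))// ler_piMl ?exprn_ge0 ?modulus_ge0// ltW.
        have ql : modulus (- q z) <= lip.
          rewrite modulusN (le_trans qM)// (le_trans _ zl)// /M exprS ler_piMr ?modulus_ge0//.
          by rewrite exprn_ile1 ?modulus_ge0// ltW.
        have -> : 2 * c * modulus z ^+ M = c * (2 * modulus z ^+ M) by ring.
        rewrite /E modulusM; apply: ler_pM; [exact: modulus_ge0|exact: modulus_ge0|exact: (Pc z z1)|].
        by apply: (le_trans (Hlip _ ql)); rewrite modulusN; exact: ler_wpM2l.
      by rewrite addr0; exact: Hc'.
    rewrite (le_trans (modulusD _ _))// (splitr x.2); apply: lerD.
      by apply: HN2 => //; exact: leq_trans Mm.
    apply: tcoef_le => //; first by rewrite divr_ge0// ltW// l0.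
    move=> z z1; rewrite /E modulusM.
    apply: le_trans (Hcd (- q z) _); last by rewrite modulusN qd.
    by apply: ler_wpM2r; [exact: modulus_ge0|exact: (Pc z z1)].
(* m steps without concentration would raise the potential above 1 *)
suff [m [H' rH' [cc|big]]] : exists m, exists2 H', reach K l e H H' & concentrated eps H' \/ (2 <= m%:R * kap) && (m%:R * kap <= potential H').
- by exists K, H'; split=> //; rewrite leq_maxr.
- exfalso; move: big => /andP[b1 b2]; have [gH' _ _ _] := rH'.
  by have := potential_le1 gH'; lra.
have iter m : exists2 H', reach K l e H H' & concentrated eps H' \/ m%:R * kap <= potential H'.
  elim: m => [|m [H' rH' [cc|ih]]].
  - by exists H => //; right; rewrite mul0r; exact: potential_ge0.
  - by exists H' => //; left.
  - have [cc|[H'' rH'' hp]] := gain H' rH'; first by exists H' => //; left.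
    by exists H'' => //; right; rewrite -natr1 mulrDl mul1r; lra.
have k20 : 0 <= 2 / kap by rewrite divr_ge0// ltW.
pose m := Num.bound (2 / kap).
have mk : 2 <= m%:R * kap by rewrite -ler_pdivrMr// ltW// archi_boundP.
have [H' rH' [cc|ih]] := iter m; exists m; exists H' => //; [by left|right].
by rewrite mk ih.
Qed.

(** Equidistributed points that resolve the oscillation of [f], with room for an error [tau] at each of them. *)
Definition resolved H (eps tau : R) := exists n : nat, [/\ (0 < n)%N,
  forall s t, 0 <= s <= 2 * pi -> `|t - s| <= 2 * pi / n%:R -> `|bdry H t - bdry H s| <= eps &
  n%:R * tau <= eps].

Lemma resolved_ex H (eps tau0 : R) : 0 < eps -> 0 < tau0 ->
  exists2 tau : R, 0 < tau & tau <= tau0 /\ resolved H eps tau.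
Proof.
move=> e0 t0; have [d d0 Hd] := unif_cont 0 (2 * pi) (rcont_bdry H) e0.
pose n := (Num.bound (2 * pi / d)).+1.
have n0 : 0 < n%:R :> R by rewrite ltr0n.
exists (Num.min tau0 (eps / n%:R)); first by rewrite lt_min t0 (divr_gt0 e0 n0).
split; first by rewrite ge_min lexx.
exists n; split => // [s t sI ts|].
  apply/ltW/Hd => //; apply: (le_lt_trans ts); rewrite ltr_pdivrMr// [ltRHS]mulrC -ltr_pdivrMr//.
  apply: (lt_le_trans (archi_boundP (divr_ge0 (@tau_ge0 R) (ltW d0)))).
  by rewrite ler_nat leqnSn.
rewrite mulrC -ler_pdivlMr//; rewrite ge_min lexx orbT//.
Qed.

Definition eps_ k : R := (1 / 2) ^+ k.+1.
Lemma eps_gt0 k : 0 < eps_ k. Proof. by rewrite exprn_gt0// divr_gt0. Qed.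

(** The outcome of the construction: polynomials [bpoly k] with tolerances [btol k] that are tied to them by [Q], errors [berr k] of
primitives, and the orders [bord k] from which on the step from [k] to [k + 1] acts. *)
Record blueprint (Q : nat -> {poly C} -> R -> Prop) := Blueprint {
  bpoly : nat -> {poly C};
  btol : nat -> R;
  berr : nat -> R;
  bord : nat -> nat;
  b_carath : forall k, carath (bpoly k);
  b_Q : forall k, 0 < btol k /\ Q k (bpoly k) (btol k);
  b_K : forall k, (k < bord k)%N;
  b_div : forall k, exists G, bpoly k.+1 = bpoly k + 'X^(bord k) * G;
  b_t : forall k, 0 < berr k /\ berr k.+1 <= berr k / 2;
  b_int : forall k t, 0 <= t <= 2 * pi -> `|Rint 0 t (fun s => bdry (bpoly k.+1) s - bdry (bpoly k) s)| <= berr k;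
  b_coef : forall i k n, (i <= k)%N -> (bord k <= n)%N -> modulus (tcoef (expd (bpoly i) (bpoly k.+1)) n) <= btol i;
  b_concentrated : forall k, concentrated (eps_ k) (bpoly k.+1);
  b_res : forall k, resolved (bpoly k.+1) (eps_ k) (berr k.+1) }.

Definition state : Type := {poly C} * seq ({poly C} * R) * R * nat.

(** Iterates [stage]; the list of anchors collects all the polynomials met so far, and the error is halved and adapted
to the current polynomial each time. *)
Theorem blueprint_ex (Q : nat -> {poly C} -> R -> Prop) :
  (forall k H, carath H -> exists2 D, 0 < D & Q k H D) -> inhabited (blueprint Q).
Proof.
move=> hQ.
(* a state consists of the current polynomial, the anchors (most recent first), the error and the order of the last step *)
pose sH (s : state) := s.1.1.1. pose sl (s : state) := s.1.1.2.
pose st (s : state) := s.1.2. pose sK (s : state) := s.2.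
pose ok (k : nat) (s : state) := [/\ carath (sH s), (forall x, x \in sl s -> 0 < x.2) & 0 < st s].
have step (ks : nat * state) : exists s' : state, ok ks.1 ks.2 ->
   [/\ ok ks.1.+1 s', (ks.1 < sK s')%N, reach (sK s') (sl ks.2) (st ks.2) (sH ks.2) (sH s'),
      concentrated (eps_ ks.1) (sH s') &
    [/\ exists D, [/\ sl s' = (sH s', D) :: sl ks.2, 0 < D & Q ks.1.+1 (sH s') D],
     st s' <= st ks.2 / 2 & resolved (sH s') (eps_ ks.1) (st s')]].
  case: ks => k s /=.
  have [[gs ls ts]|nok] := pselect (ok k s); last by exists s.
  have [K0 [H' [kK rH' cH']]] := stage k.+1 gs ls ts (eps_gt0 k).
  have gH' : carath H' by case: rH'.
  have [D D0 QD] := hQ k.+1 H' gH'.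
  have [tau tau0 [tt rt]] := resolved_ex H' (eps_gt0 k) (divr_gt0 ts (ltr0Sn R 1)).
  exists (H', (H', D) :: sl s, tau, K0) => _; split => //.
    split=> // x; rewrite inE => /predU1P[->//|]; exact: ls.
  by split=> //; exists D.
have [F HF] := boolp.choice step.
have g1 : carath (1 : {poly C}).
  by split=> [|t]; rewrite ?coef1//= /bdry hornerC re1.
have [D0 D00 QD0] := hQ 0%N 1 g1.
pose s := fix s k : state := if k is k'.+1 then F (k', s k') else (1, [:: (1, D0)], 1, 0%N).
have oks k : ok k (s k).
  elim: k => [|k ih]; last by have [] := HF (k, s k) ih.
  by split => //= x; rewrite inE => /eqP ->.
have Hs k := HF (k, s k) (oks k).
have anchors k : exists D, (0 < D /\ Q k (sH (s k)) D) /\ forall j, (k <= j)%N -> (sH (s k), D) \in sl (s j).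
  have [D [hD Dk]] : exists D, (0 < D /\ Q k (sH (s k)) D) /\ (sH (s k), D) \in sl (s k).
    case: k => [|k]; first by exists D0; split => //=; rewrite inE.
    have [_ _ _ _ [[D [e Dp QD]] _ _]] := Hs k; exists D; split => //.
    by rewrite -[s k.+1]/(F (k, s k)) e inE eqxx.
  exists D; split => // j; elim: j => [|j ih]; first by rewrite leqn0 => /eqP k0; rewrite -k0.
  rewrite leq_eqVlt => /predU1P[<-//|/ih hj].
  have [_ _ _ _ [[D' [e _ _]] _ _]] := Hs j.
  by rewrite -[s j.+1]/(F (j, s j)) e inE hj orbT.
have [D HD] := boolp.choice anchors.
split; apply: (@Blueprint Q (fun k => sH (s k)) D (fun k => st (s k)) (fun k => sK (s k.+1))).
- by move=> k; have [] := oks k.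
- by move=> k; have [] := HD k.
- by move=> k; have [] := Hs k.
- by move=> k; have [_ _ [_ ? _ _] _ _] := Hs k.
- by move=> k; split; [have [] := oks k|have [_ _ _ _ []] := Hs k].
- move=> k t tI; have [_ _ [_ _ [e' ee he] _] _ _] := Hs k.
  by apply: (le_trans (he t tI)); exact: ltW.
- move=> i k n ik Kn; have [_ _ [_ _ _ hc] _ _] := Hs k.
  by have [_ /(_ k ik) m] := HD i; exact: (hc _ m n Kn).
- by move=> k; have [] := Hs k.
- by move=> k; have [_ _ _ _ []] := Hs k.
Qed.

End Stage.

(** * The limit measure on an interval *)

Section Stieltjes.
Context {R : realType}.

Lemma stieltjes (G : R -> R) : {homo G : x y / x <= y} -> continuous G ->
  (forall t, t <= 0 -> G t = 0) -> (forall t, 2 * pi <= t -> G t = 1) ->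
  exists P : probability (measurableTypeR R) R,
    forall a b : R, a <= b -> P `]a, b]%classic = (G b - G a)%:E.
Proof.
move=> nd cG G0 G1.
have rc : (forall x, G @ at_right x --> G x) by exact: right_continuousW.
have Gy : G @ +oo --> (1 : R).
  apply/cvgrPdist_lt => e e0; exists (2 * pi); split; first exact: num_real.
  by move=> t /ltW /G1 ->; rewrite subrr normr0.
have GNy : G @ -oo --> (0 : R).
  apply/cvgrPdist_lt => e e0; exists 0; split; first exact: num_real.
  by move=> t /ltW /G0 ->; rewrite subrr normr0.
pose GC : cumulativeBounded (0 : R) (1 : R) :=
  HB.pack G (isCumulative.Build R _ R G nd rc) (isCumulativeBounded.Build R 0 1 G GNy Gy).
exists (lebesgue_stieltjes_measure GC) => a b ab.
rewrite /lebesgue_stieltjes_measure/= /lebesgue_stieltjes_measure /measure_extension measurable_mu_extE/=; last exact: is_ocitv.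
by rewrite wlength_itv_bnd.
Qed.

End Stieltjes.

Section Limit.
Context {R : realType}.
Local Notation C := (Cplx R).
Variables (Q : nat -> {poly C} -> R -> Prop) (b : blueprint Q).

Definition dens k : R -> R := bdry (bpoly b k).
(** The distribution function of the density [dens k] on [[0, 2 pi]], for the normalized Lebesgue measure. *)
Definition dens_cdf k (t : R) : R := (2 * pi)^-1 * Rint 0 t (dens k).

Lemma dens_gt0 k t : 0 < dens k t. Proof. by have [_] := b_carath b k; apply. Qed.
Lemma rcont_dens k : rcont (dens k). Proof. exact: rcont_bdry. Qed.

Lemma tau_inv_le1 : (2 * pi)^-1 <= 1 :> R.
Proof. rewrite invf_le1 ?tau_gt0//; have := @pi_ge2 R; lra. Qed.
Lemma tau_inv_ge0 : 0 <= (2 * pi)^-1 :> R.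
Proof. by rewrite invr_ge0 tau_ge0. Qed.

Lemma dens_cdf_step k t : 0 <= t <= 2 * pi -> `|dens_cdf k.+1 t - dens_cdf k t| <= berr b k.
Proof.
move=> tI; rewrite /dens_cdf -mulrBr -RintB; [|exact: rcont_dens|exact: rcont_dens].
rewrite normrM ger0_norm ?tau_inv_ge0// -[leRHS]mul1r.
apply: ler_pM; rewrite ?tau_inv_ge0 ?tau_inv_le1//.
exact: (b_int b).
Qed.

Lemma dens_cdf_dist k j t : 0 <= t <= 2 * pi -> (k <= j)%N -> `|dens_cdf j t - dens_cdf k t| <= 2 * berr b k.
Proof.
move=> tI /subnK <-; rewrite addnC.
suff H m : `|dens_cdf (k + m) t - dens_cdf k t| <= 2 * berr b k - 2 * berr b (k + m).
  by rewrite (le_trans (H _))// lerBlDr lerDl; have [] := b_t b (k + (j - k)); lra.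
elim: m => [|m ih]; first by rewrite addn0 !subrr normr0.
rewrite addnS; have := dens_cdf_step (k + m) tI; have [_] := b_t b (k + m).
by have := ler_distD (dens_cdf (k + m) t) (dens_cdf (k + m).+1 t) (dens_cdf k t); lra.
Qed.

Lemma berr_geo k : berr b k <= berr b 0 * (1 / 2) ^+ k.
Proof.
elim: k => [|k ih]; first by rewrite expr0 mulr1.
have [_ h] := b_t b k; rewrite (le_trans h)// exprS; lra.
Qed.

Lemma berr_small (e : R) : 0 < e -> exists k0, forall k, (k0 <= k)%N -> berr b k <= e.
Proof.
move=> e0; have [t0 _] := b_t b 0.
have [N H] := @expr_small R (1 / 2) (e / berr b 0) ltac:(lra) ltac:(lra) (divr_gt0 e0 t0).
exists N => k /H; rewrite ltr_pdivlMr// => h; apply: (le_trans (berr_geo k)).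
by rewrite mulrC ltW.
Qed.

(** The distribution functions form a geometric Cauchy sequence, uniformly in [t]. *)
Lemma F_ex : exists F : R -> R, forall t, 0 <= t <= 2 * pi -> forall k, `|F t - dens_cdf k t| <= 2 * berr b k.
Proof.
suff /boolp.choice[F HF] : forall t, exists l, 0 <= t <= 2 * pi -> forall k, `|l - dens_cdf k t| <= 2 * berr b k.
  by exists F.
move=> t; have [tI|_] := boolP (0 <= t <= 2 * pi); last by exists 0.
have cle n : modulus (rC (dens_cdf n.+1 t - dens_cdf n t)) <= berr b 0 * (1 / 2) ^+ n.
  by rewrite modulusR (le_trans (dens_cdf_step n tI))// berr_geo.
have [L HL] := @geo_series R (fun n => rC (dens_cdf n.+1 t - dens_cdf n t)) (berr b 0) (1 / 2) ltac:(lra) ltac:(lra) cle.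
exists (reC L + dens_cdf 0 t) => _ k; apply/ler_addgt0Pr => e e0.
have b0 : 0 < berr b 0 by have [] := b_t b 0.
have b20 : 0 < 2 * berr b 0 by rewrite mulr_gt0.
have h20 : (0 : R) <= 1 / 2 by rewrite divr_ge0.
have h21 : (1 / 2 : R) < 1 by rewrite ltr_pdivrMr// mul1r ltr1n.
have [N HN] := expr_small h20 h21 (divr_gt0 e0 b20).
pose M := maxn N k.
have h1 : `|reC L + dens_cdf 0 t - dens_cdf M t| <= e.
  have -> : reC L + dens_cdf 0 t - dens_cdf M t = reC (L - \sum_(n < M) rC (dens_cdf n.+1 t - dens_cdf n t)).
    have sumE : \sum_(n < M) reC (rC (dens_cdf n.+1 t - dens_cdf n t)) = dens_cdf M t - dens_cdf 0 t.
      rewrite (eq_bigr (fun n : 'I_M => dens_cdf n.+1 t - dens_cdf n t)) => [|n _]; last by rewrite reR.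
      by rewrite -(big_mkord xpredT (fun n => dens_cdf n.+1 t - dens_cdf n t)) telescope_sumr.
    by rewrite reB re_sum sumE; ring.
  apply: (le_trans (le_re _)); apply: (le_trans (HL M)).
  have := HN M (leq_maxl _ _); rewrite ltr_pdivlMr; last by lra.
  have -> : (1 - 1 / 2 : R) = 2^-1 by field.
  rewrite invrK; lra.
have := dens_cdf_dist tI (leq_maxr N k); rewrite -/M.
by have := ler_distD (dens_cdf M t) (reC L + dens_cdf 0 t) (dens_cdf k t); lra.
Qed.

Lemma dens_cdf0 k : dens_cdf k 0 = 0.
Proof. by rewrite /dens_cdf /Rint set_itv1 Rintegral_set1 mulr0. Qed.

Lemma dens_cdf2pi k : dens_cdf k (2 * pi) = 1.
Proof. exact: RMean_bdry (b_carath b k). Qed.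

Lemma dens_cdf_incr k s t : 0 <= s -> s <= t -> dens_cdf k t - dens_cdf k s = (2 * pi)^-1 * Rint s t (dens k).
Proof. by move=> s0 st; rewrite /dens_cdf (Rint_split s0 st (rcont_dens k)) mulrDr addrAC subrr add0r. Qed.

Lemma dens_cdf_incr_ge0 k s t : 0 <= s -> s <= t -> dens_cdf k s <= dens_cdf k t.
Proof.
move=> s0 st; rewrite -subr_ge0 dens_cdf_incr// mulr_ge0 ?tau_inv_ge0//.
by apply: Rint_ge0 => x _; exact/ltW/dens_gt0.
Qed.

Lemma dens_cdf_incr_le k s t (c : R) : 0 <= s -> s <= t -> (forall x, s <= x <= t -> dens k x <= c) ->
  dens_cdf k t - dens_cdf k s <= (2 * pi)^-1 * (c * (t - s)).
Proof.
move=> s0 st fc; rewrite dens_cdf_incr// ler_wpM2l ?tau_inv_ge0// -Rint_cst//.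
by apply: le_Rint => //; [exact: rcont_dens|exact: rcont_cst].
Qed.

Definition clip (t : R) : R := Num.max 0 (Num.min t (2 * pi)).

Lemma clip_in t : 0 <= clip t <= 2 * pi.
Proof. by rewrite /clip le_max lexx/= ge_max tau_ge0 ge_min lexx orbT. Qed.
Lemma clip_id t : 0 <= t <= 2 * pi -> clip t = t.
Proof. by move=> /andP[t0 t1]; rewrite /clip (min_idPl t1) (max_idPr t0). Qed.
Lemma clip_le0 t : t <= 0 -> clip t = 0.
Proof. by move=> t0; rewrite /clip (min_idPl (le_trans t0 (@tau_ge0 R))) (max_idPl t0). Qed.
Lemma clip_ge t : 2 * pi <= t -> clip t = 2 * pi.
Proof. by move=> t0; rewrite /clip (min_idPr t0) (max_idPr (@tau_ge0 R)). Qed.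
Lemma clip_mono s t : s <= t -> clip s <= clip t.
Proof.
by move=> st; rewrite /clip ge_max !le_max lexx/= le_min !ge_min lexx st !orbT.
Qed.
Lemma clip_lip s t : s <= t -> clip t - clip s <= t - s.
Proof.
move=> st; have [t0|t0] := leP t 0.
  by rewrite !clip_le0 ?(le_trans st)//; lra.
have [s2|s2] := leP (2 * pi) s; first by rewrite !clip_ge ?(le_trans s2)//; lra.
have : clip t <= t by rewrite /clip ge_max (ltW t0) ge_min lexx.
have : s <= clip s by rewrite /clip le_max le_min lexx (ltW s2) orbT.
lra.
Qed.

Variable F : R -> R.
Hypothesis HF : forall t, 0 <= t <= 2 * pi -> forall k, `|F t - dens_cdf k t| <= 2 * berr b k.

Definition cdfG (t : R) : R := F (clip t).

Lemma cdf_close t k : `|cdfG t - dens_cdf k (clip t)| <= 2 * berr b k.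
Proof. exact: HF (clip_in t) k. Qed.

Lemma cdf_val t c : (forall k, dens_cdf k (clip t) = c) -> cdfG t = c.
Proof.
move=> Fc; apply/eqP; rewrite -subr_eq0 -normr_le0; apply/ler_addgt0Pr => e e0.
have [k0 H] := berr_small (divr_gt0 e0 (ltr0Sn R 1)).
by have := cdf_close t k0; have := H _ (leqnn _); rewrite Fc; lra.
Qed.

Lemma cdf_le0 t : t <= 0 -> cdfG t = 0.
Proof. by move=> t0; apply: cdf_val => k; rewrite clip_le0// dens_cdf0. Qed.
Lemma cdf_ge t : 2 * pi <= t -> cdfG t = 1.
Proof. by move=> t0; apply: cdf_val => k; rewrite clip_ge// dens_cdf2pi. Qed.

Lemma cdf_mono : {homo cdfG : x y / x <= y}.
Proof.
move=> s t st; apply/ler_addgt0Pr => e e0.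
have [k0 H] := berr_small (divr_gt0 e0 (ltr0Sn R 3)).
have := cdf_close t k0; have := cdf_close s k0; have := H _ (leqnn _).
have /andP[c0 _] := clip_in s.
have := dens_cdf_incr_ge0 k0 c0 (clip_mono st); rewrite !ler_norml => ? ? /andP[? ?] /andP[? ?]; lra.
Qed.

(** A uniform limit of Lipschitz functions. *)
Lemma cdf_cont : continuous cdfG.
Proof.
move=> t; apply/(@cvgRP _ _ (nbhs t)) => e e0.
have [k H] := berr_small (divr_gt0 e0 (ltr0Sn R 7)).
have {}H := H k (leqnn _).
pose M := pnorm (bpoly b k).
have M0 : 0 <= M by exact: pnorm_ge0.
have fM x : dens k x <= M by rewrite (le_trans (re_le _))// poly_le_pnorm// modulus_ec.
have lip s u : s <= u -> cdfG u - cdfG s <= e / 2 + M * (u - s).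
  move=> su; have := cdf_close u k; have := cdf_close s k.
  have /andP[c0 _] := clip_in s.
  have := dens_cdf_incr_le c0 (clip_mono su) (fun x _ => fM x).
  have cl := clip_lip su. have cm := clip_mono su.
  have : (2 * pi)^-1 * (M * (clip u - clip s)) <= M * (u - s).
    rewrite -[leRHS]mul1r; apply: ler_pM; rewrite ?tau_inv_ge0 ?tau_inv_le1//.
      by rewrite mulr_ge0// subr_ge0.
    by rewrite ler_wpM2l.
  rewrite !ler_norml => ? ? /andP[? ?] /andP[? ?]; lra.
apply/nearRP; exists (e / 4 / (M + 1)); first by rewrite !divr_gt0//; lra.
move=> s; rewrite ltr_pdivlMr; last by lra.
move=> st; have [ts|/ltW ts] := leP t s.
  have := lip _ _ ts; have := cdf_mono ts => h1 h2.
  rewrite ger0_norm ?subr_ge0//; move: st; rewrite ger0_norm ?subr_ge0// => st; nra.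
have := lip _ _ ts; have := cdf_mono ts => h1 h2.
rewrite distrC ger0_norm ?subr_ge0//; move: st; rewrite distrC ger0_norm ?subr_ge0// => st; nra.
Qed.

Lemma cdf_prob : exists P : probability (measurableTypeR R) R,
  forall s t : R, s <= t -> P `]s, t]%classic = (cdfG t - cdfG s)%:E.
Proof. exact: stieltjes cdf_mono cdf_cont cdf_le0 cdf_ge. Qed.

Definition grid n (i : nat) : R := i%:R * (2 * pi / n%:R).

Lemma grid0 n : grid n 0 = 0. Proof. by rewrite /grid mul0r. Qed.
Lemma gridn n : (0 < n)%N -> grid n n = 2 * pi.
Proof. by move=> n0; rewrite /grid mulrCA divff ?mulr1// pnatr_eq0 -lt0n. Qed.
Lemma gridS n i : grid n i.+1 - grid n i = 2 * pi / n%:R.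
Proof. by rewrite /grid -natr1; ring. Qed.
Lemma grid_le n i j : (i <= j)%N -> grid n i <= grid n j.
Proof. by move=> ij; rewrite /grid ler_wpM2r ?divr_ge0 ?tau_ge0// ler_nat. Qed.
Lemma grid_ge0 n i : 0 <= grid n i.
Proof. by rewrite -(grid0 n) grid_le. Qed.
Lemma grid_le2pi n i : (i <= n)%N -> grid n i <= 2 * pi.
Proof.
case: n => [|n] le_in; last by rewrite -(gridn (ltn0Sn n)) grid_le.
by rewrite /grid invr0 !mulr0 tau_ge0.
Qed.

(** An additive function of intervals, close to [phi] times the increment of [G] on short intervals, is close to the
sum of Riemann and Stieltjes. It is applied to the limit measure and to the densities. *)
Lemma stieltjes_sum_close (J : R -> R -> R) (G phi : R -> R) n (e : R) : (0 < n)%N ->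
  (forall a' b' c, 0 <= a' -> a' <= b' -> b' <= c -> c <= 2 * pi -> J a' c = J a' b' + J b' c) ->
  (forall a' b', 0 <= a' -> a' <= b' -> b' <= 2 * pi -> b' - a' <= 2 * pi / n%:R ->
     `|J a' b' - phi a' * (G b' - G a')| <= e * (G b' - G a')) ->
  `|J 0 (2 * pi) - \sum_(i < n) phi (grid n i) * (G (grid n i.+1) - G (grid n i))| <= e * (G (2 * pi) - G 0).
Proof.
move=> n0 Jadd Jloc; rewrite -(gridn n0).
suff H m : (m <= n)%N -> `|J 0 (grid n m) - \sum_(i < m) phi (grid n i) * (G (grid n i.+1) - G (grid n i))| <= e * (G (grid n m) - G 0).
  exact: H.
elim: m => [|m ih] mn.
  rewrite grid0 big_ord0 !subrr mulr0 subr0.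
  have := Jadd 0 0 0 (lexx _) (lexx _) (lexx _) (@tau_ge0 R) => J0.
  by rewrite (_ : J 0 0 = 0) ?normr0//; lra.
rewrite big_ord_recr/= (Jadd 0 (grid n m) (grid n m.+1)) ?grid_ge0 ?grid_le ?grid_le2pi//.
have h := Jloc (grid n m) (grid n m.+1) (grid_ge0 _ _) (grid_le _ (leqnSn m)) (grid_le2pi mn) ltac:(by rewrite gridS).
have {}ih := ih (ltnW mn).
set A := J _ _ in ih *; set B := \sum_(i < m) _ in ih *; set D := J _ _ in h *.
set E := phi _ * _ in h *.
have -> : A + D - (B + E) = (A - B) + (D - E) by ring.
by apply: (le_trans (ler_normD _ _)); lra.
Qed.

Variable P : probability (measurableTypeR R) R.
Hypothesis HP : forall s t : R, s <= t -> P `]s, t]%classic = (cdfG t - cdfG s)%:E.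

Lemma P_oc : P `]0%R, (2 * pi)%R]%classic = 1%E.
Proof. by rewrite HP ?tau_ge0// (cdf_ge (lexx _)) (cdf_le0 (lexx _)) subr0. Qed.

Lemma P_out : P (~` `]0%R, (2 * pi)%R]%classic) = 0%E.
Proof. by rewrite probability_setC// P_oc subee. Qed.

Lemma P_integrable (phi : R -> R) (D : set R) (M : R) : rcont phi -> (forall t, `|phi t| <= M) ->
  measurable D -> P.-integrable D (EFin \o phi).
Proof.
move=> cphi phiM mD; apply: measurable_bounded_integrable => //.
- by rewrite (le_lt_trans (probability_le1 _ _))// ltry.
- apply: measurable_funTS.
  exact: (measurable_realfun.continuous_measurable_fun (rcontE cphi)).
- exists M; split; first exact: num_real.
  by move=> x Mx t _ /=; rewrite (le_trans (phiM t))// ltW.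
Qed.

(** Both integrals are close to sums of Riemann and Stieltjes on a common grid, for distribution functions that are close
to each other. *)
Theorem weak_limit (phi : R -> R) (M : R) : rcont phi -> (forall t, `|phi t| <= M) ->
  forall e : R, 0 < e -> exists k0, forall k, (k0 <= k)%N ->
    `|\int[P]_x phi x - RMean (fun t => phi t * dens k t)| <= e.
Proof.
move=> cphi phiM e e0.
have M0 : 0 <= M := le_trans (normr_ge0 _) (phiM 0).
have e3 : 0 < e / 3 by rewrite divr_gt0.
have [d d0 Hd] := unif_cont 0 (2 * pi) cphi e3.
pose n := (Num.bound (2 * pi / d)).+1.
have n0 : (0 < n)%N by [].
have nR : 0 < n%:R :> R by rewrite ltr0n.
have nd : 2 * pi / n%:R < d.
  rewrite ltr_pdivrMr// [ltRHS]mulrC -ltr_pdivrMr//.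
  apply: (lt_le_trans (archi_boundP (divr_ge0 (@tau_ge0 R) (ltW d0)))).
  by rewrite ler_nat leqnSn.
have osc s t : 0 <= s -> s <= t -> t <= 2 * pi -> t - s <= 2 * pi / n%:R -> `|phi t - phi s| <= e / 3.
  move=> s0 st t2 ts; apply/ltW/Hd; first by rewrite s0 (le_trans st).
  by rewrite ger0_norm ?subr_ge0// (le_lt_trans ts).
have iP D : measurable D -> P.-integrable D (EFin \o phi) by move=> mD; exact: P_integrable phiM mD.
pose J s t := \int[P]_(x in `]s, t]) phi x.
(* no mass outside the interval *)
have JT : \int[P]_x phi x = J 0 (2 * pi).
  have mN : measurable (~` `]0%R, (2 * pi)%R]%classic : set (measurableTypeR R)) by exact: measurableC.
  have := @negligible_integral _ (measurableTypeR R) R P setT _ (EFin \o phi) mN measurableT (iP _ measurableT) P_out.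
  by rewrite setTD setCK /J /Rintegral => ->.
have HA : `|J 0 (2 * pi) - \sum_(i < n) phi (grid n i) * (cdfG (grid n i.+1) - cdfG (grid n i))| <= e / 3.
  have -> : e / 3 = e / 3 * (cdfG (2 * pi) - cdfG 0) by rewrite (cdf_ge (lexx _)) (cdf_le0 (lexx _)) subr0 mulr1.
  apply: stieltjes_sum_close => // [s t u s0 st tu u2|s t s0 st t2 ts].
    rewrite /J -Rintegral_setU//.
    - by congr Rintegral; rewrite -itv_bndbnd_setU// bnd_simp.
    - apply: iP; exact: measurableU.
    - apply/disj_setPS => x [/=]; rewrite !in_itv/= => /andP[_ xt] /andP[tx _].
      by move: (lt_le_trans tx xt); rewrite ltxx.
  have mst : measurable (`]s, t]%classic : set R) by [].
  have Pst : fine (P `]s, t]%classic) = cdfG t - cdfG s by rewrite HP.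
  have ic c : P.-integrable `]s, t] (EFin \o (fun=> c : R)).
    by apply: (@P_integrable (fun=> c) _ `|c|) => //; exact: rcont_cst.
  have -> : J s t - phi s * (cdfG t - cdfG s) = \int[P]_(x in `]s, t]) (phi x - phi s).
    rewrite RintegralB//; last exact: iP.
    by rewrite Rintegral_cst// Pst.
  have ib : P.-integrable `]s, t] (EFin \o (fun x => phi x - phi s)).
    apply: (@P_integrable (fun x => phi x - phi s) _ (M + M)) => //.
      by apply: rcontB => //; exact: rcont_cst.
    by move=> x; rewrite (le_trans (ler_normB _ _))// lerD.
  apply: (le_trans (le_normr_Rintegral _ _)) => //.
  have -> : e / 3 * (cdfG t - cdfG s) = \int[P]_(x in `]s, t]) (e / 3) by rewrite Rintegral_cst// Pst.
  apply: le_Rintegral => //.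
  - exact: (integrable_norm ib).
  - move=> x /=; rewrite in_itv/= => /andP[sx xt]; apply: osc => //; first exact: ltW.
      exact: le_trans xt t2.
    by lra.
have [k0 Hk0] := berr_small (e := e / 3 / (4 * (M + 1) * n%:R)) ltac:(by rewrite !divr_gt0// !mulr_gt0//; lra).
exists k0 => k /Hk0 btk.
have cpf : rcont (fun t => phi t * dens k t) by apply: rcontM => //; exact: rcont_dens.
pose Jk s t := (2 * pi)^-1 * Rint s t (fun t => phi t * dens k t).
have HB : `|Jk 0 (2 * pi) - \sum_(i < n) phi (grid n i) * (dens_cdf k (grid n i.+1) - dens_cdf k (grid n i))| <= e / 3.
  have -> : e / 3 = e / 3 * (dens_cdf k (2 * pi) - dens_cdf k 0) by rewrite dens_cdf2pi dens_cdf0 subr0 mulr1.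
  apply: stieltjes_sum_close => // [s t u s0 st tu u2|s t s0 st t2 ts].
    by rewrite /Jk (Rint_split st tu cpf) mulrDr.
  rewrite dens_cdf_incr// /Jk.
  have cb := rcont_dens k.
  have cpb : rcont (fun x => phi s * dens k x) by apply: rcontM => //; exact: rcont_cst.
  have -> : phi s * ((2 * pi)^-1 * Rint s t (dens k)) = (2 * pi)^-1 * Rint s t (fun x => phi s * dens k x).
    by rewrite RintZ// mulrCA.
  rewrite -mulrBr -RintB// normrM ger0_norm ?tau_inv_ge0// mulrCA ler_wpM2l ?tau_inv_ge0//.
  rewrite -RintZ// ler_norml -RintN; last by apply: rcontM => //; exact: rcont_cst.
  have cc : rcont (fun x => e / 3 * dens k x) by apply: rcontM => //; exact: rcont_cst.
  have key x : s <= x <= t -> `|phi x - phi s| <= e / 3.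
    by move=> /andP[sx xt]; apply: osc => //; [exact: le_trans xt t2|lra].
  apply/andP; split; apply: le_Rint; try exact: rcontB; try exact: rcontN; try exact: cc;
    move=> x /key; rewrite ler_norml => /andP[h1 h2]; have := dens_gt0 k x; nra.
have HC : `|\sum_(i < n) phi (grid n i) * (cdfG (grid n i.+1) - cdfG (grid n i)) -
   \sum_(i < n) phi (grid n i) * (dens_cdf k (grid n i.+1) - dens_cdf k (grid n i))| <= e / 3.
  rewrite -sumrB; apply: (le_trans (ler_norm_sum _ _ _)).
  apply: (@le_trans _ _ (\sum_(i < n) M * (4 * berr b k))).
    apply: ler_sum => i _; rewrite -mulrBr normrM; apply: ler_pM => //.
    have h i' : (i' <= n)%N -> `|cdfG (grid n i') - dens_cdf k (grid n i')| <= 2 * berr b k.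
      move=> i'n; have := cdf_close (grid n i') k; rewrite clip_id// grid_ge0 grid_le2pi//.
    have := h i (ltnW (ltn_ord i)); have := h i.+1 (ltn_ord i); rewrite !ler_norml; lra.
  rewrite sumr_const card_ord -[leLHS]mulr_natl.
  move: btk; rewrite ler_pdivlMr ?mulr_gt0//; last by lra.
  have [bt0 _] := b_t b k; move: bt0; move: (berr b k) => x x0 h.
  apply: le_trans h; move: nR; move: (n%:R : R) => N N0.
  have := mulr_gt0 x0 N0. nra.
rewrite JT; have -> : RMean (fun t => phi t * dens k t) = Jk 0 (2 * pi) by [].
move: HA HB HC; set S1 := \sum_(i < n) _; set S2 := \sum_(i < n) _ => HA HB HC.
have := ler_distD S1 (J 0 (2 * pi)) (Jk 0 (2 * pi)); have := ler_distD S2 S1 (Jk 0 (2 * pi)).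
rewrite (distrC S2); lra.
Qed.

End Limit.

(** * The Herglotz kernel *)

Section Herglotz.
Context {R : realType}.
Local Notation C := (Cplx R).

(** The kernel of Herglotz; its real part is the Poisson kernel. *)
Definition herg (z : C) (t : R) : C := (ec t + z) / (ec t - z).

Lemma ec_sub_neq0 (z : C) (t : R) : modulus z < 1 -> ec t - z != 0.
Proof.
move=> z1; rewrite -modulus_gt0; apply: lt_le_trans (modulus_subD _ _).
by rewrite modulus_ec subr_gt0.
Qed.

Lemma ccont_herg (z : C) : modulus z < 1 -> ccont (herg z).
Proof.
move=> z1; apply: (@contC_M R (fun t => ec t + z) (fun t => (ec t - z)^-1)).
  exact: @contC_D R _ _ (@ccont_ec R) (contC_cst z).
apply: (@contC_V R (fun t => ec t - z)); last by move=> t; exact: ec_sub_neq0.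
exact: @contC_B R _ _ (@ccont_ec R) (contC_cst z).
Qed.

Lemma herg_bound (z : C) (t : R) : modulus z < 1 -> modulus (herg z t) <= 2 / (1 - modulus z).
Proof.
move=> z1; rewrite modulusM modulusV; apply: ler_pM.
- exact: modulus_ge0.
- by rewrite invr_ge0 modulus_ge0.
- by apply: (le_trans (modulusD _ _)); rewrite modulus_ec; lra.
- rewrite lef_pV2 ?posrE ?modulus_gt0 ?ec_sub_neq0// ?subr_gt0//.
  by have := modulus_subD (ec t) z; rewrite modulus_ec.
Qed.

Lemma Mean_modulus (g : R -> C) : ccont g -> modulus (Mean g) <= RMean (fun t => modulus (g t)).
Proof.
move=> cg; rewrite /Mean /RMean modulusM modulusR ger0_norm ?tau_inv_ge0//.
by rewrite ler_wpM2l ?tau_inv_ge0// Cint_modulus.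
Qed.

Lemma rC_reE (z : C) : rC (reC z) = (z + cjC z) / 2.
Proof. by rewrite -rCn -rCV; apply: eq_reim; rewrite !reimE; field. Qed.

Lemma ccont_bdry (H : {poly C}) : ccont (fun t => rC (bdry H t)).
Proof. exact: cont_rC (rcont_bdry H). Qed.

(** The conjugate half of the real part only has nonpositive frequencies. *)
Lemma Mean_bdry_coef (H : {poly C}) n : H`_0 = 1 ->
  Mean (fun t => rC (bdry H t) * ec t ^- n) = (H`_n + (n == 0%N)%:R) / 2.
Proof.
move=> H0.
have c1 := @contC_M R _ _ (ccont_poly H) (@ccont_ecV R n).
have c2 : ccont (fun t => H.[ec t] * ec t ^+ n) := @contC_M R _ _ (ccont_poly H) (@ccont_ecX R n).
have E t : rC (bdry H t) * ec t ^- n = 2^-1 * (H.[ec t] * ec t ^- n + cjC (H.[ec t] * ec t ^+ n)).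
  rewrite rC_reE cjM cjX ec_cj exprVn; move: (ec t ^- n) (H.[ec t]) (cjC _) => x y v.
  by rewrite mulrC mulrA [in RHS]mulrC; ring.
rewrite (eq_Mean E) MeanZ; last exact: contC_D c1 (cont_cj c2).
rewrite MeanD; [|exact: c1|exact: cont_cj c2].
rewrite Mean_cj// Mean_poly mulrC; congr (_ / _); congr (_ + _).
have -> : (fun t => H.[ec t] * ec t ^+ n) = (fun t => ('X^n * H).[ec t] : C).
  by apply/funext => t; rewrite hornerM hornerXn mulrC.
rewrite Mean_poly0 coefXnM; case: n {c1 c2 E} => [|n]/=; last by rewrite -rC0 cjR.
by rewrite subn0 H0 -rC1 cjR.
Qed.

(** With [x = z / exp (i t)] the kernel is [2 / (1 - x) - 1]; expand [1 / (1 - x)] to order [N + 1]. As [f] is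
positive with mean [1], the remainder is bounded by the supremum of the kernel part alone, uniformly in [H]. *)
Lemma herg_rem (H : {poly C}) (z : C) N : carath H -> modulus z < 1 ->
  modulus (Mean (fun t => herg z t * rC (bdry H t)) - \sum_(n < N.+1) H`_n * z ^+ n)
   <= 2 * modulus z ^+ N.+1 / (1 - modulus z).
Proof.
move=> gH z1; have [H0 Hp] := gH.
pose x (t : R) := z * (ec t)^-1.
have x1 t : 1 - x t != 0.
  have := ec_sub_neq0 t z1; apply: contra => /eqP e.
  by rewrite -[ec t]mul1r -[z](divfK (ec_neq0 t)) -mulrBl e mul0r.
have cV : ccont (fun t : R => (ec t)^-1) := @contC_V R _ (@ccont_ec R) (@ec_neq0 R).
have cx : ccont x := @contC_M R _ _ (contC_cst z) cV.
have c1x : ccont (fun t => (1 - x t)^-1) := @contC_V R _ (@contC_B R _ _ (contC_cst 1) cx) x1.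
have cf := ccont_bdry H.
pose r t := x t ^+ N.+1 / (1 - x t) * rC (bdry H t).
have cr : ccont r := @contC_M R _ _ (@contC_M R _ _ (@contC_X R _ N.+1 cx) c1x) cf.
have cn (n : nat) : ccont (fun t => rC (bdry H t) * ec t ^- n) := @contC_M R _ _ cf (@ccont_ecV R n).
have cs : ccont (fun t => \sum_(n < N.+1) z ^+ n * (rC (bdry H t) * ec t ^- n)).
  by apply: contC_sum => n; exact: @contC_M R _ _ (contC_cst (z ^+ n)) (cn n).
have E t : herg z t * rC (bdry H t) =
    2 * (\sum_(n < N.+1) z ^+ n * (rC (bdry H t) * ec t ^- n) + r t) - rC (bdry H t).
  have -> : herg z t = 2 * (1 - x t)^-1 - 1.
    rewrite /herg /x; have := ec_sub_neq0 t z1; have := ec_neq0 t; have := x1 t; rewrite /x.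
    by move: (ec t) => w h1 h2 h3; field; rewrite h3 h2.
  have xn1 : x t != 1 by have := x1 t; rewrite subr_eq0 eq_sym.
  rewrite (geo_expand N.+1 xn1).
  rewrite /r; set q := x t ^+ N.+1 / _.
  have -> : \sum_(n < N.+1) z ^+ n * (rC (bdry H t) * ec t ^- n) = rC (bdry H t) * \sum_(n < N.+1) x t ^+ n.
    by rewrite mulr_sumr; apply: eq_bigr => n _; rewrite /x exprMn exprVn mulrCA.
  by move: (\sum_(_ < _) _) (rC _) q => a b c; ring.
rewrite (eq_Mean E) MeanB; [|by exact: @contC_M R _ _ (contC_cst 2) (@contC_D R _ _ cs cr)|exact: cf].
rewrite MeanZ; last exact: @contC_D R _ _ cs cr.
rewrite (@MeanD R _ _ cs cr) Mean_sum; last by move=> n; exact: @contC_M R _ _ (contC_cst (z ^+ n)) (cn n).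
have M1 : Mean (fun t => rC (bdry H t)) = 1.
  have := Mean_bdry_coef 0 H0; rewrite (eq_Mean (h := fun t => rC (bdry H t))); last by move=> t; rewrite expr0 invr1 mulr1.
  by rewrite H0 => ->; rewrite divff// pnatr_eq0.
rewrite M1.
have -> : 2 * (\sum_(n < N.+1) Mean (fun t => z ^+ n * (rC (bdry H t) * ec t ^- n)) + Mean r) - 1
    - \sum_(n < N.+1) H`_n * z ^+ n = 2 * Mean r.
  have -> : \sum_(n < N.+1) Mean (fun t => z ^+ n * (rC (bdry H t) * ec t ^- n)) =
    (\sum_(n < N.+1) H`_n * z ^+ n + 1) / 2.
    rewrite (eq_bigr (fun n : 'I_N.+1 => (H`_n * z ^+ n + (n == 0%N :> nat)%:R * z ^+ n) / 2)); last first.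
      by move=> n _; rewrite MeanZ// Mean_bdry_coef// mulrA mulrDr ![z ^+ n * _]mulrC.
    rewrite -mulr_suml big_split/=; congr ((_ + _) / _).
    rewrite big_ord_recl expr0 mulr1 big1 ?addr0// => n _.
    by rewrite mul0r.
  by field.
rewrite modulusM modulus_nat -mulrA ler_wpM2l//.
apply: (le_trans (Mean_modulus cr)).
have -> : modulus z ^+ N.+1 / (1 - modulus z) = RMean (fun t => modulus z ^+ N.+1 / (1 - modulus z) * bdry H t).
  by rewrite RMeanZ ?RMean_bdry ?mulr1//; exact: rcont_bdry.
apply: le_RMean => [||t].
- exact: cont_mod.
- by apply: rcontM; [exact: rcont_cst|exact: rcont_bdry].
rewrite /r !modulusM modulusX modulusV modulusR (ger0_norm (ltW (Hp t))).
apply: ler_wpM2r; first exact: ltW.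
have mx : modulus (x t) = modulus z by rewrite /x modulusM modulusV modulus_ec invr1 mulr1.
rewrite mx ler_wpM2l ?exprn_ge0 ?modulus_ge0// lef_pV2 ?posrE ?modulus_gt0 ?subr_gt0//.
by have := modulus_subD 1 (x t); rewrite modulus1 mx.
Qed.

Lemma herg_tail_small (z : C) (e : R) : modulus z < 1 -> 0 < e ->
  exists N0, forall N, (N0 <= N)%N -> 2 * modulus z ^+ N.+1 / (1 - modulus z) <= e.
Proof.
move=> z1 e0; have z10 : 0 < 1 - modulus z by rewrite subr_gt0.
have [N0 H] := expr_small (modulus_ge0 z) z1 (divr_gt0 (mulr_gt0 e0 z10) (ltr0Sn R 1)).
exists N0 => N NN; rewrite ler_pdivrMr//.
by have := H N.+1 (leqW NN); rewrite ltr_pdivlMr//; lra.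
Qed.

(** A polynomial is recovered from its real part on the circle. *)
Lemma poly_herg (H : {poly C}) (z : C) : carath H -> modulus z < 1 ->
  Mean (fun t => herg z t * rC (bdry H t)) = H.[z].
Proof.
move=> gH z1; apply/eqP; rewrite -subr_eq0; apply/eqP/modulus_small0 => e e0.
have e2 : 0 < e / 2 by rewrite divr_gt0.
have [N1 H1] := herg_tail_small z1 e2.
have [N2 H2] := has_coefs_poly H z1 e2.
apply: (le_trans (modulus_tri _ _ (\sum_(n < (maxn N1 N2).+1) H`_n * z ^+ n))).
have h1 := le_trans (herg_rem (maxn N1 N2) gH z1) (H1 _ (leq_maxl _ _)).
have := H2 (maxn N1 N2).+1 (leqW (leq_maxr _ _)); rewrite modulusC; lra.
Qed.

End Herglotz.

(** * The inner function and its Taylor coefficients *)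

Section LimitMeasure.
Context {R : realType}.
Local Notation C := (Cplx R).
Variables (Q : nat -> {poly C} -> R -> Prop) (b : blueprint Q).

(** The properties of the limit measure that are used below, without reference to its distribution function. *)
Theorem limit_measure : exists P : probability (measurableTypeR R) R,
  [/\ (forall (phi : R -> R) (M : R), rcont phi -> (forall t, `|phi t| <= M) ->
        forall e : R, 0 < e -> exists k0, forall k, (k0 <= k)%N ->
        `|\int[P]_x phi x - RMean (fun t => phi t * bdry (bpoly b k) t)| <= e),
      P (~` `]0%R, (2 * pi)%R]%classic) = 0%E &
      forall k s t, 0 <= s -> s <= t -> t <= 2 * pi ->
        (P `]s, t]%classic <= (dens_cdf b k t - dens_cdf b k s + 4 * berr b k)%:E)%E].
Proof.
have [F HF] := F_ex b; have [P HP] := cdf_prob HF.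
exists P; split.
- by move=> phi M c1 c2 e e0; exact: (weak_limit HF HP c1 c2 e0).
- exact: (P_out HF HP).
- move=> k s t s0 st t2; rewrite HP// lee_fin.
  have := cdf_close HF s k; have := cdf_close HF t k.
  rewrite !clip_id ?s0 ?(le_trans st t2) ?(le_trans s0 st)//.
  by rewrite !ler_norml => /andP[? ?] /andP[? ?]; lra.
Qed.

Variable P : probability (measurableTypeR R) R.
Hypothesis weakP : forall (phi : R -> R) (M : R), rcont phi -> (forall t, `|phi t| <= M) ->
        forall e : R, 0 < e -> exists k0, forall k, (k0 <= k)%N ->
        `|\int[P]_x phi x - RMean (fun t => phi t * bdry (bpoly b k) t)| <= e.

Definition Hlim (z : C) : C :=
  mkC (\int[P]_t reC (herg z t)) (\int[P]_t imC (herg z t)).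

Definition hlim n : C := (bpoly b n)`_n.

(** Coefficients stabilize, since the step from [j] to [j + 1] has order greater than [j]. *)
Lemma bpoly_coef j n : (n <= j)%N -> (bpoly b j)`_n = hlim n.
Proof.
elim: j => [|j ih]; first by rewrite leqn0 => /eqP->.
rewrite leq_eqVlt ltnS => /orP[/eqP->//|nj]; rewrite -(ih nj).
have [G ->] := b_div b j; rewrite coefD coefXnM.
by rewrite (leq_ltn_trans nj (b_K b j)) addr0.
Qed.

Lemma im_MeanE (g : R -> C) : imC (Mean g) = RMean (fun t => imC (g t)).
Proof. by rewrite /Mean /RMean /Cint !reimE mul0r addr0. Qed.

Lemma Hlim_near (z : C) (e : R) : modulus z < 1 -> 0 < e ->
  exists k0, forall k, (k0 <= k)%N -> modulus (Hlim z - (bpoly b k).[z]) <= e.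
Proof.
move=> z1 e0; have e2 : 0 < e / 2 by rewrite divr_gt0.
have ch := ccont_herg z1.
have br t : `|reC (herg z t)| <= 2 / (1 - modulus z).
  exact: le_trans (le_re _) (herg_bound t z1).
have bi t : `|imC (herg z t)| <= 2 / (1 - modulus z).
  exact: le_trans (le_im _) (herg_bound t z1).
have [k1 H1] := weakP (cont_re ch) br e2.
have [k2 H2] := weakP (cont_im ch) bi e2.
exists (maxn k1 k2) => k; rewrite geq_max => /andP[/H1 h1 /H2 h2].
rewrite -(poly_herg (b_carath b k) z1).
apply: (le_trans (modulus_le _)); rewrite !reB !imB re_mk im_mk re_MeanE im_MeanE.
have -> : (fun t => reC (herg z t * rC (bdry (bpoly b k) t))) = (fun t => reC (herg z t) * bdry (bpoly b k) t).
  by apply/funext => t; rewrite !reimE mulr0 subr0.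
have -> : (fun t => imC (herg z t * rC (bdry (bpoly b k) t))) = (fun t => imC (herg z t) * bdry (bpoly b k) t).
  by apply/funext => t; rewrite !reimE mulr0 add0r.
lra.
Qed.

(** The estimate of [herg_rem] is uniform in [k], so it passes to the limit. *)
Lemma Hlim_rem (z : C) N : modulus z < 1 ->
  modulus (Hlim z - \sum_(n < N.+1) hlim n * z ^+ n) <= 2 * modulus z ^+ N.+1 / (1 - modulus z).
Proof.
move=> z1; apply/ler_addgt0Pr => e e0.
have [k0 H] := Hlim_near z1 e0.
have h1 := H _ (leq_maxl k0 N); have gk := b_carath b (maxn k0 N).
have := herg_rem N gk z1; rewrite (poly_herg gk z1).
rewrite (eq_bigr (fun n : 'I_N.+1 => hlim n * z ^+ n)); last first.
  move=> n _; rewrite bpoly_coef//; apply: leq_trans (leq_maxr _ _).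
  by rewrite -ltnS ltn_ord.
move=> h2; apply: (le_trans (modulus_tri _ _ (bpoly b (maxn k0 N)).[z])).
by rewrite addrC lerD.
Qed.

Lemma Hlim_coefs : has_coefs hlim Hlim.
Proof.
move=> z z1 e e0; have [N0 H] := herg_tail_small z1 e0.
exists N0.+1 => -[//|N] NN; exact: le_trans (Hlim_rem N z1) (H N NN).
Qed.

Lemma Hlim_bH (z : C) j : modulus z < 1 ->
  modulus (Hlim z - (bpoly b j).[z]) <= 4 * modulus z ^+ j.+1 / (1 - modulus z).
Proof.
move=> z1; have := herg_rem j (b_carath b j) z1; rewrite (poly_herg (b_carath b j) z1).
rewrite (eq_bigr (fun n : 'I_j.+1 => hlim n * z ^+ n)); last first.
  by move=> n _; rewrite bpoly_coef// -ltnS ltn_ord.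
have := Hlim_rem j z1 => h1 h2.
apply: (le_trans (modulus_tri _ _ (\sum_(n < j.+1) hlim n * z ^+ n))).
move: h2; rewrite modulusC; move: h1; rewrite -!mulrA; set q := _ / _; lra.
Qed.

Lemma Hlim_holo : holo Hlim.
Proof. exact: has_coefs_holo Hlim_coefs. Qed.

Lemma Hlim_re (z : C) : modulus z < 1 -> 0 <= reC (Hlim z).
Proof.
move=> z1; apply/ler_addgt0Pr => e e0.
have [k0 /(_ _ (leqnn _)) H] := Hlim_near z1 e0.
have := carath_exp_le1 (b_carath b k0) z1; rewrite modulus_expC reN -expR0 ler_expR => h1.
have := le_trans (le_re _) H; rewrite reB ler_norml => /andP[h2 _]; lra.
Qed.

Definition theta (z : C) : C := expC (- Hlim z).

Lemma holo_theta : holo theta.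
Proof. exact: (@holo_exp R (fun z => - Hlim z) (@holoN R _ Hlim_holo)). Qed.

Lemma theta_le1 (z : C) : modulus z < 1 -> modulus (theta z) <= 1.
Proof. by move=> z1; rewrite /theta modulus_expC reN -expR0 ler_expR oppr_le0 Hlim_re. Qed.

Definition Ftheta i (z : C) : C := expC ((bpoly b i).[z] - Hlim z).

Lemma FthetaE i z : Ftheta i z = expC (bpoly b i).[z] * theta z.
Proof. exact: expCD. Qed.

Lemma holo_Ftheta i : holo (Ftheta i).
Proof. exact: (@holo_exp R _ (@holoB R _ _ (@holo_poly R (bpoly b i)) Hlim_holo)). Qed.

Lemma Ftheta_bound i (c : R) (z : C) : (forall z : C, modulus z < 1 -> modulus (expC (bpoly b i).[z]) <= c) ->
  modulus z < 1 -> modulus (Ftheta i z) <= c.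
Proof.
move=> H z1; rewrite FthetaE modulusM -[leRHS]mulr1.
exact: ler_pM (modulus_ge0 _) (modulus_ge0 _) (H z z1) (theta_le1 z1).
Qed.

Lemma tcoefB (f g : C -> C) n : holo f -> holo g -> tcoef (fun z => f z - g z) n = tcoef f n - tcoef g n.
Proof.
move=> hf hg; have H := has_coefsD (taylor hf) (has_coefsZ (-1) (taylor hg)).
by rewrite (tcoefE (has_coefs_eq H _)) ?mulN1r// => z _; rewrite mulN1r.
Qed.

(** If the exponents agree up to order [m], the exponentials differ by a function of order [m + 1] at the origin. *)
Lemma tcoef_exp_agree (f g : C -> C) (d K B : R) m n : holo f -> holo g -> 0 < d -> d < 1 ->
  0 <= K -> (forall z : C, modulus z <= d -> modulus (f z - g z) <= K * modulus z ^+ m.+1) ->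
  (forall z : C, modulus z <= d -> modulus (expC (g z)) <= B) ->
  (n <= m)%N -> tcoef (fun z => expC (f z)) n = tcoef (fun z => expC (g z)) n.
Proof.
move=> hf hg d0 d1 K0 Hfg HB nm.
have [s s0 Hs] := @expC_lip0 R.
have hfe := @holo_exp R f hf; have hge := @holo_exp R g hg.
have B0 : 0 <= B.
  by apply: (le_trans _ (HB 0 _)); [exact: modulus_ge0|rewrite modulus0 ltW].
have K1 : 0 < K + 1 by rewrite ltr_wpDl.
pose r := Num.min d (s / (K + 1)).
have r0 : 0 < r by rewrite lt_min d0 divr_gt0.
have key (z : C) : modulus z <= r -> modulus (expC (f z) - expC (g z)) <= (B * (2 * K)) * modulus z ^+ m.+1.
  rewrite le_min => /andP[zd zs].
  have h := Hfg z zd.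
  have hw : modulus (f z - g z) <= s.
    apply: (le_trans h); move: zs; rewrite ler_pdivlMr// => zs; apply: le_trans zs.
    rewrite mulrC; apply: ler_pM => //; rewrite ?exprn_ge0 ?modulus_ge0//; last by rewrite lerDl.
    rewrite exprS ler_piMr ?modulus_ge0// exprn_ile1 ?modulus_ge0//.
    exact: le_trans zd (ltW d1).
  have -> : expC (f z) - expC (g z) = expC (g z) * (expC (f z - g z) - 1).
    by rewrite mulrBr mulr1 -expCD addrCA subrr addr0.
  rewrite modulusM -mulrA; apply: ler_pM; rewrite ?modulus_ge0 ?HB//.
  apply: (le_trans (Hs _ hw)); rewrite -mulrA ler_wpM2l//.
have := tcoef_vanish (@holoB R _ _ hfe hge) r0 key (n := n) nm.
by rewrite (tcoefB n hfe hge) => /eqP; rewrite subr_eq0 => /eqP.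
Qed.


Lemma tcoef_expd_id (A : {poly C}) n : (0 < n)%N -> tcoef (expd A A) n = 0.
Proof.
move=> n0; rewrite (tcoefE (has_coefs_eq (has_coefs_poly 1) _)); first by rewrite coef1 gtn_eqF.
by move=> z _; rewrite /expd subrr expC0 hornerC.
Qed.

(** Induction on [j]. At orders at least [bord j] the coefficients were controlled by the construction; at lower orders
they have not moved. The induction starts from the constant [exp 0 = 1]. *)
Lemma anchor_stage i j n : (i <= j)%N -> (0 < n)%N -> modulus (tcoef (expd (bpoly b i) (bpoly b j)) n) <= btol b i.
Proof.
have [D0 _] := b_Q b i.
move=> ij n0; elim: j ij => [|j ih]; rewrite leq_eqVlt => /orP[/eqP e|//].
- by rewrite -e (tcoef_expd_id _ n0) modulus0 ltW.
- by rewrite -e (tcoef_expd_id _ n0) modulus0 ltW.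
- rewrite ltnS => ij; have [Kn|nK] := leqP (bord b j) n; first exact: b_coef.
  have [G HG] := b_div b j.
  have [c c1 Hc] := exp_poly_bound (bpoly b i).
  have mK : (bord b j).-1.+1 = bord b j by rewrite prednK// (leq_ltn_trans _ nK).
  have hp k := @holoB R _ _ (@holo_poly R (bpoly b i)) (@holo_poly R (bpoly b k)).
  have h0 : (0 : R) < 1 / 2 by rewrite divr_gt0.
  have h1 : (1 / 2 : R) < 1 by lra.
  have h2 (z : C) : modulus z <= 1 / 2 -> modulus z < 1 by lra.
  rewrite -[X in modulus X](_ : tcoef (expd (bpoly b i) (bpoly b j)) n = _); first exact: ih.
  symmetry; apply: (@tcoef_exp_agree _ _ (1 / 2) (pnorm G) c (bord b j).-1 n (hp j.+1) (hp j) h0 h1 (pnorm_ge0 G)).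
  - move=> z /h2 z1; rewrite HG mK.
    have -> : (bpoly b i).[z] - (bpoly b j + 'X^(bord b j) * G).[z] - ((bpoly b i).[z] - (bpoly b j).[z]) = - (z ^+ bord b j * G.[z]).
      by rewrite hornerD hornerM hornerXn; ring.
    rewrite modulusN modulusM modulusX mulrC ler_wpM2r ?exprn_ge0 ?modulus_ge0//.
    by apply: poly_le_pnorm; exact: ltW.
  - by move=> z /h2 z1; exact: (expd_bound (b_carath b j) Hc z1).
  - by rewrite -ltnS mK.
Qed.

(** The limit [Hlim] and [bpoly j] agree up to order [j], so this reduces to [anchor_stage] for large [j]. *)
Theorem anchor_coef i n : (0 < n)%N -> modulus (tcoef (Ftheta i) n) <= btol b i.
Proof.
move=> n0; have inm : (i <= maxn i n)%N by exact: leq_maxl.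
have := anchor_stage inm n0; set j := maxn i n.
have [c c1 Hc] := exp_poly_bound (bpoly b i).
have h0 : (0 : R) < 1 / 2 by rewrite divr_gt0.
have h1 : (1 / 2 : R) < 1 by lra.
have h2 (z : C) : modulus z <= 1 / 2 -> modulus z < 1 by lra.
have hp := @holoB R _ _ (@holo_poly R (bpoly b i)) (@holo_poly R (bpoly b j)).
have hl := @holoB R _ _ (@holo_poly R (bpoly b i)) Hlim_holo.
have K0 : (0 : R) <= 8 by [].
suff -> : tcoef (Ftheta i) n = tcoef (expd (bpoly b i) (bpoly b j)) n by [].
apply: (@tcoef_exp_agree _ _ (1 / 2) 8 c j n hl hp h0 h1 K0).
- move=> z zd; have z1 := h2 z zd.
  have -> : (bpoly b i).[z] - Hlim z - ((bpoly b i).[z] - (bpoly b j).[z]) = - (Hlim z - (bpoly b j).[z]) by ring.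
  rewrite modulusN; apply: (le_trans (Hlim_bH j z1)).
  rewrite ler_pdivrMr ?subr_gt0//.
  have := exprn_ge0 j.+1 (modulus_ge0 z); move: (_ ^+ _) => q q0; nra.
- by move=> z /h2 z1; exact: (expd_bound (b_carath b j) Hc z1).
- exact: leq_maxr.
Qed.

End LimitMeasure.

(** * The measure on the circle and its singularity *)

Lemma nneseries_le (R : realType) (u : nat -> \bar R) (B : \bar R) : (forall n, (0 <= u n)%E) ->
  (forall N, (\sum_(n < N) u n <= B)%E) -> (\sum_(0 <= n <oo) u n <= B)%E.
Proof.
move=> u0 uB; apply: lime_le; first by apply: is_cvg_nneseries => n _ _.
by apply: nearW => N; rewrite big_mkord.
Qed.

(* The definitions on the circle and those of integrals are expressed by real and imaginary parts. *)
Transparent ec mkC reC imC.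
Lemma val_expi (R : realType) (t : R) : val (expi t) = ec t.
Proof. by []. Qed.
Lemma circle_integralE (R : realType) (nu : {measure set (borel_circle R) -> \bar R}) F :
  circle_integral nu F = mkC (\int[nu]_x reC (F x)) (\int[nu]_x imC (F x)).
Proof. by []. Qed.
Opaque ec mkC reC imC.

Section CircleMeasure.
Context {R : realType}.
Local Notation C := (Cplx R).

Lemma circle_val_continuous : continuous (fun x : circle R => val x : C).
Proof. exact: (@initial_continuous (circle R) C val). Qed.

Lemma modulus_val (x : circle R) : modulus (val x) = 1.
Proof.
case: x => w /= /set_mem /=; rewrite normE -rC1 => e.
by apply: (@rC_inj R); rewrite e.
Qed.

Lemma expi_preimage_open (O : set (circle R)) : open O -> open ((@expi R) @^-1` O).
Proof.
move=> [U oU <-].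
by have /continuousP/(_ U oU) := ccontE (@ccont_ec R).
Qed.

(** Open sets generate, and [expi] is continuous. *)
Lemma measurable_expi : measurable_fun setT (@expi R : measurableTypeR R -> borel_circle R).
Proof.
apply: (@measurability _ _ (measurableTypeR R) (borel_circle R) setT _ (@open (circle R) : set (set (borel_circle R)))) => //.
move=> _ [U oU <-]; rewrite setTI; exact: (measurable_realfun.open_measurable (expi_preimage_open oU)).
Qed.

Lemma measurable_continuous_circle (g : circle R -> R) : continuous g ->
  measurable_fun setT (g : borel_circle R -> R).
Proof.
move=> /continuousP cg; apply: (measurability _ (measurable_realfun.RGenOpens.measurableE R)).
move=> _ [_ [a [b ->] <-]]; rewrite setTI; apply: sub_sigma_algebra.
exact/cg/interval_open.
Qed.

Lemma kernel_cont (T : topologicalType) (v : T -> C) (z : C) : continuous v ->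
  (forall x, modulus (v x) = 1) -> modulus z < 1 ->
  continuous (fun x : T => (v x + z) / (v x - z)).
Proof.
move=> cv v1 z1 x; apply: cvgM.
  by apply: cvgD; [exact: cv|exact: cvg_cst].
apply: cvgV; last by apply: cvgB; [exact: cv|exact: cvg_cst].
rewrite -modulus_gt0; apply: lt_le_trans (modulus_subD _ _).
by rewrite v1 subr_gt0.
Qed.

Lemma measurable_kernel (z : C) : modulus z < 1 ->
  measurable_fun setT (fun x : borel_circle R => reC ((val x + z) / (val x - z))) /\
  measurable_fun setT (fun x : borel_circle R => imC ((val x + z) / (val x - z))).
Proof.
move=> z1; have ck := kernel_cont circle_val_continuous modulus_val z1.
split; apply: measurable_continuous_circle => x.
  by apply: (@continuous_comp _ _ _ (fun x : circle R => (val x + z) / (val x - z)) (@reC R)); [exact: ck|exact: cont_reC].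
by apply: (@continuous_comp _ _ _ (fun x : circle R => (val x + z) / (val x - z)) (@imC R)); [exact: ck|exact: cont_imC].
Qed.

End CircleMeasure.

Section Pushforward.
Context {R : realType}.
Local Notation C := (Cplx R).
Variables (P : probability (measurableTypeR R) R).

Definition expi_m : measurableTypeR R -> borel_circle R := @expi R.

Definition expiM : {mfun measurableTypeR R >-> borel_circle R} :=
  HB.pack expi_m (isMeasurableFun.Build _ _ _ _ expi_m (@measurable_expi R)).

Definition nuP : {finite_measure set (borel_circle R) -> \bar R} := distribution P expiM.


Lemma nuP_integral (g : borel_circle R -> R) (u : R -> R) (M : R) : measurable_fun setT g ->
  (forall t, g (expi t) = u t) -> rcont u -> (forall t, `|u t| <= M) ->
  \int[nuP]_x g x = \int[P]_t u t.
Proof.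
move=> mg gu cu uM; rewrite /Rintegral; congr fine.
have /measurable_realfun.measurable_EFinP mE := mg.
have iu := @P_integrable R P u setT M cu uM measurableT.
have E : (EFin \o g) \o expi_m = EFin \o u by apply/funext => t; rewrite /= gu.
have := @integral_pushforward _ _ (measurableTypeR R) (borel_circle R) R expi_m (@measurable_expi R) P setT (EFin \o g) mE.
rewrite E preimage_setT => /(_ iu measurableT) ->.
by apply: eq_integral => t _; rewrite -[RHS]/((EFin \o u) t) -E.
Qed.

End Pushforward.

Section Singular.
Context {R : realType}.
Local Notation C := (Cplx R).
Variables (Q : nat -> {poly C} -> R -> Prop) (b : blueprint Q).
Variable P : probability (measurableTypeR R) R.
Hypothesis outP : P (~` `]0%R, (2 * pi)%R]%classic) = 0%E.
Hypothesis arcP : forall k s t, 0 <= s -> s <= t -> t <= 2 * pi ->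
        (P `]s, t]%classic <= (dens_cdf b k t - dens_cdf b k s + 4 * berr b k)%:E)%E.

Let E_ j : set R := [set t | @eps_ R j <= bdry (bpoly b j.+1) t].
Let B_ j : set (borel_circle R) := [set x | @eps_ R j <= reC (bpoly b j.+1).[val x]].

Lemma preimage_B j : (@expi R) @^-1` (B_ j) = E_ j.
Proof. by apply/seteqP; split => t; rewrite /B_ /E_ /bdry /preimage /mkset val_expi. Qed.

Lemma measurable_B j : measurable (B_ j).
Proof.
have cg : continuous (fun x : circle R => reC (bpoly b j.+1).[val x]).
  move=> x; apply: (@continuous_comp _ _ _ (fun x : circle R => (bpoly b j.+1).[val x]) (@reC R)); last exact: cont_reC.
  apply: (@continuous_comp _ _ _ (fun x : circle R => val x : C) (fun w : C => (bpoly b j.+1).[w])).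
    exact: circle_val_continuous.
  exact: derivable_cont (@entire_poly R (bpoly b j.+1) _).
have := measurable_continuous_circle cg measurableT (measurable_itv `[@eps_ R j, +oo[).
by rewrite setTI preimage_itvcy.
Qed.

Lemma measurable_E j : measurable (E_ j).
Proof.
have := measurable_realfun.continuous_measurable_fun (rcontE (rcont_bdry (bpoly b j.+1))) measurableT (measurable_itv `[@eps_ R j, +oo[).
by rewrite setTI preimage_itvcy.
Qed.

(** On the grid that resolves [f_{j+1}], an arc that meets the set where [f_{j+1} < eps_j] has [f_{j+1} <= 2 eps_j] throughout; its
mass under the limit measure is at most that under the density, up to four times the error of the distribution functions, and there is room for
that error on each of the arcs. *)
Lemma low_measure j : (P (~` E_ j) <= (6 * @eps_ R j)%:E)%E.
Proof.
have mE : measurable (~` E_ j : set (measurableTypeR R)) by apply: measurableC; exact: measurable_E.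
have [n [n0 osc nt]] := b_res b j.
have nR : 0 < n%:R :> R by rewrite ltr0n.
have e0 := @eps_gt0 R j.
have [t0 _] := b_t b j.+1.
pose c : R := 2 * @eps_ R j / n%:R + 4 * berr b j.+1.
have c0 : 0 <= c by rewrite addr_ge0// ltW// ?divr_gt0// mulr_gt0.
have moc s t : measurable (`]s, t]%classic : set (measurableTypeR R)) by exact: measurable_itv.
(* by the choice of the grid, an arc that meets the low set is low throughout *)
have arc i : (i < n)%N -> (P (`]@grid R n i, @grid R n i.+1]%classic `&` ~` E_ j) <= c%:E)%E.
  move=> lin; have mi := moc (@grid R n i) (@grid R n i.+1).
  have [[t [tI tE]]|N] := pselect (exists t, (`]@grid R n i, @grid R n i.+1]%classic `&` ~` E_ j) t); last first.
    rewrite (_ : _ `&` _ = set0) ?measure0 ?lee_fin//.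
    by apply/seteqP; split => t // h; apply: N; exists t.
  have s0 := @grid_ge0 R n i; have st := @grid_le R n _ _ (leqnSn i); have t2 := @grid_le2pi R n _ lin.
  apply: (@le_trans _ _ (P `]@grid R n i, @grid R n i.+1]%classic)).
    by apply: le_measure; rewrite ?inE//; exact: measurableI.
  apply: (le_trans (arcP j.+1 s0 st t2)); rewrite lee_fin lerD2r.
  have ft x : @grid R n i <= x <= @grid R n i.+1 -> dens b j.+1 x <= 2 * @eps_ R j.
    move=> /andP[sx xt].
    have tlt : bdry (bpoly b j.+1) t < @eps_ R j by rewrite ltNge; exact/negP.
    move: tI; rewrite /= in_itv/= => /andP[tl tr].
    have dS := @gridS R n i.
    have t02 : 0 <= t <= 2 * pi by rewrite (le_trans s0 (ltW tl)) (le_trans tr t2).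
    have xd : `|x - t| <= 2 * pi / n%:R by rewrite ler_norml; apply/andP; split; lra.
    by have := osc t x t02 xd; rewrite ler_norml /dens => /andP[_]; lra.
  apply: (le_trans (dens_cdf_incr_le s0 st ft)); rewrite gridS mulrCA.
  have -> : (2 * pi)^-1 * (2 * pi / n%:R) = n%:R^-1 :> R by rewrite mulKf// tau_neq0.
  exact: lexx.
have ind m : (m <= n)%N -> (P (`]0%R, @grid R n m]%classic `&` ~` E_ j) <= (m%:R * c)%:E)%E.
  elim: m => [|m ih] mn.
    by rewrite grid0 mul0r set_itvoc0 set0I measure0.
  have -> : `]0%R, @grid R n m.+1]%classic `&` ~` E_ j =
    (`]0%R, @grid R n m]%classic `&` ~` E_ j) `|` (`]@grid R n m, @grid R n m.+1]%classic `&` ~` E_ j).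
    rewrite -setIUl; congr (_ `&` _); rewrite -itv_bndbnd_setU// bnd_simp.
      exact: grid_ge0.
    exact: grid_le.
  apply: (@le_trans _ _ (P (`]0%R, @grid R n m]%classic `&` ~` E_ j) + P (`]@grid R n m, @grid R n m.+1]%classic `&` ~` E_ j))%E).
    by apply: measureU2; exact: measurableI.
  by rewrite -natr1 mulrDl mul1r EFinD; apply: leeD; [exact/ih/ltnW|exact: arc].
have := ind n (leqnn _); rewrite gridn// => h.
have mo := moc 0 (2 * pi).
apply: (@le_trans _ _ (P (`]0%R, (2 * pi)%R]%classic `&` ~` E_ j) + P (~` `]0%R, (2 * pi)%R]%classic))%E).
  apply: (@le_trans _ _ (P ((`]0%R, (2 * pi)%R]%classic `&` ~` E_ j) `|` ~` `]0%R, (2 * pi)%R]%classic))).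
    apply: le_measure; rewrite ?inE//.
      by apply: measurableU; [exact: measurableI|exact: measurableC].
    by move=> t tE; have [h1|h1] := pselect (`]0%R, (2 * pi)%R]%classic t); [left|right].
  by apply: measureU2; [exact: measurableI|exact: measurableC].
rewrite outP adde0; apply: (le_trans h); rewrite lee_fin /c.
move: nt; move: (berr b j.+1) => x nt.
have -> : n%:R * (2 * @eps_ R j / n%:R + 4 * x) = 2 * @eps_ R j + 4 * (n%:R * x).
  by field; rewrite gt_eqF.
lra.
Qed.

Lemma sum_eps N : \sum_(n < N) @eps_ R n <= 1.
Proof.
suff -> : \sum_(n < N) @eps_ R n = 1 - (1 / 2) ^+ N by rewrite lerBlDr lerDl exprn_ge0// divr_ge0.
elim: N => [|N ih]; first by rewrite big_ord0 expr0 subrr.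
rewrite big_ord_recr/= ih /eps_ exprS; move: (_ ^+ N) => q; lra.
Qed.

Lemma lebesgue_limsup :
  lebesgue_measure (`[0%R, (2 * pi)%R[ `&` lim_sup_set E_) = 0%E.
Proof.
pose F j := `[0%R, (2 * pi)%R[%classic `&` E_ j.
have -> : `[0%R, (2 * pi)%R[ `&` lim_sup_set E_ = lim_sup_set F.
  apply/seteqP; split => t.
    by move=> [tI tE] n _; have [j jn Ej] := tE n I; exists j.
  move=> tF; split; first by have [j _ []] := tF 0%N I.
  by move=> n _; have [j jn []] := tF n I; exists j.
apply: lim_sup_set_cvg0.
  by move=> k; apply: measurableI; [exact: measurable_itv|exact: measurable_E].
apply: (@le_lt_trans _ _ ((2 * pi)%:E)); last exact: ltry.
apply: nneseries_le => [n|N]; first exact: measure_ge0.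
apply: (@le_trans _ _ (\sum_(n < N) (@eps_ R n * (2 * pi))%:E)%E).
  by apply: lee_sum => n _; exact: (b_concentrated b n).
rewrite sumEFin lee_fin -mulr_suml -[leRHS]mul1r ler_wpM2r ?tau_ge0//.
exact: sum_eps.
Qed.

Lemma eps_small (e : R) n : 0 < e -> exists2 j, (n <= j)%N & 6 * @eps_ R j <= e.
Proof.
move=> e0.
have [N H] := @expr_small R (1 / 2) (e / 6) ltac:(lra) ltac:(lra) (divr_gt0 e0 (ltr0Sn R 5)).
exists (maxn n N); first exact: leq_maxl.
by have := H (maxn n N).+1 (leqW (leq_maxr _ _)); rewrite /eps_; lra.
Qed.

(** The carrier is the upper limit of the closed sets where [f_{j+1} >= eps_j]. It is null for the Lebesgue measure by the lemma of
Borel and Cantelli, and its complement is a countable union of sets whose measure is at most [6 eps_j] for all large [j]. *)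
Theorem nuP_singular : singular_to_lebesgue (nuP P).
Proof.
exists (lim_sup_set B_); split.
- apply: bigcap_measurable => // k _; apply: bigcup_measurable => j _; exact: measurable_B.
- have pE : (@expi R) @^-1` (lim_sup_set B_) = lim_sup_set E_.
    rewrite /lim_sup_set preimage_bigcap; apply: eq_bigcapr => n _.
    by rewrite preimage_bigcup; apply: eq_bigcupr => j _; exact: preimage_B.
  by rewrite /circle_lebesgue pE lebesgue_limsup mule0.
change (P ((@expi R) @^-1` (~` lim_sup_set B_)) = 0%E).
pose G n : set (measurableTypeR R) := \bigcap_(j in [set j | (n <= j)%N]) ~` E_ j.
have mG n : measurable (G n).
  by apply: bigcap_measurable; [exists n => /=|move=> j _; apply: measurableC; exact: measurable_E].
have -> : (@expi R) @^-1` (~` lim_sup_set B_) = \bigcup_n G n.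
  rewrite /lim_sup_set setC_bigcap preimage_bigcup; apply: eq_bigcupr => n _.
  rewrite setC_bigcup preimage_bigcap; apply: eq_bigcapr => j _.
  by rewrite -(preimage_B j).
apply/negligibleP; first exact: bigcup_measurable.
apply: negligible_bigcup => n; apply/negligibleP; first exact: mG.
apply/eqP; rewrite eq_le measure_ge0 andbT; apply/lee_addgt0Pr => e e0; rewrite add0e.
have [j nj je] := eps_small n e0.
apply: (@le_trans _ _ (P (~` E_ j))).
  apply: le_measure; rewrite ?inE//; first by apply: measurableC; exact: measurable_E.
  by move=> t; apply.
by apply: (le_trans (low_measure j)); rewrite lee_fin.
Qed.

End Singular.

(** * Density *)

Section Inner.
Context {R : realType}.
Local Notation C := (Cplx R).
Variables (Q : nat -> {poly C} -> R -> Prop) (b : blueprint Q).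
Variable P : probability (measurableTypeR R) R.
Hypothesis outP : P (~` `]0%R, (2 * pi)%R]%classic) = 0%E.
Hypothesis arcP : forall k s t, 0 <= s -> s <= t -> t <= 2 * pi ->
        (P `]s, t]%classic <= (dens_cdf b k t - dens_cdf b k s + 4 * berr b k)%:E)%E.

(** The exponent [Hlim] is the integral of the kernel against the image measure, by change of variables. *)
Theorem theta_singular_inner : singular_inner (theta P).
Proof.
exists (nuP P); split; last 1 first.
- move=> z /discP z1; rewrite /theta circle_integralE; congr (expC (- _)).
  have [mr mi] := measurable_kernel z1.
  have ch := ccont_herg z1.
  have br t : `|reC (herg z t)| <= 2 / (1 - modulus z).
    exact: le_trans (le_re _) (herg_bound t z1).
  have bi t : `|imC (herg z t)| <= 2 / (1 - modulus z).
    exact: le_trans (le_im _) (herg_bound t z1).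
  have er t : reC ((val (expi t) + z) / (val (expi t) - z)) = reC (herg z t) by rewrite val_expi.
  have ei t : imC ((val (expi t) + z) / (val (expi t) - z)) = imC (herg z t) by rewrite val_expi.
  by rewrite /Hlim (nuP_integral P mr er (cont_re ch) br) (nuP_integral P mi ei (cont_im ch) bi).
- have -> : nuP P [set: borel_circle R] = 1%E by exact: probability_setT.
  exact: oner_neq0.
- exact: nuP_singular outP arcP.
Qed.

End Inner.

Section YoungFun.
Context {R : realType}.
Variable Psi : R -> R.
Hypothesis hPsi : young_function Psi.

Lemma young_convex (t x y : R) : 0 <= t -> t <= 1 -> 0 <= x -> 0 <= y ->
  Psi (t * x + (1 - t) * y) <= t * Psi x + (1 - t) * Psi y.
Proof.
move=> t0 t1 x0 y0; have [h _ _ _] := hPsi.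
have xI : x \in (`[0, +oo[%classic : set R) by rewrite inE /= in_itv/= x0.
have yI : y \in (`[0, +oo[%classic : set R) by rewrite inE /= in_itv/= y0.
by have := h (Itv01 t0 t1) x y xI yI; rewrite !convRE.
Qed.

Lemma young0 : Psi 0 = 0. Proof. by have [] := hPsi. Qed.
Lemma young_gt0 x : 0 < x -> 0 < Psi x. Proof. by have [_ _ + _] := hPsi; exact. Qed.
Lemma young_ge0 x : 0 <= x -> 0 <= Psi x.
Proof. by rewrite le_eqVlt => /orP[/eqP<-|/young_gt0/ltW//]; rewrite young0. Qed.

(** Convexity between [0] and [y]. *)
Lemma young_mono x y : 0 <= x -> x <= y -> Psi x <= Psi y.
Proof.
move=> x0; rewrite le_eqVlt => /orP[/eqP->//|xy].
have y0 : 0 < y := le_lt_trans x0 xy.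
have t0 : 0 <= x / y by rewrite divr_ge0// ltW.
have t1 : x / y <= 1 by rewrite ler_pdivrMr// mul1r ltW.
have := young_convex t0 t1 (ltW y0) (lexx 0).
rewrite mulr0 addr0 divfK ?gt_eqF// young0 mulr0 addr0 => h; apply: (le_trans h).
by rewrite ler_piMl// young_ge0// ltW.
Qed.

Lemma young_mid x y : 0 <= x -> 0 <= y -> Psi (x + y) <= (Psi (2 * x) + Psi (2 * y)) / 2.
Proof.
move=> x0 y0.
have h := @young_convex (1 / 2) (2 * x) (2 * y) ltac:(lra) ltac:(lra) ltac:(lra) ltac:(lra).
have e : 1 / 2 * (2 * x) + (1 - 1 / 2) * (2 * y) = x + y by field.
by rewrite e in h; lra.
Qed.

Lemma young_double : exists C d : R, [/\ 1 <= C, 0 < d & forall x, 0 <= x -> x < d -> Psi (2 * x) <= C * Psi x].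
Proof.
have [_ _ _ [c [C [c0 C0 H]]]] := hPsi.
have [d /= d0 Hd] := H; exists (C + 1), d; split; [lra|exact: d0|].
move=> x; rewrite le_eqVlt => /orP[/eqP<- _|x0 xd]; first by rewrite mulr0 young0 mulr0.
have : ball 0 d x by rewrite /ball /= sub0r normrN ger0_norm// ltW.
move=> /Hd/(_ x0)/andP[_ h]; apply: (le_trans h).
by rewrite ler_wpM2r ?young_ge0 ?(ltW x0)//; lra.
Qed.

(** The doubling condition iterated; the radius shrinks with [m]. *)
Lemma young_pow2 m : exists C d : R, [/\ 1 <= C, 0 < d & forall x, 0 <= x -> x < d -> Psi (2 ^+ m * x) <= C * Psi x].
Proof.
have [C [d [C1 d0 H]]] := young_double.
elim: m => [|m [C' [d' [C1' d0' H']]]].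
  by exists 1, 1; split=> // x _ _; rewrite expr0 !mul1r.
have p0 : 0 < (2 : R) ^+ m by rewrite exprn_gt0.
exists (C * C'), (Num.min d' (d / 2 ^+ m)); split.
- by rewrite -[1]mulr1 ler_pM.
- by rewrite lt_min d0' divr_gt0.
move=> x x0; rewrite lt_min ltr_pdivlMr// => /andP[xd' xd].
have px0 : 0 <= 2 ^+ m * x by apply: mulr_ge0 => //; exact: ltW.
rewrite exprS -mulrA; apply: (le_trans (H _ px0 _)); first by rewrite mulrC.
by rewrite -mulrA ler_wpM2l ?H'//; lra.
Qed.

Lemma young_scale (s : R) : 0 <= s -> exists C d : R, [/\ 1 <= C, 0 < d & forall x, 0 <= x -> x < d -> Psi (s * x) <= C * Psi x].
Proof.
move=> s0; have [m Hm] : exists m : nat, s <= 2 ^+ m.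
  exists (Num.bound s); apply: (le_trans (ltW (archi_boundP s0))).
  by rewrite -natrX ler_nat ltnW// ltn_expl.
have [C [d [C1 d0 H]]] := young_pow2 m; exists C, d; split => // x x0 xd.
apply: le_trans (H x x0 xd).
by apply: young_mono; [exact: mulr_ge0|rewrite ler_wpM2r].
Qed.

Hypothesis hPsi2 : decreases_to_0_at_0 (fun x : R => Psi x / x ^+ 2).

(** The form in which the hypothesis on [Psi x / x^2] is used. *)
Lemma young_quad (c : R) : 0 < c -> exists2 d : R, 0 < d & forall y, 0 <= y -> y < d -> Psi y <= c * y ^+ 2.
Proof.
move=> c0; have [_ /cvgRP/(_ _ c0) [d /= d0 H]] := hPsi2.
exists d; first exact: d0.
move=> y; rewrite le_eqVlt => /orP[/eqP<- _|y0 yd]; first by rewrite young0 expr0n mulr0.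
have : ball 0 d y by rewrite /ball /= sub0r normrN ger0_norm// ltW.
have y20 : 0 < y ^+ 2 by rewrite exprn_gt0.
move=> /H/(_ y0); rewrite subr0 ger0_norm; last by rewrite divr_ge0 ?young_ge0// ltW.
by rewrite ltr_pdivrMr// => /ltW.
Qed.

(** Partial sums close to their supremum leave small tails. *)
Lemma series_small (u : nat -> R) (B : R) : (forall n, 0 <= u n) -> (forall N, \sum_(n < N) u n <= B) ->
  forall e : R, 0 < e -> exists K, forall N, \sum_(n < N) (if (n < K)%N then 0 else u n) <= e.
Proof.
move=> u0 uB e e0.
pose A : set R := range (fun N => \sum_(n < N) u n).
have sA : has_sup A.
  by split; [exists (\sum_(n < 0) u n); exists 0%N|exists B => _ [N _ <-]].
have [_ [K _ <-] HK] := sup_adherent e0 sA.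
exists K => N.
have h : \sum_(n < maxn K N) u n <= sup A by apply: (ub_le_sup sA.2); exists (maxn K N).
have -> : \sum_(n < N) (if (n < K)%N then 0 else u n) = \sum_(0 <= n < N) (if (n < K)%N then 0 else u n).
  by rewrite big_mkord.
move: h; rewrite -!(big_mkord xpredT) => h; move: HK; rewrite -(big_mkord xpredT) => HK.
have h2 : \sum_(0 <= n < N) (if (n < K)%N then 0 else u n) <= \sum_(0 <= n < maxn K N) (if (n < K)%N then 0 else u n).
  rewrite (@big_cat_nat _ _ _ N 0 (maxn K N))//= ?leq_maxr// lerDl.
  by apply: sumr_ge0 => n _; case: ifP.
apply: (le_trans h2); rewrite (@big_cat_nat _ _ _ K 0 (maxn K N))//= ?leq_maxl//.
rewrite big_nat big1 ?add0r; last by move=> n /andP[_ ->].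
move: h; rewrite (@big_cat_nat _ _ _ K 0 (maxn K N))//= ?leq_maxl//.
rewrite [X in _ + X <= _ -> _](_ : _ = \sum_(K <= n < maxn K N) (if (n < K)%N then 0 else u n)).
  by set q := \sum_(K <= _ < _) _ in HK *; lra.
by apply: eq_big_nat => n /andP[Kn _]; rewrite ltnNge Kn.
Qed.

Lemma partial_le (u : nat -> R) N : (forall n, 0 <= u n) -> (\sum_(0 <= n <oo) (u n)%:E < +oo)%E ->
  \sum_(n < N) u n <= fine (\sum_(0 <= n <oo) (u n)%:E)%E.
Proof.
move=> u0 fin.
have f : (\sum_(0 <= n <oo) (u n)%:E)%E \is a fin_num.
  by rewrite ge0_fin_numE//; apply: nneseries_ge0 => n _ _; rewrite lee_fin.
rewrite -lee_fin fineK// -sumEFin -(big_mkord xpredT (fun n => (u n)%:E)).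
by apply: nneseries_lim_ge => n _ _; rewrite lee_fin.
Qed.

Lemma young_tends0 (u : nat -> R) (B : R) : (forall n, 0 <= u n) -> (forall N, \sum_(n < N) Psi (u n) <= B) ->
  forall d : R, 0 < d -> exists K, forall n, (K <= n)%N -> u n < d.
Proof.
move=> u0 uB d d0; have p0 := young_gt0 d0.
have [K HK] := series_small (fun n => young_ge0 (u0 n)) uB (divr_gt0 p0 (ltr0Sn R 1)).
exists K => n Kn; rewrite ltNge; apply/negP => du.
have := HK n.+1; rewrite big_ord_recr /= ltnNge Kn /=.
have : 0 <= \sum_(i < n) (if (i < K)%N then 0 else Psi (u i)).
  by apply: sumr_ge0 => i _; case: ifP => // _; exact: young_ge0.
have := young_mono (ltW d0) du; move: p0.
set q := \sum_(i < n) _; lra.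
Qed.

(** The coefficients of a bounded function are square summable, and [Psi x <= x^2] near [0]. *)
Lemma bounded_modular (f : Cplx R -> Cplx R) (B : R) : holo f ->
  (forall z : Cplx R, modulus z < 1 -> modulus (f z) <= B) -> orlicz_space Psi f.
Proof.
move=> hf fB; split; first by move=> z /discP; exact: hf.
have [d d0 Hd] := young_quad (@ltr01 R).
have [N0 HN0] := tcoef_tends0 hf fB (divr_gt0 d0 (ltr0Sn R 1)).
pose u n : R := modulus (tcoef f n).
have u0 n : 0 <= Psi (u n) by apply: young_ge0; exact: modulus_ge0.
pose S := \sum_(n < N0) Psi (u n).
apply: (@le_lt_trans _ _ (S + B ^+ 2)%:E); last exact: ltry.
apply: nneseries_le => [n|N]; first by rewrite lee_fin taylor_coef_tcoef// u0.
rewrite sumEFin lee_fin (eq_bigr (fun n : 'I_N => Psi (u n))); last by move=> n _; rewrite taylor_coef_tcoef.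
apply: (@le_trans _ _ (\sum_(n < N) ((if (n < N0)%N then Psi (u n) else 0) + u n ^+ 2))).
  apply: ler_sum => n _; case: ltnP => [_|nN].
    by rewrite lerDl exprn_ge0// modulus_ge0.
  rewrite add0r -[leRHS]mul1r; apply: Hd; first exact: modulus_ge0.
  by apply: (le_lt_trans (HN0 n nN)); lra.
rewrite big_split; apply: lerD; last exact: (tcoef_bessel N hf fB).
rewrite -(big_mkord xpredT (fun n => if (n < N0)%N then Psi (u n) else 0)) /S.
rewrite -(big_mkord xpredT (fun n => Psi (u n))).
apply: (@le_trans _ _ (\sum_(0 <= n < maxn N N0) (if (n < N0)%N then Psi (u n) else 0))).
  rewrite [leRHS](@big_cat_nat _ _ _ N 0 (maxn N N0))//= ?leq_maxl// lerDl.
  by apply: sumr_ge0 => n _; case: ifP.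
rewrite (@big_cat_nat _ _ _ N0 0 (maxn N N0))//= ?leq_maxr//.
rewrite [X in _ + X](_ : _ = 0) ?addr0; last first.
  by apply: big1_seq => n; rewrite mem_index_iota => /and3P[_ Nn _]; rewrite ltnNge Nn.
by rewrite [leLHS]big_nat [leRHS]big_nat; apply: ler_sum => n /andP[_ ->].
Qed.

(** The tolerance [D] for the polynomial [H]: with [Cb] a bound for [exp H] on the disc, [Psi y / y^2] has to be negligible
against [(k Cb)^-2] up to [2 k D]. The factor [3 Cb] bounds [1 - p Theta] in [near_one], and the factor [k]
absorbs the polynomial and the scale that occur in [span_approx]. *)
Definition anchor_spec k (H : {poly Cplx R}) (D : R) : Prop := D <= 1 /\ exists Cb : R,
  [/\ 1 <= Cb, (forall z : Cplx R, modulus z < 1 -> modulus (expC H.[z]) <= Cb) &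
   forall y, 0 <= y -> y <= 2 * k%:R * D -> (k%:R * (3 * Cb)) ^+ 2 * Psi y <= y ^+ 2 / 4].

Lemma anchor_spec_ex k H : exists2 D : R, 0 < D & anchor_spec k H D.
Proof.
have [Cb Cb1 HCb] := exp_poly_bound H.
pose A := (k%:R * (3 * Cb)) ^+ 2.
have A0 : 0 <= A by exact: sqr_ge0.
have c0 : 0 < (4 * (A + 1))^-1 by rewrite invr_gt0 mulr_gt0//; lra.
have [d d0 Hd] := young_quad c0.
have k0 : 0 < 2 * k%:R + 1 :> R by rewrite ltr_wpDl// mulr_ge0.
pose D := Num.min 1 (d / (2 * k%:R + 1) / 2).
have D0 : 0 < D by rewrite lt_min ltr01 !divr_gt0.
have Dd : D * (2 * k%:R + 1) < d.
  rewrite -ltr_pdivlMr//; have : D <= d / (2 * k%:R + 1) / 2 by rewrite ge_min lexx orbT.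
  by have := divr_gt0 d0 k0; lra.
exists D => //; split; first by rewrite ge_min lexx.
exists Cb; split => // y y0 yD.
have yd : y < d by apply: le_lt_trans Dd; rewrite mulrDr mulr1; lra.
have h := Hd y y0 yd; rewrite -/A.
apply: (@le_trans _ _ (A * ((4 * (A + 1))^-1 * y ^+ 2))); first by rewrite ler_wpM2l.
have -> : A * ((4 * (A + 1))^-1 * y ^+ 2) = (A / (A + 1)) * (y ^+ 2 / 4) by field; rewrite gt_eqF//; lra.
rewrite -[leRHS]mul1r ler_wpM2r//; first by rewrite divr_ge0// sqr_ge0.
by rewrite ler_pdivrMr; lra.
Qed.

End YoungFun.

Section Coefs.
Context {R : realType}.
Local Notation C := (Cplx R).

Lemma has_coefs_shiftn (a : nat -> C) (h : C -> C) j : has_coefs a h ->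
  has_coefs (fun n => if (j <= n)%N then a (n - j)%N else 0) (fun z => z ^+ j * h z).
Proof.
move=> ah; elim: j => [|j ih].
  apply: (has_coefs_eqa (has_coefs_eq ah _)) => [z _|n]; first by rewrite expr0 mul1r.
  by rewrite leq0n subn0.
apply: (has_coefs_eqa (has_coefs_eq (has_coefs_shift ih) _)) => [z _|[|n]//].
by rewrite exprS mulrA.
Qed.

Lemma has_coefs_sum (c : nat -> C) (a : nat -> nat -> C) (F : nat -> C -> C) m :
  (forall j, has_coefs (a j) (F j)) ->
  has_coefs (fun n => \sum_(j < m) c j * a j n) (fun z => \sum_(j < m) c j * F j z).
Proof.
move=> H; elim: m => [|m ih].
  apply: (has_coefs_eqa (has_coefs_eq (has_coefs_poly 0) _)) => [z _|n].
    by rewrite horner0 big_ord0.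
  by rewrite coef0 big_ord0.
apply: (has_coefs_eqa (has_coefs_eq (has_coefsD ih (has_coefsZ (c m) (H m))) _)) => [z _|n];
  by rewrite big_ord_recr.
Qed.

(** A polynomial multiplier acts on coefficients by a convolution with finitely many terms. *)
Lemma tcoef_polymul (q : {poly C}) (h : C -> C) (d : R) n : holo h ->
  (forall n, modulus (tcoef h n) <= d) -> modulus (tcoef (fun z => q.[z] * h z) n) <= pnorm q * d.
Proof.
move=> hh hd; have d0 : 0 <= d := le_trans (modulus_ge0 _) (hd 0%N).
have H := has_coefs_sum (fun j => q`_j) (size q) (fun j => has_coefs_shiftn j (taylor hh)).
rewrite (tcoefE (has_coefs_eq H _)); last first.
  by move=> z _; rewrite horner_coef mulr_suml; apply: eq_bigr => j _; rewrite mulrA.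
apply: (le_trans (modulus_sum _ _ _)); rewrite /pnorm mulr_suml.
apply: ler_sum => j _; rewrite modulusM ler_wpM2l ?modulus_ge0//.
by case: ifP; rewrite ?hd// modulus0.
Qed.

End Coefs.

Section Density.
Context {R : realType}.
Local Notation C := (Cplx R).
Variable Psi : R -> R.
Hypothesis hPsi : young_function Psi.
Hypothesis hPsi2 : decreases_to_0_at_0 (fun x : R => Psi x / x ^+ 2).
Variable b : blueprint (anchor_spec Psi).
Variable P : probability (measurableTypeR R) R.
Hypothesis weakP : forall (phi : R -> R) (M : R), rcont phi -> (forall t, `|phi t| <= M) ->
        forall e : R, 0 < e -> exists k0, forall k, (k0 <= k)%N ->
        `|\int[P]_x phi x - RMean (fun t => phi t * bdry (bpoly b k) t)| <= e.

Local Notation Theta := (theta P).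
Local Notation shifts := (range (fun (n : nat) (z : C) => z ^+ n * Theta z)).

Let hTheta : holo Theta. Proof. exact: (holo_theta weakP). Qed.
Let Theta1 (z : C) : modulus z < 1 -> modulus (Theta z) <= 1. Proof. exact: (theta_le1 weakP). Qed.

Lemma span_poly (q : {poly C}) : linear_span shifts (fun z => q.[z] * Theta z).
Proof.
exists (size q), (fun i => q`_i), (fun i z => z ^+ i * Theta z); split; first by move=> i; exists (i : nat).
by apply/funext => z; rewrite horner_coef mulr_suml; apply: eq_bigr => i _; rewrite mulrA.
Qed.

(** Elements of the span are bounded on the disc. *)
Lemma span_sub : linear_span shifts `<=` orlicz_space Psi.
Proof.
move=> _ [n [a [F [HF ->]]]].
have hF i : holo (F i) /\ forall z : C, modulus z < 1 -> modulus (F i z) <= 1.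
  have [m _ <-] := HF i; split.
    exact: (@holoM R _ _ (@holoX R _ m (@entire_holo R _ (@entire_id R))) hTheta).
  move=> z z1; rewrite modulusM -[leRHS]mulr1; apply: ler_pM.
  - exact: modulus_ge0.
  - exact: modulus_ge0.
  - by rewrite modulusX exprn_ile1 ?modulus_ge0// ltW.
  - exact: Theta1.
apply: (@bounded_modular R Psi hPsi hPsi2 _ (\sum_(i < n) modulus (a i))).
  apply: holo_sum => i; exact: (@holoM R _ _ (@holo_cst R (a i)) (hF i).1).
move=> z z1; apply: (le_trans (modulus_sum _ _ _)); apply: ler_sum => i _.
by rewrite modulusM -[leRHS]mulr1 ler_wpM2l ?modulus_ge0// (hF i).2.
Qed.

(** [1 - p Theta = (1 - F Theta) + (F - p) Theta] with [F = exp (bpoly k)]; the first term has coefficients at most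
[btol k], by [anchor_coef] and because its value at [0] is [0], the second one is at most [btol k] on the disc. *)
Lemma near_one k : exists p : {poly C}, exists Cb : R,
  [/\ 1 <= Cb,
   forall y, 0 <= y -> y <= 2 * k%:R * btol b k -> (k%:R * (3 * Cb)) ^+ 2 * Psi y <= y ^+ 2 / 4,
   holo (fun z => 1 - p.[z] * Theta z),
   forall z : C, modulus z < 1 -> modulus (1 - p.[z] * Theta z) <= 3 * Cb &
   forall n, modulus (tcoef (fun z => 1 - p.[z] * Theta z) n) <= 2 * btol b k].
Proof.
have [D0 [D1 [Cb [Cb1 HCb HPsi]]]] := b_Q b k.
have eE : entire (fun z : C => expC (bpoly b k).[z]) := @entire_exp R _ (@entire_poly R (bpoly b k)).
have [p Hp] := entire_approx eE D0.
have hp : holo (fun z : C => p.[z] * Theta z) := @holoM R _ _ (@holo_poly R p) hTheta.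
have h1 : holo (fun z : C => 1 - Ftheta b P k z) := @holoB R _ _ (@holo_cst R 1) (@holo_Ftheta R _ b P weakP k).
have h2 : holo (fun z : C => (expC (bpoly b k).[z] - p.[z]) * Theta z).
  exact: (@holoM R _ _ (@holoB R _ _ (@entire_holo R _ eE) (@holo_poly R p)) hTheta).
have b2 (z : C) : modulus z < 1 -> modulus ((expC (bpoly b k).[z] - p.[z]) * Theta z) <= btol b k.
  move=> z1; rewrite modulusM -[leRHS]mulr1.
  exact: ler_pM (modulus_ge0 _) (modulus_ge0 _) (Hp z z1) (Theta1 z1).
have E (z : C) : 1 - p.[z] * Theta z = 1 - Ftheta b P k z + (expC (bpoly b k).[z] - p.[z]) * Theta z.
  by rewrite FthetaE mulrBl addrA subrK.
exists p, Cb; split; [exact: Cb1|exact: HPsi| | |].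
- exact: (@holoB R _ _ (@holo_cst R 1) hp).
- move=> z z1; rewrite E; apply: (le_trans (modulusD _ _)).
  have := Ftheta_bound weakP HCb z1; have := b2 z z1.
  by have := modulusB 1 (Ftheta b P k z); rewrite modulus1; lra.
move=> n; have -> : (fun z : C => 1 - p.[z] * Theta z) =
    (fun z => (1 - Ftheta b P k z) + (expC (bpoly b k).[z] - p.[z]) * Theta z) by apply/funext.
rewrite (tcoefD n h1 h2); apply: (le_trans (modulusD _ _)).
have t2 := tcoef_le n (ltW D0) h2 b2.
suff : modulus (tcoef (fun z : C => 1 - Ftheta b P k z) n) <= btol b k by lra.
rewrite (tcoefB n (@holo_cst R 1) (@holo_Ftheta R _ b P weakP k)).
have c1 m : tcoef (fun=> 1 : C) m = (m == 0%N)%:R.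
  rewrite (tcoefE (has_coefs_eq (has_coefs_poly 1) _)) ?coef1//.
  by move=> z _; rewrite hornerC.
rewrite c1; case: n {t2} => [|n].
  have F0 : tcoef (Ftheta b P k) 0 = 1.
    rewrite -(has_coefs0 (taylor (@holo_Ftheta R _ b P weakP k))) /Ftheta.
    rewrite (has_coefs0 (Hlim_coefs weakP)) /hlim horner_coef0.
    by rewrite (b_carath b k).1 (b_carath b 0).1 subrr expC0.
  by rewrite F0 subrr modulus0 ltW.
by rewrite sub0r modulusN; exact: (anchor_coef weakP).
Qed.

(** [f] is approximated by [P p Theta], with [P] a Taylor polynomial of [f] and [p Theta] close to [1]. The difference is the tail of
[f], which is small by the doubling condition, plus [P (1 - p Theta)], whose coefficients are both square summable and
small; by [anchor_spec], applied with [k] large, their modular is small. *)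
Lemma span_approx (f : C -> C) (eps : R) : orlicz_space Psi f -> 0 < eps ->
  exists2 g, linear_span shifts g & (orlicz_norm Psi (f \- g)%R < eps%:E)%E.
Proof.
move=> [hf0 ff] eps0; have hf : holo f by move=> z /discP; exact: hf0.
pose M := eps / 2; have M0 : 0 < M by rewrite divr_gt0.
(* the factor 2 comes from splitting the modular of a sum by convexity *)
pose s := 2 / M; have s0 : 0 < s by rewrite divr_gt0.
pose u n := modulus (tcoef f n); have u0 n : 0 <= u n by exact: modulus_ge0.
have ff' : (\sum_(0 <= n <oo) (Psi (u n))%:E < +oo)%E.
  by move: ff; congr (_ < _)%E; apply: eq_eseriesr => n _; rewrite taylor_coef_tcoef.
have uB N := partial_le N (fun n => young_ge0 hPsi (u0 n)) ff'.
have [C0 [d [C1 d0 Hd]]] := young_scale hPsi (ltW s0).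
have Cp : 0 < C0 by lra.
have [K1 HK1] := young_tends0 hPsi u0 uB d0.
have [K2 HK2] := series_small (fun n => young_ge0 hPsi (u0 n)) uB (divr_gt0 (@ltr01 R) Cp).
pose K := maxn K1 K2.
pose v n : C := if (n < K)%N then 0 else tcoef f n.
have vsum N : \sum_(n < N) Psi (s * modulus (v n)) <= 1.
  have -> : 1 = C0 * (1 / C0) :> R by rewrite mulrCA divff ?mulr1// gt_eqF.
  apply: (@le_trans _ _ (C0 * \sum_(n < N) (if (n < K2)%N then 0 else Psi (u n)))); last by rewrite ler_wpM2l// ltW.
  rewrite mulr_sumr; apply: ler_sum => n _; rewrite /v; case: (ltnP n K) => nK.
    rewrite modulus0 mulr0 (young0 hPsi) mulr_ge0 ?(ltW Cp)//.
    by case: ifP => // _; exact: young_ge0.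
  have [n1 n2] : (K1 <= n)%N /\ (K2 <= n)%N by move: nK; rewrite /K geq_max => /andP.
  by rewrite (leq_gtF n2); apply: Hd (u0 n) (HK1 n n1).
pose PK : {poly C} := \poly_(i < K) tcoef f i.
pose A := pnorm PK + 1.
have A1 : 1 <= A by rewrite lerDr pnorm_ge0.
have A0 : 0 < A by lra.
(* k exceeds the factor by which PK and the scale s enlarge coefficients *)
pose k := Num.bound (s * A).
have kA : s * A <= k%:R by apply/ltW/archi_boundP/ltW/mulr_gt0.
have sA0 : 0 < s * A by exact: mulr_gt0.
have k0 : 0 < k%:R :> R by exact: lt_le_trans sA0 kA.
have [p [Cb [Cb1 HPsi hh hb hc]]] := near_one k.
pose h z : C := 1 - p.[z] * Theta z.
have D0 : 0 < btol b k by have [] := b_Q b k.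
have hPh : holo (fun z => PK.[z] * h z) := @holoM R _ _ (@holo_poly R PK) hh.
pose c n := tcoef (fun z => PK.[z] * h z) n.
have cle n : modulus (c n) <= A * (2 * btol b k).
  apply: (le_trans (tcoef_polymul PK n hh hc)); rewrite ler_wpM2r ?lerDl//.
  by rewrite mulr_ge0// ltW.
have cb (z : C) : modulus z < 1 -> modulus (PK.[z] * h z) <= A * (3 * Cb).
  move=> z1; rewrite modulusM; apply: ler_pM (modulus_ge0 _) (modulus_ge0 _) _ (hb z z1).
  by apply: (le_trans (poly_le_pnorm PK (ltW z1))); rewrite lerDl.
have csq N := tcoef_bessel N hPh cb.
have csum N : \sum_(n < N) Psi (s * modulus (c n)) <= 1.
  pose X := k%:R * (3 * Cb).
  have X0 : 0 < X by rewrite mulr_gt0//; lra.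
  have X2 : 0 < X ^+ 2 by rewrite exprn_gt0.
  rewrite -(ler_pM2l X2) mulr1 mulr_sumr.
  apply: (@le_trans _ _ (\sum_(n < N) (s ^+ 2 / 4) * modulus (c n) ^+ 2)).
    apply: ler_sum => n _.
    have -> : s ^+ 2 / 4 * modulus (c n) ^+ 2 = (s * modulus (c n)) ^+ 2 / 4 by move: (modulus (c n)) (s) => q r; field.
    apply: HPsi; first by apply: mulr_ge0 (ltW s0) (modulus_ge0 _).
    apply: (@le_trans _ _ (s * (A * (2 * btol b k)))); first by rewrite ler_wpM2l// ltW.
    have D20 : 0 <= 2 * btol b k by rewrite mulr_ge0// ltW.
    have -> : s * (A * (2 * btol b k)) = s * A * (2 * btol b k) by rewrite [LHS]mulrA.
    have -> : 2 * k%:R * btol b k = k%:R * (2 * btol b k) by rewrite [RHS]mulrCA [RHS]mulrA.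
    exact: ler_wpM2r D20 _ _ kA.
  rewrite -mulr_sumr; apply: (@le_trans _ _ (s ^+ 2 / 4 * (A * (3 * Cb)) ^+ 2)).
    by apply: ler_wpM2l (csq N); apply: mulr_ge0 => //; exact: sqr_ge0.
  have -> : s ^+ 2 / 4 * (A * (3 * Cb)) ^+ 2 = (s * A * (3 * Cb)) ^+ 2 / 4.
    by move: (s) (A) => r w; field.
  have h1 : (s * A * (3 * Cb)) ^+ 2 <= X ^+ 2.
    have c3 : 0 <= 3 * Cb by lra.
    have y0 : 0 <= s * A * (3 * Cb) by exact: mulr_ge0 (ltW sA0) c3.
    by rewrite ler_sqr ?nnegrE ?(ltW X0)// ler_wpM2r.
  by move: h1; have := sqr_ge0 (s * A * (3 * Cb)); lra.
exists (fun z => (PK * p).[z] * Theta z); first exact: span_poly.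
set g := fun z => _.
have E : f \- g = (fun z => (f z - PK.[z]) + PK.[z] * h z).
  by apply/funext => z; rewrite /g /h /= hornerM; move: (f z) (PK.[z]) (p.[z]) (Theta z) => x y w t; ring.
have hfP : holo (fun z => f z - PK.[z]) := @holoB R _ _ hf (@holo_poly R PK).
have tcfg n : taylor_coef (f \- g) n = v n + c n.
  rewrite E taylor_coef_tcoef; last exact: (@holoD R _ _ hfP hPh).
  rewrite (tcoefD n hfP hPh) (tcoefB n hf (@holo_poly R PK)) (tcoefE (has_coefs_poly PK)) coef_poly /v.
  by case: ltnP; rewrite ?subrr ?subr0.
have mod1 : (modular Psi (f \- g)%R M <= 1)%E.
  apply: nneseries_le => [n|N].
    by rewrite lee_fin; apply: (young_ge0 hPsi); apply: divr_ge0 (modulus_ge0 _) (ltW M0).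
  rewrite sumEFin lee_fin.
  apply: (@le_trans _ _ (\sum_(n < N) (Psi (s * modulus (v n)) + Psi (s * modulus (c n))) / 2)).
    apply: ler_sum => n _; rewrite tcfg.
    have h1 : 0 <= modulus (v n) / M := divr_ge0 (modulus_ge0 _) (ltW M0).
    have h2 : 0 <= modulus (c n) / M := divr_ge0 (modulus_ge0 _) (ltW M0).
    have e x : s * x = 2 * (x / M) by rewrite /s; field; rewrite gt_eqF.
    rewrite !e; apply: le_trans (young_mid hPsi h1 h2).
    apply: (young_mono hPsi); first exact: divr_ge0 (modulus_ge0 _) (ltW M0).
    by rewrite -mulrDl ler_wpM2r ?invr_ge0 ?(ltW M0)// modulusD.
  by rewrite -mulr_suml big_split /=; have := vsum N; have := csum N; lra.
apply: (@le_lt_trans _ _ M%:E); last by rewrite lte_fin /M; lra.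
by apply: ereal_inf_lbound; exists M.
Qed.

End Density.

Theorem theorem2p3 (R : realType) (Psi : R -> R)
    (hPsi : young_function Psi)
    (hPsi2 : decreases_to_0_at_0 (fun x : R => Psi x / x ^+ 2)) :
  exists2 Theta : Cplx R -> Cplx R, singular_inner Theta &
    dense_in_orlicz Psi
      (linear_span (range (fun (n : nat) (z : Cplx R) => z ^+ n * Theta z))).
Proof.
have [b] := @blueprint_ex R (anchor_spec Psi) (fun k H _ => anchor_spec_ex hPsi hPsi2 k H).
have [P [weakP outP arcP]] := limit_measure b.
exists (theta P); first exact: theta_singular_inner outP arcP.
split; first exact: (span_sub hPsi hPsi2 weakP).
by move=> f ff eps eps0; exact: (span_approx hPsi weakP ff eps0).
Qed.
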